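(* Let $AN$ be a Damek-Ricci space with Lie algebra $\mathfrak{a}\oplus\mathfrak{n}$, where $\mathfrak{a}$ is one-dimensional and $\mathfrak{n}=\mathfrak{v}\oplus\mathfrak{z}$ is a generalized Heisenberg algebra with center $\mathfrak{z}$. Let $\mathfrak{w}$ be any proper subspace of $\mathfrak{v}$, and let $S_{\mathfrak{w}}$ be the connected subgroup of $AN$ whose Lie algebra is $\mathfrak{s}_{\mathfrak{w}}=\mathfrak{a}\oplus\mathfrak{w}\oplus\mathfrak{z}$. Then, for every $r>0$, the tube $M^r$ of radius $r$ around the submanifold $S_{\mathfrak{w}}$ is an isoparametric hypersurface of $AN$, and it has constant principal curvatures if and only if $\mathfrak{w}^\perp=\mathfrak{v}\ominus\mathfrak{w}$ has constant generalized Kähler angle.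
   Context: **Generalized Heisenberg algebra.** Let $\mathfrak{v},\mathfrak{z}$ be finite-dimensional real vector spaces, $\mathfrak{z}\neq 0$, $\beta:\mathfrak{v}\times\mathfrak{v}\to\mathfrak{z}$ skew-symmetric bilinear, and $\mathfrak{n}=\mathfrak{v}\oplus\mathfrak{z}$ with an inner product for which $\mathfrak{v}\perp\mathfrak{z}$. Define $J_Z\in\mathrm{End}(\mathfrak{v})$ by $\langle J_ZU,V\rangle=\langle\beta(U,V),Z\rangle$ and the bracket $[U+X,V+Y]=\beta(U,V)$ for $U,V\in\mathfrak{v}$, $X,Y\in\mathfrak{z}$. If $J_Z^2=-\langle Z,Z\rangle I_{\mathfrak{v}}$ for all $Z\in\mathfrak{z}$, then $\mathfrak{n}$ is called a generalized Heisenberg algebra. **Damek-Ricci space.** Let $\mathfrak{a}=\mathbb{R}B$ be one-dimensional. On $\mathfrak{a}\oplus\mathfrak{n}$ put, for $r,s\in\mathbb{R}$, $U,V\in\mathfrak{v}$, $X,Y\in\mathfrak{z}$, $$\langle rB+U+X,sB+V+Y\rangle=rs+\langle U+X,V+Y\rangle_{\mathfrak{n}},$$ $$[rB+U+X,sB+V+Y]=[U,V]_{\mathfrak{n}}+\tfrac12 rV-\tfrac12 sU+rY-sX.$$ The simply connected Lie group $AN$ with this Lie algebra, with the induced left-invariant Riemannian metric, is a Damek-Ricci space. **Submanifold and tubes.** $\mathfrak{v}\ominus\mathfrak{w}$ denotes the orthogonal complement of $\mathfrak{w}$ in $\mathfrak{v}$. $S_{\mathfrak{w}}$ is regarded as a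 submanifold of $AN$; the tube of radius $r$ around it is $M^r=\{\gamma(r)\}$, where $\gamma$ runs over the unit speed geodesics with $\gamma(0)\in S_{\mathfrak{w}}$ and $\dot\gamma(0)$ a unit normal vector to $S_{\mathfrak{w}}$. A hypersurface is isoparametric if it and its nearby parallel hypersurfaces have constant mean curvature. It has constant principal curvatures if the principal curvatures (eigenvalues of the shape operator) do not depend on the point. **Generalized Kähler angle.** Let $m=\dim\mathfrak{z}$. For $\xi\in\mathfrak{w}^\perp$ and $Z\in\mathfrak{z}$ write $J_Z\xi=P_Z\xi+F_Z\xi$ with $P_Z\xi\in\mathfrak{w}$ and $F_Z\xi\in\mathfrak{w}^\perp$. For nonzero $\xi$ and $Z$, the Kähler angle of $\xi$ with respect to $Z$ (or $J_Z$) and $\mathfrak{w}^\perp$ is the $\varphi\in[0,\pi/2]$ with $\langle F_Z\xi,F_Z\xi\rangle=\cos^2(\varphi)\langle Z,Z\rangle\langle\xi,\xi\rangle$. For each nonzero $\xi\in\mathfrak{w}^\perp$ there is an orthonormal basis $\{Z_1,\dots,Z_m\}$ of $\mathfrak{z}$ and a unique $m$-tuple $(\varphi_1,\dots,\varphi_m)$ with $0\le\varphi_1\le\dots\le\varphi_m\le\pi/2$ such that $\varphi_i$ is the Kähler angle of $\xi$ with respect to $Z_i$, $\langle P_{Z_i}\xi,P_{Z_j}\xi\rangle=\langle F_{Z_i}\xi,F_{Z_j}\xi\rangle=0$ for $i\ne j$, and $\varphi_1$, $\varphi_m$ are the minimal and maximal Kähler angles of $\xi$ with respect to nonzero elements of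 $\mathfrak{z}$. This tuple is the generalized Kähler angle of $\xi$ with respect to $\mathfrak{w}^\perp$ (equivalently, the numbers $\cos^2(\varphi_i)\langle\xi,\xi\rangle$ are the eigenvalues of the quadratic form $Z\mapsto\langle F_Z\xi,F_Z\xi\rangle$ on $\mathfrak{z}$). The subspace $\mathfrak{w}^\perp$ has constant generalized Kähler angle if this tuple is the same for all unit $\xi\in\mathfrak{w}^\perp$. *)

(* Defs.v *)
From HB Require Import structures.
From mathcomp Require Import all_boot all_order all_algebra.
From mathcomp Require Import all_classical all_reals all_analysis.
From mathcomp Require Import ring lra.

Set Implicit Arguments.
Unset Strict Implicit.
Unset Printing Implicit Defensive.

Import Order.TTheory GRing.Theory Num.Theory.
Import numFieldNormedType.Exports.

Local Open Scope classical_set_scope.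
Local Open Scope ring_scope.

(** * Riemannian geometry of a metric [g] on a finite-dimensional space [E]

    The manifolds considered here are diffeomorphic to a vector space [E], so
    one global chart suffices: [g x u v] is the inner product of the tangent
    vectors [u] and [v] at the point [x], with every tangent space identified
    with [E]. *)

Section Riemannian.
Context {R : realType} {E : normedModType R}.
Variable g : E -> E -> E -> R.
Implicit Types (M : set E) (x u v : E) (nu : E -> E) (c : R -> E) (r t : R).

(** [f] is C^k on the open set [O]; in finite dimension it is enough to look at
    iterated directional derivatives. *)
Fixpoint Ck (F : normedModType R) (k : nat) (O : set E) (f : E -> F) : Prop :=
  (forall x, O x -> {for x, continuous f}) /\
  match k with
  | 0 => True
  | k'.+1 => forall v, (forall x, O x -> derivable f x v) /\ Ck k' O ('D_v f)
  end.

Definition smooth (F : normedModType R) (O : set E) (f : E -> F) : Prop :=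
  forall k, Ck k O f.

(** The vector [christoffel x u v] has the components
    Gamma^k_ij u^i v^j of the Levi-Civita connection at [x]: the equation is the
    Koszul formula for constant vector fields, and it has exactly one solution
    when [g x] is an inner product. *)
Definition christoffel x u v : E :=
  xget 0 [set a | forall w, 2 * g x a w =
    'D_u (fun y => g y v w) x + 'D_v (fun y => g y u w) x
      - 'D_w (fun y => g y u v) x].

Definition nabla u (Y : E -> E) x : E := 'D_u Y x + christoffel x u (Y x).

Definition geodesic c : Prop :=
  forall t, [/\ derivable c t 1, derivable (derive1 c) t 1 &
    derive1 (derive1 c) t + christoffel (c t) (derive1 c t) (derive1 c t) = 0].

Definition tangent M x : set E :=
  [set u | exists c, [/\ forall t, M (c t), c 0 = x &
                         is_derive (0 : R) (1 : R) c u]].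

Definition normal M x : set E :=
  [set u | forall v, tangent M x v -> g x u v = 0].

Definition tube M r : set E :=
  [set y | exists c, [/\ geodesic c, M (c 0), normal M (c 0) (derive1 c 0),
                         g (c 0) (derive1 c 0) (derive1 c 0) = 1 & y = c r]].

Definition hypersurface M : Prop :=
  M !=set0 /\
  forall x, M x -> exists (O : set E) (f : E -> R),
    [/\ open O, O x, smooth O f,
        forall y, O y -> exists v, 'D_v f y != 0 &
        M `&` O = [set y | O y /\ f y = 0]].

(** Only the values of [nu] on [M] matter below; [nu] is given on a
    neighbourhood of [M] so that its smoothness and its derivatives make
    sense. *)
Definition unit_normal_field M nu : Prop :=
  (exists O : set E, [/\ open O, M `<=` O & smooth O nu]) /\
  (forall x, M x -> g x (nu x) (nu x) = 1 /\ normal M x (nu x)).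

Definition shape nu x u : E := - nabla u nu x.

Definition tangent_onb M x (n : nat) (e : 'I_n -> E) : Prop :=
  [/\ forall i, tangent M x (e i),
      forall i j, g x (e i) (e j) = (i == j)%:R &
      forall u, tangent M x u -> u = \sum_i g x u (e i) *: e i].

Definition mean_curvature M nu x (h : R) : Prop :=
  exists (n : nat) (e : 'I_n -> E),
    tangent_onb M x e /\ h = \sum_i g x (shape nu x (e i)) (e i).

(** [k] lists the eigenvalues of the shape operator at [x], with
    multiplicities. *)
Definition principal_curvatures M nu x (n : nat) (k : 'I_n -> R) : Prop :=
  exists e : 'I_n -> E,
    tangent_onb M x e /\ forall i, shape nu x (e i) = k i *: e i.

Definition constant_mean_curvature M : Prop :=
  exists nu, unit_normal_field M nu /\
    exists h, forall x, M x -> mean_curvature M nu x h.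

Definition constant_principal_curvatures M : Prop :=
  exists nu, unit_normal_field M nu /\
    exists (n : nat) (k : 'I_n -> R),
      forall x, M x -> principal_curvatures M nu x k.

Definition parallel M nu t : set E :=
  [set y | exists c, [/\ geodesic c, M (c 0), derive1 c 0 = nu (c 0) & y = c t]].

Definition isoparametric_hypersurface M : Prop :=
  [/\ hypersurface M, constant_mean_curvature M &
    exists nu, unit_normal_field M nu /\
      exists2 eps : R, 0 < eps & forall t, `|t| < eps ->
        hypersurface (parallel M nu t) /\
        constant_mean_curvature (parallel M nu t)].

End Riemannian.

Section DeriveAux.
Context {R : realType}.

Lemma is_derive_along (E F : normedModType R) (f : E -> F) x v d :
  is_derive (0 : R) (1 : R) (fun h : R => f (h *: v + x)) d -> 'D_v f x = d.
Proof.
case=> _ <-; rewrite /derive; set q1 := fun h => h^-1 *: _.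
set q2 := fun h => h^-1 *: _; suff -> : q1 = q2 by [].
by apply/funext => h; rewrite /q1 /q2 /= addr0 scale0r add0r [_%:A]mulr1.
Qed.

Lemma is_derive_pair (F G : normedModType R) (f : R -> F) (g : R -> G) t df dg :
  is_derive t (1 : R) f df -> is_derive t (1 : R) g dg ->
  is_derive t (1 : R) (fun h => (f h, g h)) (df, dg).
Proof.
move=> [cf <-] [cg <-].
have C : (fun h : R => h^-1 *: (((fun h => (f h, g h)) \o shift t) (h *: (1 : R))
   - (f t, g t))) @ 0^' --> ('D_1 f t, 'D_1 g t).
  exact: (cvg_pair cf cg).
by split; [apply/cvg_ex; eexists; exact: C | exact: cvg_lim C].
Qed.

Lemma is_derive_scale (F : normedModType R) (k : R -> R) t dk (c : F) :
  is_derive t (1 : R) k dk -> is_derive t (1 : R) (fun h => k h *: c) (dk *: c).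
Proof.
move=> [ck <-].
have C : (fun h : R => h^-1 *: (((fun h => k h *: c) \o shift t) (h *: (1 : R))
   - k t *: c)) @ 0^' --> 'D_1 k t *: c.
  rewrite (_ : (fun h : R => _) = (fun h : R => (h^-1 *: ((k \o shift t) (h *: (1 : R)) - k t)) *: c)).
    exact: cvgZr_tmp.
  by apply/funext => h /=; rewrite -scalerBl scalerA.
by split; [apply/cvg_ex; eexists; exact: C | exact: cvg_lim C].
Qed.

End DeriveAux.

(** * Generalized Heisenberg algebras

    The spaces v and z are 'rV_p and 'rV_m with arbitrary inner products; an
    inner product on n = v + z with v orthogonal to z is the same as a pair of
    inner products on v and on z. *)

Record genHeisenberg (R : realType) (p m : nat) := GenHeisenberg {
  ipv : {dot 'rV[R]_p for idfun};
  ipz : {dot 'rV[R]_m for idfun};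
  beta : {bilinear 'rV[R]_p -> 'rV[R]_p -> 'rV[R]_m};
  J : 'rV[R]_m -> 'End('rV[R]_p);
  z_neq0 : (0 < m)%N;
  beta_skew : forall U V, beta U V = - beta V U;
  J_adjoint : forall Z U V, ipv (J Z U) V = ipz (beta U V) Z;
  J_sqr : forall Z U, J Z (J Z U) = - ipz Z Z *: U
}.

(** * Damek-Ricci spaces

    The triple [(s, U, X)] stands for sB + U + X in the Lie algebra a + v + z,
    and for the point Exp_n(U + X) exp(sB) in the group AN; the latter are
    global coordinates, as AN is the semidirect product of R and the simply
    connected nilpotent group N. *)

Section DamekRicci.
Context {R : realType} {p m : nat} (H : genHeisenberg R p m).

Local Notation AN := (R * 'rV[R]_p * 'rV[R]_m)%type.
Implicit Types (a b x y : AN) (w : {vspace 'rV[R]_p}).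

Let betaDl U V W : beta H (U + V) W = beta H U W + beta H V W.
Proof. exact: linearDl. Qed.
Let betaDr U V W : beta H U (V + W) = beta H U V + beta H U W.
Proof. exact: linearDr. Qed.
Let betaNr U V : beta H U (- V) = - beta H U V.
Proof. exact: linearNr. Qed.
Let betaZl (k : R) U V : beta H (k *: U) V = k *: beta H U V.
Proof. exact: linearZl_LR. Qed.
Let betaZr (k : R) U V : beta H U (k *: V) = k *: beta H U V.
Proof. exact: linearZr_LR. Qed.
Let betaxx U : beta H U U = 0.
Proof.
have /rowP UU := beta_skew H U U; apply/rowP => i; rewrite mxE.
by have := UU i; rewrite mxE; lra.
Qed.

Definition dr_ip a b : R := a.1.1 * b.1.1 + ipv H a.1.2 b.1.2 + ipz H a.2 b.2.

Definition dr_bracket a b : AN :=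
  (0,
   (2^-1 * a.1.1) *: b.1.2 - (2^-1 * b.1.1) *: a.1.2,
   beta H a.1.2 b.1.2 + a.1.1 *: b.2 - b.1.1 *: a.2).

Definition dr_mul x y : AN :=
  (x.1.1 + y.1.1,
   x.1.2 + expR (x.1.1 / 2) *: y.1.2,
   x.2 + expR x.1.1 *: y.2
     + (expR (x.1.1 / 2) / 2) *: beta H x.1.2 y.1.2).

Definition dr_inv x : AN :=
  (- x.1.1,
   - (expR (- x.1.1 / 2) *: x.1.2),
   - (expR (- x.1.1) *: x.2)).

Lemma dr_mulA x y z : dr_mul x (dr_mul y z) = dr_mul (dr_mul x y) z.
Proof.
case: x y z => [[s U] X] [[t V] Y] [[q W] Z]; rewrite /dr_mul /=.
have e1 : expR s = expR (s / 2) * expR (s / 2) by rewrite -expRD -splitr.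
have e2 : expR ((s + t) / 2) = expR (s / 2) * expR (t / 2).
  by rewrite mulrDl expRD.
congr (_, _, _); first by rewrite addrA.
  by rewrite scalerDr scalerA e2 addrA.
rewrite betaDl betaDr betaZl betaZr e2 expRD e1.
by apply/rowP => i; rewrite !mxE; field.
Qed.

Lemma dr_mul0x x : dr_mul 0 x = x.
Proof.
case: x => [[s U] X]; rewrite /dr_mul /= mul0r expR0 linear0l !scale1r scaler0.
by rewrite !add0r addr0.
Qed.

Lemma dr_mulVx x : dr_mul (dr_inv x) x = 0.
Proof.
case: x => [[s U] X]; rewrite /dr_mul /dr_inv /= -scaleNr betaZl betaxx.
by rewrite !scaler0 addr0 scaleNr !addNr.
Qed.

Definition left_invariant a : AN -> AN := fun x => 'D_a (dr_mul x) 0.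

Lemma derive_dr_mul x y a : 'D_a (dr_mul x) y =
  (a.1.1, expR (x.1.1 / 2) *: a.1.2,
   expR x.1.1 *: a.2 + (expR (x.1.1 / 2) / 2) *: beta H x.1.2 a.1.2).
Proof.
rewrite /derive; set l := RHS.
apply: cvg_lim => //; apply: cvg_near_cst.
near=> h; have h0 : h != 0 by near: h; exact: nbhs_dnbhs_neq.
rewrite -[RHS]scale1r -(mulVf h0) -scalerA; congr (_ *: _).
rewrite /l /dr_mul /=; congr (_, _, _).
- by rewrite /=/GRing.scale/=; ring.
- by apply/rowP => i; rewrite !mxE; ring.
- by rewrite betaDr betaZr; apply/rowP => i; rewrite !mxE; ring.
Unshelve. all: by end_near. Qed.

Lemma derive_left_invariant x v b : 'D_v (left_invariant b) x =
  (0, (v.1.1 / 2 * expR (x.1.1 / 2)) *: b.1.2,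
   (v.1.1 * expR x.1.1) *: b.2 +
   (v.1.1 / 2 * expR (x.1.1 / 2) / 2) *: beta H x.1.2 b.1.2 +
   (expR (x.1.1 / 2) / 2) *: beta H v.1.2 b.1.2).
Proof.
apply: is_derive_along.
have E (k : R) : is_derive (0 : R) (1 : R)
    (fun h : R => expR (k * (h * v.1.1 + x.1.1))) (k * v.1.1 * expR (k * x.1.1)).
  pose f1 (h : R) : R := k * v.1.1 * h + k * x.1.1.
  have f1D : is_derive (0 : R) (1 : R) f1 (k * v.1.1).
    have -> : f1 = (k * v.1.1) \*: (@id R) + cst (k * x.1.1) by apply/funext.
    by apply: is_derive_eq; rewrite addr0 /GRing.scale /= mulr1.
  have -> : (fun h : R => expR (k * (h * v.1.1 + x.1.1))) = expR \o f1.
    by apply/funext => h; rewrite /f1 /=; congr expR; ring.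
  by apply: is_derive_eq; rewrite /f1 mulr0 add0r mulrC.
have F0 : (fun h : R => left_invariant b (h *: v + x)) = (fun h : R =>
   ((b.1.1, expR (2^-1 * (h * v.1.1 + x.1.1)) *: b.1.2),
     (expR (1 * (h * v.1.1 + x.1.1)) *: b.2
      + (expR (2^-1 * (h * v.1.1 + x.1.1))) *: (2^-1 *: beta H x.1.2 b.1.2))
      + (h * expR (2^-1 * (h * v.1.1 + x.1.1))) *: (2^-1 *: beta H v.1.2 b.1.2))).
  apply/funext => h; rewrite /left_invariant derive_dr_mul /=.
  rewrite mul1r [_ / 2]mulrC betaDl betaZl /GRing.scale /=; congr (_, _, _).
  by apply/rowP => i; rewrite !mxE; ring.
rewrite F0.
apply: (@is_derive_eq _ _ _ _ _ _ _ _ (is_derive_pair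
  (is_derive_pair (is_derive_cst b.1.1 _ _) (is_derive_scale b.1.2 (E _)))
  (is_deriveD (is_deriveD (is_derive_scale b.2 (E _)) (is_derive_scale _ (E _)))
    (is_derive_scale _ (is_deriveM (is_derive_id _ _) (E _)))))).
rewrite /= !mul0r !mul1r !add0r /GRing.scale /=.
rewrite ![2^-1 * _]mulrC mulr1 /=.
congr (_, _, _).
by apply/rowP => i; rewrite !mxE; ring.
Qed.

(** AN has the Lie algebra a + n with the bracket [dr_bracket]: the left side is
    the bracket of vector fields in the global coordinates. *)
Lemma lie_bracket_left_invariant x a b :
  'D_(left_invariant a x) (left_invariant b) x
    - 'D_(left_invariant b x) (left_invariant a) x
  = left_invariant (dr_bracket a b) x.
Proof.
rewrite (congr2 (fun u v => u - v) (derive_left_invariant x (left_invariant a x) b)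
  (derive_left_invariant x (left_invariant b x) a)).
rewrite /left_invariant !derive_dr_mul.
case: x a b => [[s U] X] [[t V] Y] [[q W] Z] /=.
have e : expR s = expR (s / 2) * expR (s / 2) by rewrite -expRD -splitr.
congr (_, _, _); first by rewrite subr0.
  by apply/rowP => i; rewrite !mxE; ring.
rewrite betaDr betaNr !betaZr !betaZl (beta_skew H W V) e.
by apply/rowP => i; rewrite !mxE; field.
Qed.

(** Left-invariant metric: [dr_metric x] is the pullback of [dr_ip] under the
    differential at [x] of the left translation by the inverse of [x]. *)
Definition dr_metric x a b : R :=
  dr_ip ('D_a (dr_mul (dr_inv x)) x) ('D_b (dr_mul (dr_inv x)) x).

Lemma dr_metric_left_invariant x a b :
  dr_metric x (left_invariant a x) (left_invariant b x) = dr_ip a b.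
Proof.
have K (s : R) : expR (- s) * expR s = 1 by rewrite -expRD addNr expR0.
have K2 (s : R) : expR (- s / 2) * expR (s / 2) = 1 by rewrite mulNr K.
have E (c : AN) : 'D_(left_invariant c x) (dr_mul (dr_inv x)) x = c.
  rewrite /left_invariant !derive_dr_mul; case: x c => [[s U] X] [[t V] Y] /=.
  have e : expR (- s) = expR (- s / 2) * expR (- s / 2).
    by rewrite -expRD -splitr.
  congr (_, _, _); first by rewrite scalerA K2 scale1r.
  rewrite betaZr -scaleNr betaZl scalerDr !scalerA K scale1r e.
  apply/rowP => i; rewrite !mxE.
  by ring.
rewrite /dr_metric; congr dr_ip; [exact: (E a)|exact: (E b)].
Qed.

Definition subgroup (G : set AN) : Prop :=
  [/\ G 0, forall x y, G x -> G y -> G (dr_mul x y) &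
      forall x, G x -> G (dr_inv x)].

Definition one_parameter_subgroup (phi : R -> AN) : Prop :=
  (forall s t, phi (s + t) = dr_mul (phi s) (phi t)) /\
  forall t, derivable phi t 1.

Definition s_alg w : set AN := [set a | a.1.2 \in w].

(** The connected subgroup with Lie algebra [s_alg w] is the subgroup generated by
    the exponentials of the elements of [s_alg w]. *)
Definition S_grp w : set AN :=
  [set x | forall G, subgroup G ->
     (forall phi, one_parameter_subgroup phi -> s_alg w (derive1 phi 0) ->
        G (phi 1)) ->
     G x].

Definition vperp w : {vspace 'rV[R]_p} := orthov (ipv H) w.

Definition P_ w (Z : 'rV[R]_m) (xi : 'rV[R]_p) : 'rV[R]_p :=
  daddv_pi w (vperp w) (J H Z xi).
Definition F_ w (Z : 'rV[R]_m) (xi : 'rV[R]_p) : 'rV[R]_p :=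
  daddv_pi (vperp w) w (J H Z xi).

Definition kahler_angle w (xi : 'rV[R]_p) (Z : 'rV[R]_m) (phi : R) : Prop :=
  0 <= phi <= pi / 2 /\
  ipv H (F_ w Z xi) (F_ w Z xi) = cos phi ^+ 2 * ipz H Z Z * ipv H xi xi.

(** The indices 1, ..., m of the angles are shifted to 0, ..., m.-1. *)
Definition generalized_kahler_angle w (xi : 'rV[R]_p) (phi : 'I_m -> R) : Prop :=
  (forall i j : 'I_m, (i <= j)%N -> phi i <= phi j) /\
  exists Z : 'I_m -> 'rV[R]_m,
    [/\ forall i j, ipz H (Z i) (Z j) = (i == j)%:R,
        forall i, kahler_angle w xi (Z i) (phi i),
        forall i j, i != j ->
          ipv H (P_ w (Z i) xi) (P_ w (Z j) xi) = 0 /\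
          ipv H (F_ w (Z i) xi) (F_ w (Z j) xi) = 0 &
        forall Y psi, Y != 0 -> kahler_angle w xi Y psi ->
          (forall i : 'I_m, i = 0 :> nat -> phi i <= psi) /\
          (forall i : 'I_m, i = m.-1 :> nat -> psi <= phi i)].

Definition constant_generalized_kahler_angle w : Prop :=
  exists phi : 'I_m -> R, forall xi, xi \in vperp w -> ipv H xi xi = 1 ->
    generalized_kahler_angle w xi phi.

End DamekRicci.

(* Main.v *)
(** Let pi be the orthogonal projection of v onto the orthogonal complement of w.
    The geodesics normal to S_w are horizontal, and along them exp(-s/2) and
    exp(-s/2) pi U solve y'' = y / 4; hence the tube of radius r is the level set
    |pi U|^2 = 4 sinh^2(r/2) e^s, and its parallel sets are such level sets again.
    Its unit normal is polynomial in the coordinates,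
    nu = (- tau, rho pi U, beta(U, rho pi U) / 2) with tau = tanh(r/2),
    rho = 1 / sinh r. In a suitable orthonormal frame, minus the shape operator
    becomes the operator on v + z
      V + Z |-> tau/2 V + rho (pi V - <V, xi> xi) - sigma/2 J_Z xi
                + sigma/2 beta(V, xi) + tau Z,     sigma = 1 / cosh(r/2),
    where xi is the direction of pi U. Its trace does not depend on xi, so the mean
    curvature is constant. By a Schur complement its characteristic polynomial is
    G(x) det(q(x) + C_xi), with G and the cubic q independent of xi and with
    C_xi Z = beta(xi, pi J_Z xi), whose eigenvalues are the cos^2 phi_i of the
    generalized Kaehler angle of xi. As xi takes all unit values, the principal
    curvatures are constant if and only if the Kaehler angle is. *)

Require Import Defs.
From HB Require Import structures.
From mathcomp Require Import all_boot all_order all_algebra.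
From mathcomp Require Import all_classical all_reals all_analysis.
From mathcomp Require Import perm complex.
From mathcomp Require Import ring lra.

Set Implicit Arguments.
Unset Strict Implicit.
Unset Printing Implicit Defensive.

Import Order.TTheory GRing.Theory Num.Theory.
Import numFieldNormedType.Exports.

Local Open Scope classical_set_scope.
Local Open Scope ring_scope.

(** * Calculus in finite dimension *)

(** The eigenvalues are never computed. The cubic q is nonconstant, so P o q = P' o q forces P = P';
    agreement of two characteristic polynomials off finitely many points therefore decides equality
    of spectra, up to a permutation of the indices. This lets one avoid the points where the Schur
    complement breaks down. The definitions quantify over arbitrary data, and this shapes the rest.
    A unit normal field may differ from nu by a sign that varies over the tube, and an orthonormal
    basis of a tangent space is a list of a length not known beforehand. An isometry of v + z onto
    each tangent space settles the length, and the positive trace of the operator settles the sign.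
    A foreign normal field is smooth only in the sense of iterated directional derivatives; that its
    derivative in a tangent direction depends on its values on the tube alone requires a chain rule
    along curves, obtained here from the mean value theorem. A point of a level set is traced back
    to its origin by a geodesic in closed form, and the Koszul equation is solved explicitly. *)

Lemma is_derive_linear (R : numFieldType) (V F G : normedModType R) (L : F -> G)
    (f : V -> F) x v df :
  linear L -> continuous L -> is_derive x v f df -> is_derive x v (L \o f) (L df).
Proof.
move=> Llin Lc [cf <-].
have L0 : L 0 = 0.
  by move: (Llin 1 0 0); rewrite scaler0 scale1r addr0 => /esym/eqP; rewrite -subr_eq0 addrK => /eqP.
have LZB a y z : a *: (L y - L z) = L (a *: (y - z)).
  have := Llin a (y - z) 0; rewrite L0 !addr0 => ->; congr (_ *: _).
  by rewrite [in RHS]addrC -[- z]scaleN1r Llin scaleN1r addrC.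
have C : (fun h : R => h^-1 *: (((L \o f) \o shift x) (h *: v) - (L \o f) x))
    @ 0^' --> L ('D_v f x).
  rewrite (_ : (fun h : R => _) =
      L \o (fun h : R => h^-1 *: ((f \o shift x) (h *: v) - f x))); last first.
    by apply/funext => h /=; rewrite LZB.
  exact: (cvg_comp _ _ cf (Lc _)).
by split; [apply/cvg_ex; eexists; exact: C | exact: cvg_lim C].
Qed.

Lemma linear_rowE (R : nzRingType) (F : lmodType R) n (L : 'rV[R]_n -> F) u :
  linear L -> L u = \sum_j u 0 j *: L (delta_mx 0 j).
Proof.
move=> Llin.
have L0 : L 0 = 0.
  by move: (Llin 1 0 0); rewrite scaler0 scale1r addr0 => /esym/eqP; rewrite -subr_eq0 addrK => /eqP.
rewrite [in LHS](row_sum_delta u); elim/big_rec2: _ => [//|j y z _ <-].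
by rewrite Llin.
Qed.

Lemma cvg_sum_normed (R : numFieldType) (F : normedModType R) (T I : Type)
    (FF : set_system T) {FFF : Filter FF} (r : seq I) (P : pred I)
    (f : I -> T -> F) (a : I -> F) :
  (forall i, P i -> f i x @[x --> FF] --> a i) ->
  \sum_(i <- r | P i) f i x @[x --> FF] --> \sum_(i <- r | P i) a i.
Proof. by apply: cvg_big => x; exact: add_continuous. Qed.

Lemma linear_row_continuous (R : numFieldType) (F : normedModType R) n
  (L : 'rV[R]_n -> F) : linear L -> continuous L.
Proof.
move=> Llin u.
rewrite (_ : L = fun u => \sum_j u 0 j *: L (delta_mx 0 j)); last first.
  by apply/funext => y; exact: linear_rowE.
apply: (@cvg_sum_normed R F _ _ (nbhs u)) => j _.
by apply: cvgZr_tmp; exact: coord_continuous.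
Qed.

Lemma is_derive_row (R : numFieldType) (V F : normedModType R) n
    (L : 'rV[R]_n -> F) (f : V -> 'rV[R]_n) x v df :
  linear L -> is_derive x v f df -> is_derive x v (fun y => L (f y)) (L df).
Proof.
by move=> Llin fd; apply: is_derive_linear => //; exact: linear_row_continuous.
Qed.

Lemma is_derive_fst (R : numFieldType) (V F G : normedModType R)
    (f : V -> F * G) x v df :
  is_derive x v f df -> is_derive x v (fun y => (f y).1) df.1.
Proof.
have lin : linear (@fst F G) by [].
have cts : continuous (@fst F G) by move=> [u u']; exact: cvg_fst.
exact: is_derive_linear lin cts.
Qed.

Lemma is_derive_snd (R : numFieldType) (V F G : normedModType R)
    (f : V -> F * G) x v df :
  is_derive x v f df -> is_derive x v (fun y => (f y).2) df.2.
Proof.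
have lin : linear (@snd F G) by [].
have cts : continuous (@snd F G) by move=> [u u']; exact: cvg_snd.
exact: is_derive_linear lin cts.
Qed.

Lemma bilinear_rowE (R : comNzRingType) (F : lmodType R) n k
    (Q : 'rV[R]_n -> 'rV[R]_k -> F) u v :
  (forall v, linear (Q^~ v)) -> (forall u, linear (Q u)) ->
  Q u v = \sum_i \sum_j (u 0 i * v 0 j) *: Q (delta_mx 0 i) (delta_mx 0 j).
Proof.
move=> Ql Qr; rewrite (linear_rowE u (Ql v)); apply: eq_bigr => i _.
rewrite (linear_rowE v (Qr _)) scaler_sumr.
by apply: eq_bigr => j _; rewrite scalerA.
Qed.

Lemma is_derive_scalel (R : numFieldType) (V F : normedModType R) (k : V -> R)
    x v dk (c : F) :
  is_derive x v k dk -> is_derive x v (fun y => k y *: c) (dk *: c).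
Proof.
apply: (@is_derive_linear R V R F (fun t : R => t *: c)).
  by move=> a b d; rewrite scalerDl scalerA.
by move=> t; exact: scalel_continuous.
Qed.

(** Expanding [Q] on the standard bases reduces the claim to the product rule for real coordinate
    functions. *)
Lemma is_derive_bilinear (R : numFieldType) (V F : normedModType R) n k
    (Q : 'rV[R]_n -> 'rV[R]_k -> F) (f : V -> 'rV[R]_n) (g : V -> 'rV[R]_k)
    x v df dg :
  (forall v, linear (Q^~ v)) -> (forall u, linear (Q u)) ->
  is_derive x v f df -> is_derive x v g dg ->
  is_derive x v (fun y => Q (f y) (g y)) (Q df (g x) + Q (f x) dg).
Proof.
move=> Ql Qr fd gd.
pose q (i : 'I_n) (j : 'I_k) : V -> F :=
  fun y => (f y 0 i * g y 0 j) *: Q (delta_mx 0 i) (delta_mx 0 j).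
have fi i : is_derive x v (fun y => f y 0 i) (df 0 i).
  by apply: (@is_derive_row R V R n (fun u => u 0 i)) => // a b c; rewrite !mxE.
have gi i : is_derive x v (fun y => g y 0 i) (dg 0 i).
  by apply: (@is_derive_row R V R k (fun u => u 0 i)) => // a b c; rewrite !mxE.
have D : is_derive x v (\sum_i (\sum_j q i j))
  (\sum_i (\sum_j (f x 0 i *: dg 0 j + g x 0 j *: df 0 i) *: Q (delta_mx 0 i) (delta_mx 0 j))).
  apply: is_derive_sum => i; apply: is_derive_sum => j.
  exact: is_derive_scalel (is_deriveM (fi i) (gi j)).
rewrite (_ : (fun y => _) = \sum_i (\sum_j q i j)); last first.
  apply/funext => y; rewrite (bilinear_rowE _ _ Ql Qr) fct_sumE.
  by apply: eq_bigr => i _; rewrite fct_sumE.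
apply: (is_derive_eq D); rewrite !(bilinear_rowE _ _ Ql Qr) -big_split /=.
apply: eq_bigr => i _; rewrite -big_split /=; apply: eq_bigr => j _.
by rewrite scalerDl addrC /GRing.scale /= [g x 0 j * _]mulrC.
Qed.

Lemma bilinear_row_continuous (R : numFieldType) (V : topologicalType)
    (F : normedModType R) n k
    (Q : 'rV[R]_n -> 'rV[R]_k -> F) (f : V -> 'rV[R]_n) (g : V -> 'rV[R]_k) x :
  (forall v, linear (Q^~ v)) -> (forall u, linear (Q u)) ->
  {for x, continuous f} -> {for x, continuous g} ->
  {for x, continuous (fun y => Q (f y) (g y))}.
Proof.
move=> Ql Qr fc gc.
rewrite (_ : (fun y => _) = fun y => \sum_i \sum_j
   (f y 0 i * g y 0 j) *: Q (delta_mx 0 i) (delta_mx 0 j)); last first.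
  by apply/funext => y; rewrite (bilinear_rowE _ _ Ql Qr).
apply: (@cvg_sum_normed R F _ _ (nbhs x)) => i _.
apply: (@cvg_sum_normed R F _ _ (nbhs x)) => j _.
apply: cvgZr_tmp.
apply: cvgM.
  exact: (cvg_comp _ _ fc (@coord_continuous _ _ _ 0 i (f x))).
exact: (cvg_comp _ _ gc (@coord_continuous _ _ _ 0 j (g x))).
Qed.

Lemma is_derive_shift_line (R : realType) (E F : normedModType R) (f : E -> F)
    (z v : E) (t : R) :
  derivable f (t *: v + z) v ->
  is_derive t (1 : R) (fun s : R => f (s *: v + z)) ('D_v f (t *: v + z)).
Proof.
move=> df.
have C : (fun h : R => h^-1 *: (((fun s : R => f (s *: v + z)) \o shift t) (h *: (1 : R))
    - f (t *: v + z))) @ 0^' --> 'D_v f (t *: v + z).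
  rewrite (_ : (fun h : R => _) =
      fun h => h^-1 *: ((f \o shift (t *: v + z)) (h *: v) - f (t *: v + z))).
    exact: df.
  apply/funext => h /=; congr (_ *: (f _ - _)).
  by rewrite [h *: (1 : R)]mulr1 scalerDl addrA.
by split; [apply/cvg_ex; eexists; exact: C | exact: cvg_lim C].
Qed.

Lemma mvt_line (R : realType) (E : normedModType R) (f : E -> R) (z v : E) :
  (forall t : R, 0 <= t <= 1 -> derivable f (t *: v + z) v) ->
  exists2 t : R, 0 <= t <= 1 & f (v + z) - f z = 'D_v f (t *: v + z).
Proof.
move=> df; pose F (s : R) := f (s *: v + z).
have dF (t : R) : 0 <= t <= 1 -> is_derive t (1 : R) F ('D_v f (t *: v + z)).
  by move=> /df; exact: is_derive_shift_line.
have cF : {within `[0 : R, 1], continuous F}.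
  apply: derivable_within_continuous => t; rewrite in_itv /= => /dF dt.
  exact: ex_derive.
have dF' (t : R) : t \in `]0, 1[ -> is_derive t (1 : R) F ('D_v f (t *: v + z)).
  by rewrite in_itv /= => /andP[t0 t1]; apply: dF; rewrite !ltW.
have [t t01] := MVT ltr01 dF' cF.
rewrite /F subr0 mulr1 scale1r scale0r add0r => E1.
by exists t => //; move: t01; rewrite in_itv /= => /andP[t0 t1]; rewrite !ltW.
Qed.

Lemma derivableZdir (R : realType) (E F : normedModType R) (f : E -> F) x v (a : R) :
  derivable f x v -> is_derive x (a *: v) f (a *: 'D_v f x).
Proof.
move=> df.
have [->|a0] := eqVneq a 0.
  by rewrite !scale0r; exact: is_derive0.
have C : (fun h : R => h^-1 *: ((f \o shift x) (h *: (a *: v)) - f x)) @ 0^'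
    --> a *: 'D_v f x.
  rewrite (_ : (fun h : R => _) = a \*: ((fun h => h^-1 *: ((f \o shift x) (h *: v) - f x))
      \o (fun h : R => h * a))).
    apply: cvgZl_tmp; apply: (@cvg_comp _ _ _ (fun h : R => h * a) _ _ (0^')); last exact: df.
    move=> A [e /= e0 eA]; exists (e / `|a|); first by rewrite /= divr_gt0 // normr_gt0.
    move=> h /=; rewrite sub0r normrN => he h0; apply: eA => /=.
      by rewrite sub0r normrN normrM -ltr_pdivlMr // normr_gt0.
    by rewrite mulf_neq0.
  apply/funext => h /=; rewrite !scalerA; congr (_ *: _).
  have [->|h0] := eqVneq h 0; first by rewrite mul0r !invr0 mulr0.
  by rewrite invfM mulrCA divff // mulr1.
by split; [apply/cvg_ex; eexists; exact: C | exact: cvg_lim C].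
Qed.

(** Directional derivatives are not additive in the direction without some continuity. The increment
    is split at [h *: u + x]; by the mean value theorem the second half is a derivative along [v] at
    a nearby point, and continuity of ['D_v f] moves that point to [x]. *)
Lemma is_deriveDdir (R : realType) (E : normedModType R) (f : E -> R) x u v :
  (\forall y \near x, derivable f y v) -> {for x, continuous ('D_v f)} ->
  derivable f x u -> is_derive x (u + v) f ('D_u f x + 'D_v f x).
Proof.
move=> dv cv du.
have C : (fun h : R => h^-1 *: ((f \o shift x) (h *: (u + v)) - f x)) @ 0^'
    --> 'D_u f x + 'D_v f x.
  rewrite (_ : (fun h : R => _) =
     (fun h => h^-1 *: ((f \o shift x) (h *: u) - f x)) \+
     (fun h => h^-1 *: (f (h *: v + (h *: u + x)) - f (h *: u + x)))); last first.
    apply/funext => h /=; rewrite -scalerDr; congr (_ *: _).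
    by rewrite [RHS]addrC subrKA scalerDr [h *: u + _]addrC addrA.
  apply: cvgD; first exact: du.
  apply/cvgrPdist_lt => e e0.
  have /cvgrPdist_lt/(_ _ e0)/nbhs_ballP[d1 /= d10 d1P] := cv.
  move: dv => /nbhs_ballP[d2 /= d20 d2P].
  pose d := Num.min d1 d2.
  have d0 : 0 < d by rewrite /d lt_min d10.
  exists (d / (`|u| + `|v| + 1)) => /=.
    by rewrite divr_gt0 // ltr_wpDl // addr_ge0.
  move=> h /=; rewrite sub0r normrN => hd h0.
  have nz : 0 < `|u| + `|v| + 1 by rewrite ltr_wpDl // addr_ge0.
  have close (t : R) : 0 <= t <= 1 -> `|x - (t *: (h *: v) + (h *: u + x))| < d.
    move=> /andP[t0 t1]; rewrite distrC addrA addrK.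
    apply: (@le_lt_trans _ _ (`|h| * (`|u| + `|v|))).
      apply: le_trans (ler_normD _ _) _; rewrite !normrZ ger0_norm // mulrDr addrC lerD2l.
      by rewrite ler_piMl // mulr_ge0.
    move: hd; rewrite ltr_pdivlMr // => hd; apply: le_lt_trans hd.
    by rewrite ler_wpM2l // lerDl.
  have dd (t : R) : 0 <= t <= 1 -> derivable f (t *: (h *: v) + (h *: u + x)) v.
    move=> /close tc; apply: d2P; rewrite -ball_normE /=.
    by apply: lt_le_trans tc _; rewrite /d ge_min lexx orbT.
  have [|t t01 ->] := @mvt_line R E f (h *: u + x) (h *: v).
    move=> t t01; exact: (@ex_derive _ _ _ _ _ _ _ (derivableZdir h (dd t t01))).
  have -> := @derive_val _ _ _ _ _ _ _ (derivableZdir h (dd t t01)).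
  rewrite [h^-1 *: _]scalerA mulVf // scale1r; apply: d1P; rewrite -ball_normE /=.
  by apply: lt_le_trans (close t t01) _; rewrite /d ge_min lexx.
by split; [apply/cvg_ex; eexists; exact: C | exact: cvg_lim C].
Qed.

(** Coordinates on [E]: a finite list of vectors paired with their coordinate
    functionals. *)
Definition coordinates (R : realType) (E : normedModType R)
    (s : seq (E * (E -> R))) : Prop :=
  (forall y, y = \sum_(b <- s) b.2 y *: b.1) /\
  (forall y, {in s, forall b, `|b.2 y| <= `|y|}).

Lemma is_derive_sumdir (R : realType) (E : normedModType R) (f : E -> R) (O : set E)
    (s : seq (E * (E -> R))) x y :
  open O -> O x -> Ck 1 O f ->
  is_derive x (\sum_(b <- s) b.2 y *: b.1) f (\sum_(b <- s) b.2 y *: 'D_(b.1) f x).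
Proof.
move=> Oo Ox [_ f1]; elim: s => [|b s IH]; first by rewrite !big_nil; exact: is_derive0.
rewrite !big_cons addrC [X in is_derive _ _ _ X]addrC.
have [fd [fc _]] := f1 (b.2 y *: b.1).
have fb := derivableZdir (b.2 y) ((f1 b.1).1 x Ox).
rewrite -(@derive_val _ _ _ _ _ _ _ fb) -(@derive_val _ _ _ _ _ _ _ IH).
apply: is_deriveDdir; [|exact: fc|exact: ex_derive].
by apply: filterS fd _; exact: open_nbhs_nbhs.
Qed.

(** The mean value inequality makes [f] Lipschitz near [c 0], so that [c] may be
    replaced by its tangent line. *)
Lemma C1_chain_rule (R : realType) (E : normedModType R) (s : seq (E * (E -> R)))
    (f : E -> R) (O : set E) (c : R -> E) (u : E) :
  coordinates s -> open O -> O (c 0) -> Ck 1 O f ->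
  is_derive (0 : R) (1 : R) c u ->
  is_derive (0 : R) (1 : R) (fun t => f (c t)) ('D_u f (c 0)).
Proof.
move=> [sE sle] Oo Ox fC [cd cu].
have f1 : forall v, (forall x, O x -> derivable f x v) /\ Ck 0 O ('D_v f) by case: fC.
have [e0 e00 eO] : exists2 e : R, 0 < e & ball (c 0) e `<=` O.
  by move: (open_nbhs_nbhs (conj Oo Ox)) => /nbhs_ballP[e /= e0 eO]; exists e.
(* A bound for the coordinate derivatives near [c 0]. It serves as a Lipschitz constant, because
   ['D_(y - z) f] is their combination with coefficients at most [|y - z|] in absolute value. *)
pose K := \sum_(b <- s) (`|'D_(b.1) f (c 0)| + 1).
have K0 : 0 <= K by apply: sumr_ge0 => b _; rewrite addr_ge0.
have [e1 e10 e1P] : exists2 e : R, 0 < e & forall y, ball (c 0) e y ->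
    \sum_(b <- s) `|'D_(b.1) f y| <= K.
  rewrite /K; elim: s {sE sle K K0} => [|b s [e eP IH]].
    by exists 1 => // y _; rewrite !big_nil.
  have [_ [fc _]] := f1 b.1.
  have /cvgrPdist_lt/(_ _ ltr01)/nbhs_ballP[d /= d0 dP] := fc _ Ox.
  exists (Num.min d e); first by rewrite lt_min d0.
  move=> y; rewrite -ball_normE /= lt_min => /andP[yd ye]; rewrite !big_cons lerD //.
    have := dP y; rewrite -ball_normE /= => /(_ yd) /ltW H.
    rewrite -[X in `|X|](subrK ('D_(b.1) f (c 0))).
    by rewrite (le_trans (ler_normD _ _)) // addrC lerD2l distrC.
  by apply: IH; rewrite -ball_normE.
pose d := Num.min e0 e1.
have d0 : 0 < d by rewrite lt_min e00.
have Lip y z : ball (c 0) d y -> ball (c 0) d z -> `|f y - f z| <= K * `|y - z|.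
  move=> yB zB.
  have seg (t : R) : 0 <= t <= 1 -> ball (c 0) d (t *: (y - z) + z).
    move: yB zB; rewrite -!ball_normE /= => yB zB /andP[t0 t1].
    have -> : c 0 - (t *: (y - z) + z) = t *: (c 0 - y) + (1 - t) *: (c 0 - z).
      rewrite scalerBl scale1r addrCA -scalerBr opprD addrCA addrC -scalerN opprB.
      by rewrite opprB [c 0 - y + _]addrC subrKA.
    apply: le_lt_trans (ler_normD _ _) _.
    rewrite !normrZ !ger0_norm ?subr_ge0 //.
    have [->|tn0] := eqVneq t 0; first by rewrite mul0r add0r subr0 mul1r.
    have tp : 0 < t by rewrite lt_neqAle eq_sym tn0.
    have : t * `|c 0 - y| < t * d by rewrite ltr_pM2l.
    have : (1 - t) * `|c 0 - z| <= (1 - t) * d by rewrite ler_wpM2l ?subr_ge0 // ltW.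
    by move=> h1 h2; have := ltr_leD h2 h1; rewrite -mulrDl [t + (1 - t)]addrC subrK mul1r.
  have inO y' : ball (c 0) d y' -> O y'.
    rewrite -ball_normE /= => h; apply: eO; rewrite -ball_normE /=.
    by apply: lt_le_trans h _; rewrite ge_min lexx.
  have [t t01] := @mvt_line R E f z (y - z) (fun t t01 => (f1 _).1 _ (inO _ (seg t t01))).
  rewrite (subrK z y) => ->.
  have tO := inO _ (seg t t01).
  have := @derive_val _ _ _ _ _ _ _ (is_derive_sumdir s (y - z) Oo tO fC).
  rewrite -sE => ->.
  apply: le_trans (ler_norm_sum _ _ _) _.
  apply: (@le_trans _ _ (\sum_(b <- s) `|'D_(b.1) f (t *: (y - z) + z)| * `|y - z|)).
    rewrite !big_seq; apply: ler_sum => b bs; rewrite normrZ mulrC ler_wpM2l //.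
    exact: sle.
  rewrite -mulr_suml ler_wpM2r // e1P //.
  move: (seg t t01); rewrite -!ball_normE /= => h; apply: lt_le_trans h _.
  by rewrite ge_min lexx orbT.
have [du0 [_ _]] := f1 u.
have fu : (fun h : R => h^-1 *: ((f \o shift (c 0)) (h *: u) - f (c 0))) @ 0^'
    --> 'D_u f (c 0) by exact: du0.
have cu' : (fun h : R => h^-1 *: ((c \o shift 0) (h *: (1 : R)) - c 0)) @ 0^' --> u.
  by rewrite -cu; exact: cd.
(* The Lipschitz bound turns the o(h) distance from [c h] to the tangent line into an o(h)
   difference of values of [f]. *)
have C : (fun h : R => h^-1 *: (f (c h) - f (h *: u + c 0))) @ 0^' --> (0 : R).
  apply/cvgrPdist_lt => e e_gt0.
  have K1 : 0 < K + 1 by rewrite ltr_wpDl.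
  have /cvgrPdist_lt/(_ (e / (K + 1)) (divr_gt0 e_gt0 K1)) near1 := cu'.
  have cc : {for 0, continuous c} by apply: differentiable_continuous; apply/derivable1_diffP.
  near=> h.
  have h0 : h != 0 by near: h; exact: nbhs_dnbhs_neq.
  have hB : ball (c 0) d (c h).
    by near: h; apply: nbhs_dnbhs; apply: cc; exact: nbhsx_ballx.
  have lB : ball (c 0) d (h *: u + c 0).
    near: h; apply: nbhs_dnbhs.
    have : (fun h : R => h *: u + c 0) @ 0 --> 0 *: u + c 0.
      by apply: cvgD; [exact: scalel_continuous|exact: cvg_cst].
    by rewrite scale0r add0r; apply; exact: nbhsx_ballx.
  have nh : `|u - h^-1 *: ((c \o shift 0) (h *: (1 : R)) - c 0)| < e / (K + 1).
    by near: h; exact: near1.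
  rewrite sub0r normrN normrZ.
  have hn : 0 < `|h^-1| by rewrite normr_gt0 invr_eq0.
  apply: (@le_lt_trans _ _ (`|h^-1| * (K * `|c h - (h *: u + c 0)|))).
    by rewrite ler_pM2l // Lip.
  rewrite distrC mulrCA -normrZ.
  have -> : h^-1 *: (h *: u + c 0 - c h) = u - h^-1 *: (c h - c 0).
    by rewrite -addrA scalerDr scalerA mulVf // scale1r -[c 0 - _]opprB scalerN.
  move: nh; rewrite /= [h *: (1 : R)]mulr1 addr0 ltr_pdivlMr // => nh.
  by apply: le_lt_trans nh; rewrite mulrC ler_wpM2l // lerDl.
have C2 : (fun h : R => h^-1 *: (((fun t => f (c t)) \o shift 0) (h *: (1 : R)) - f (c 0)))
    @ 0^' --> 'D_u f (c 0).
  rewrite -['D_u f _]add0r (_ : (fun h : R => _) =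
    (fun h : R => h^-1 *: (f (c h) - f (h *: u + c 0))) \+
    (fun h : R => h^-1 *: ((f \o shift (c 0)) (h *: u) - f (c 0)))); first exact: cvgD.
  by apply/funext => h /=; rewrite [h *: (1 : R)]mulr1 addr0 -scalerDr subrKA.
by split; [apply/cvg_ex; eexists; exact: C2 | exact: cvg_lim C2].
Unshelve. all: by end_near. Qed.

(** * Self-adjoint operators and determinants *)

Section Spectral.
Variables (R : rcfType) (n : nat) (ip : 'rV[R]_n -> 'rV[R]_n -> R).
Hypothesis ip_lin : forall (a : R) (u v x : 'rV[R]_n),
  ip (a *: u + v) x = a * ip u x + ip v x.
Hypothesis ipC : forall u v : 'rV[R]_n, ip u v = ip v u.
Hypothesis ip_gt0 : forall u : 'rV[R]_n, u != 0 -> 0 < ip u u.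

Let ip0 x : ip 0 x = 0.
Proof. by move: (ip_lin 1 0 0 x); rewrite scaler0 addr0 mul1r; lra. Qed.

Let ipZ (a : R) (u x : 'rV[R]_n) : ip (a *: u) x = a * ip u x.
Proof. by rewrite -[a *: u]addr0 ip_lin ip0 addr0. Qed.

Let ipD (u v x : 'rV[R]_n) : ip (u + v) x = ip u x + ip v x.
Proof. by rewrite -[u]scale1r ip_lin mul1r scale1r. Qed.

Lemma ip_sum (I : Type) (r : seq I) (P : pred I) (f : I -> 'rV[R]_n) x :
  ip (\sum_(i <- r | P i) f i) x = \sum_(i <- r | P i) ip (f i) x.
Proof. by elim/big_rec2: _ => [//|i y1 y2 _ <-]; rewrite ipD. Qed.

Lemma orthonormal_free_coef k (e : 'I_k -> 'rV[R]_n) (c : 'I_k -> R) j :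
  (forall i j, ip (e i) (e j) = (i == j)%:R) -> ip (\sum_i c i *: e i) (e j) = c j.
Proof.
move=> eO; rewrite ip_sum (bigD1 j) //= ipZ eO eqxx mulr1 big1 ?addr0 // => i ij.
by rewrite ipZ eO (negbTE ij) mulr0.
Qed.

Lemma orthonormal_row_free k (e : 'I_k -> 'rV[R]_n) :
  (forall i j, ip (e i) (e j) = (i == j)%:R) -> row_free (\matrix_i e i).
Proof.
move=> eO; rewrite -kermx_eq0; apply/rowV0P => v /sub_kermxP ve0.
apply/rowP => j; rewrite mxE -(orthonormal_free_coef (fun i => v 0 i) j eO).
move: ve0; rewrite mulmx_sum_row; under eq_bigr do rewrite rowK.
by move=> ->.
Qed.

Lemma orthonormal_expand (e : 'I_n -> 'rV[R]_n) u :
  (forall i j, ip (e i) (e j) = (i == j)%:R) -> u = \sum_i ip u (e i) *: e i.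
Proof.
move=> eO; have := orthonormal_row_free eO; rewrite row_free_unit => eU.
have -> : u = (u *m invmx (\matrix_i e i)) *m (\matrix_i e i) by rewrite mulmxKV.
rewrite mulmx_sum_row; under eq_bigr do rewrite rowK.
by apply: eq_bigr => i _; rewrite orthonormal_free_coef.
Qed.

Section SelfAdjoint.
Variable F : 'M[R]_n.
Hypothesis F_sa : forall u v, ip (u *m F) v = ip u (v *m F).

(* A complex eigenvector x + i y for a + i b satisfies xF = ax - by and
   yF = bx + ay, so self-adjointness gives b(|x|^2 + |y|^2) = 0. *)
Lemma selfadjoint_eigenvector k (W : 'M[R]_(k.+1, n)) :
  row_free W -> (W *m F <= W)%MS ->
  exists (u : 'rV[R]_n) (a : R), [/\ u != 0, (u <= W)%MS & u *m F = a *: u].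
Proof.
move=> Wfree WF; pose A := W *m F *m pinvmx W.
have AW : A *m W = W *m F by rewrite /A mulmxKpV.
pose f : {rmorphism R -> R[i]} := real_complex R.
have [l rl] : exists l : R[i], root (char_poly (map_mx f A)) l.
  by apply/closed_rootP; rewrite size_char_poly.
have /eigenvalueP[v vA v0] : eigenvalue (map_mx f A) l.
  by rewrite eigenvalue_root_char.
case: l rl vA => [a b] _ vA.
pose x := map_mx (@complex.Re R) v; pose y := map_mx (@complex.Im R) v.
have ReS (I : finType) (g : I -> R[i]) : complex.Re (\sum_i g i) = \sum_i complex.Re (g i).
  by elim/big_rec2: _ => [//|i z1 z2 _ <-]; case: (g i) z2 => [? ?] [].
have ImS (I : finType) (g : I -> R[i]) : complex.Im (\sum_i g i) = \sum_i complex.Im (g i).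
  by elim/big_rec2: _ => [//|i z1 z2 _ <-]; case: (g i) z2 => [? ?] [].
have xA : x *m A = a *: x - b *: y.
  apply/rowP => j; have := congr1 (fun w : 'rV[R[i]]_k.+1 => complex.Re (w 0 j)) vA.
  rewrite !mxE ReS => E; transitivity (complex.Re (Complex a b * v 0 j)).
    rewrite -E; apply: eq_bigr => i _; rewrite !mxE.
    by case: (v 0 i) => p q /=; rewrite mulr0 subr0.
  by case: (v 0 j) => p q /=.
have yA : y *m A = b *: x + a *: y.
  apply/rowP => j; have := congr1 (fun w : 'rV[R[i]]_k.+1 => complex.Im (w 0 j)) vA.
  rewrite !mxE ImS => E; transitivity (complex.Im (Complex a b * v 0 j)).
    rewrite -E; apply: eq_bigr => i _; rewrite !mxE.
    by case: (v 0 i) => p q /=; rewrite mulr0 add0r.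
  by case: (v 0 j) => p q /=; rewrite addrC.
have ipN u w : ip (- u) w = - ip u w by rewrite -scaleN1r ipZ mulN1r.
have key := F_sa (x *m W) (y *m W).
rewrite -2!(mulmxA _ W F) -AW !(mulmxA _ A W) xA yA !mulmxDl mulNmx -!scalemxAl in key.
rewrite ipD ipN !ipZ [RHS]ipC ipD !ipZ [ip (y *m W) (x *m W)]ipC in key.
have inj (u : 'rV[R]_k.+1) : u *m W = 0 -> u = 0.
  by move/eqP; rewrite mulmx_free_eq0 // => /eqP.
have sub (u : 'rV[R]_k.+1) : (u *m W <= W)%MS by exact: submxMl.
have ge (u : 'rV[R]_n) : 0 <= ip u u.
  by have [->|/ip_gt0/ltW//] := eqVneq u 0; rewrite ip0.
have xy0 : (x != 0) || (y != 0).
  rewrite -negb_and; apply: contra v0 => /andP[/eqP x0 /eqP y0].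
  apply/eqP/rowP => j; have := congr1 (fun w : 'rV[R]_k.+1 => w 0 j) x0.
  have := congr1 (fun w : 'rV[R]_k.+1 => w 0 j) y0; rewrite !mxE.
  by case: (v 0 j) => p q /= -> ->.
have b0 : b = 0.
  have : b * (ip (x *m W) (x *m W) + ip (y *m W) (y *m W)) = 0 by lra.
  move=> /eqP; rewrite mulf_eq0 => /orP[/eqP //|/eqP].
  have := ge (x *m W); have := ge (y *m W).
  case/orP: xy0 => nz.
    have : 0 < ip (x *m W) (x *m W) by apply: ip_gt0; apply: contra nz => /eqP/inj ->.
    by lra.
  have : 0 < ip (y *m W) (y *m W) by apply: ip_gt0; apply: contra nz => /eqP/inj ->.
  by lra.
case/orP: xy0 => nz; [exists (x *m W), a|exists (y *m W), a]; split.
- by apply: contra nz => /eqP/inj ->.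
- exact: sub.
- by rewrite -mulmxA -AW mulmxA xA b0 scale0r subr0 scalemxAl.
- by apply: contra nz => /eqP/inj ->.
- exact: sub.
- by rewrite -mulmxA -AW mulmxA yA b0 scale0r add0r scalemxAl.
Qed.

(** Induction on the number of eigenvectors: by self-adjointness the orthogonal complement of those
    already found is stable under [F], and [selfadjoint_eigenvector] yields one more in it. *)
Lemma spectral_partial k : (k <= n)%N ->
  exists (e : 'I_k -> 'rV[R]_n) (d : 'I_k -> R),
    (forall i j, ip (e i) (e j) = (i == j)%:R) /\
    forall i, e i *m F = d i *: e i.
Proof.
elim: k => [|k IH] kn; first by exists (fun _ => 0), (fun _ => 0); split; case.
have [e [d [eO eF]]] := IH (ltnW kn).
(* The kernel of [Q] is the orthogonal complement of the [e j]; it is nonzero because [Q] has only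
   [k < n] columns. *)
pose Q : 'M[R]_(n, k) := \matrix_(i, j) ip (delta_mx 0 i) (e j).
have ipQ u j : ip u (e j) = (u *m Q) 0 j.
  rewrite [in LHS](row_sum_delta u) ip_sum mxE; apply: eq_bigr => i _.
  by rewrite ipZ mxE.
have memK u : (u <= kermx Q)%MS = [forall j, ip u (e j) == 0].
  apply/idP/forallP => [/sub_kermxP uQ j|H]; first by rewrite ipQ uQ mxE.
  by apply/sub_kermxP/rowP => j; rewrite -ipQ (eqP (H j)) mxE.
have rk : (0 < \rank (kermx Q))%N.
  by rewrite mxrank_ker subn_gt0 (leq_ltn_trans (rank_leq_col Q)).
pose W := row_base (kermx Q).
have WE : (W :=: kermx Q)%MS by exact: eq_row_base.
have WF : (W *m F <= W)%MS.
  rewrite WE (eqmxMr F WE); apply/row_subP => i; rewrite row_mul memK.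
  have /[!memK]/forallP iK := row_sub i (kermx Q).
  by apply/forallP => j; rewrite F_sa eF ipC ipZ ipC (eqP (iK j)) mulr0.
have Wf : row_free W by exact: row_base_free.
clearbody W; move: rk W WE WF Wf; case: (\rank _) => // r _ W WE WF Wf.
have [u [a [u0 uW uF]]] := selfadjoint_eigenvector Wf WF.
have uu := ip_gt0 u0.
have s0 : 0 < Num.sqrt (ip u u) by rewrite sqrtr_gt0.
pose u1 := (Num.sqrt (ip u u))^-1 *: u.
have u1u1 : ip u1 u1 = 1.
  rewrite /u1 ipZ ipC ipZ mulrA -invfM -expr2 sqr_sqrtr ?ltW // mulVf //.
  by rewrite gt_eqF.
have u1e j : ip u1 (e j) = 0.
  move: uW; rewrite WE memK => /forallP/(_ j)/eqP ue.
  by rewrite /u1 ipZ ue mulr0.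
exists (fun i => if unlift ord_max i is Some j then e j else u1).
exists (fun i => if unlift ord_max i is Some j then d j else a); split.
  move=> i j.
  case: (unliftP ord_max i) => [i' ->|->]; case: (unliftP ord_max j) => [j' ->|->].
  - by rewrite eO (inj_eq (@lift_inj _ _)).
  - by rewrite ipC u1e eq_sym (negbTE (neq_lift _ _)).
  - by rewrite u1e (negbTE (neq_lift _ _)).
  - by rewrite u1u1 eqxx.
move=> i; case: (unliftP ord_max i) => [i' _|_]; first exact: eF.
by rewrite /u1 -scalemxAl uF !scalerA mulrC.
Qed.

Lemma spectral_theorem :
  exists (e : 'I_n -> 'rV[R]_n) (d : 'I_n -> R),
    (forall i j, ip (e i) (e j) = (i == j)%:R) /\
    forall i, e i *m F = d i *: e i.
Proof. exact: spectral_partial. Qed.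

End SelfAdjoint.

Lemma orthonormal_basis_exists :
  exists e : 'I_n -> 'rV[R]_n, forall i j, ip (e i) (e j) = (i == j)%:R.
Proof.
have [|e [d [eO _]]] := @spectral_theorem 0; last by exists e.
by move=> u v; rewrite !mulmx0 ip0 ipC ip0.
Qed.

Lemma orthonormal_trace (e : 'I_n -> 'rV[R]_n) (F : 'M[R]_n) :
  (forall i j, ip (e i) (e j) = (i == j)%:R) ->
  \sum_i ip (e i *m F) (e i) = \tr F.
Proof.
move=> eO; pose P := \matrix_i e i.
have PU : P \in unitmx by rewrite -row_free_unit; exact: orthonormal_row_free.
pose D := \matrix_(i, j) ip (e i *m F) (e j).
have PF : P *m F = D *m P.
  apply/row_matrixP => i; rewrite row_mul rowK [LHS](orthonormal_expand _ eO).
  rewrite row_mul [RHS]mulmx_sum_row; apply: eq_bigr => j _.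
  by rewrite rowK !mxE.
have -> : F = invmx P *m (D *m P) by rewrite -PF mulKmx.
rewrite mxtrace_mulC mulmxK //.
by apply: eq_bigr => i _; rewrite mxE -PF mulKmx.
Qed.

Lemma orthonormal_eigen_det (e : 'I_n -> 'rV[R]_n) (d : 'I_n -> R) (F : 'M[R]_n) x :
  (forall i j, ip (e i) (e j) = (i == j)%:R) ->
  (forall i, e i *m F = d i *: e i) ->
  \det (x%:M - F) = \prod_i (x - d i).
Proof.
move=> eO eF; pose P := \matrix_i e i.
have PU : P \in unitmx by rewrite -row_free_unit; exact: orthonormal_row_free.
have E : P *m (x%:M - F) = diag_mx (\row_i (x - d i)) *m P.
  apply/row_matrixP => i; rewrite mulmxBr mul_mx_scalar linearB /= linearZ /= !row_mul.
  by rewrite row_diag_mx -scalemxAl -rowE !rowK eF mxE scalerBl.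
have := congr1 determinant E; rewrite !det_mulmx det_diag mulrC.
move: PU; rewrite unitmxE unitfE => PU /(mulIf PU) ->.
by apply: eq_bigr => i _; rewrite mxE.
Qed.

End Spectral.

(** Multiplied by the product of the ['X - a%:P] over the excluded points, the difference vanishes
    everywhere, and the natural numbers provide more roots than its size allows. *)
Lemma poly_eq_cofinite (R : numDomainType) (p q : {poly R}) (s : seq R) :
  (forall x, x \notin s -> p.[x] = q.[x]) -> p = q.
Proof.
move=> pq; apply/eqP; rewrite -subr_eq0.
pose P := (p - q) * \prod_(a <- s) ('X - a%:P).
have P0 : P = 0.
  have Pz x : P.[x] = 0.
    rewrite hornerM; have [xs|/pq E] := boolP (x \in s).
      by move: (xs); rewrite -root_prod_XsubC => /rootP ->; rewrite mulr0.
    by rewrite !hornerE E subrr mul0r.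
  apply/eqP/negPn/negP => nz.
  have /(_ [seq n%:R | n <- iota 0 (size P)]) := max_poly_roots nz.
  rewrite size_map size_iota ltnn => H; suff : false by []; apply: H.
    by apply/allP => x _; apply/rootP; exact: Pz.
  by rewrite map_inj_uniq ?iota_uniq // => i j /eqP; rewrite eqr_nat => /eqP.
move/eqP: P0; rewrite mulf_eq0 => /orP[//|].
by rewrite (negbTE (monic_neq0 (monic_prod_XsubC _ _ _))).
Qed.

Lemma prod_XsubC_perm (R : fieldType) n (d k : 'I_n -> R) :
  \prod_i ('X - (d i)%:P) = \prod_i ('X - (k i)%:P) ->
  exists s : 'S_n, forall i, k i = d (s i).
Proof.
move=> E.
have /tuple_permP[s sE] : perm_eq [tuple k i | i < n] [tuple d i | i < n].
  apply: prod_XsubC_eq; rewrite !big_tuple.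
  under eq_bigr do rewrite tnth_mktuple.
  by under [RHS]eq_bigr do rewrite tnth_mktuple.
exists s => i; have := congr1 (fun t : seq R => nth 0 t i) sE.
by rewrite -!tnth_nth !tnth_mktuple.
Qed.

Lemma mul_rV_lin1_mx (R : comNzRingType) n k (f : 'rV[R]_n -> 'rV[R]_k) u :
  linear f -> u *m lin1_mx f = f u.
Proof.
move=> fl; rewrite (linear_rowE u fl) mulmx_sum_row; apply: eq_bigr => i _.
by congr (_ *: _); apply/rowP => j; rewrite !mxE.
Qed.

(** The matrix determinant lemma: one bordered matrix is factored in two ways. *)
Lemma det_1_rank1 (R : comNzRingType) n (u : 'cV[R]_n) (v : 'rV[R]_n) :
  \det (1%:M + u *m v) = 1 + (v *m u) 0 0.
Proof.
pose M := block_mx (1%:M : 'M[R]_n) u (- v) (1%:M : 'M[R]_1).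
have M1 : M = block_mx 1%:M 0 (- v) 1%:M *m block_mx 1%:M u 0 (1%:M + v *m u).
  rewrite mulmx_block !(mul1mx, mulmx1, mul0mx, mulmx0, addr0, add0r).
  by rewrite mulNmx addrCA addNr addr0.
have M2 : M = block_mx (1%:M + u *m v) u 0 1%:M *m block_mx 1%:M 0 (- v) 1%:M.
  rewrite mulmx_block !(mul1mx, mulmx1, mul0mx, mulmx0, addr0, add0r).
  by rewrite mulmxN addrK.
have := congr1 determinant M1; rewrite M2 !det_mulmx !det_ublock !det_lblock !det1.
by rewrite !mulr1 !mul1r => ->; rewrite det_mx11 !mxE.
Qed.

(** The inverse of [A] is an argument, so that a closed form of it can be inserted. *)
Lemma det_schur (R : comNzRingType) n k (A A' : 'M[R]_n) (B : 'M[R]_(n, k)) C (D : 'M[R]_k) :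
  A' *m A = 1%:M -> \det (block_mx A B C D) = \det A * \det (D - C *m A' *m B).
Proof.
move=> AA'.
have -> : block_mx A B C D = block_mx A 0 C 1%:M *m block_mx 1%:M (A' *m B) 0 (D - C *m A' *m B).
  rewrite mulmx_block !(mul1mx, mulmx1, mul0mx, mulmx0, addr0, add0r).
  rewrite mulmxA (mulmx1C AA') mul1mx.
  by rewrite mulmxA addrCA subrr addr0.
by rewrite det_mulmx det_lblock det_ublock !det1 mulr1 mul1r.
Qed.

(** * Generalized Heisenberg algebras *)

Section Heisenberg.
Context {R : realType} {p m : nat} (H : genHeisenberg R p m).
Implicit Types (U V W : 'rV[R]_p) (X Y Z : 'rV[R]_m) (a : R) (w : {vspace 'rV[R]_p}).

Lemma ipvDl U V W : ipv H (U + V) W = ipv H U W + ipv H V W.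
Proof. exact: linearDl. Qed.
Lemma ipvDr U V W : ipv H U (V + W) = ipv H U V + ipv H U W.
Proof. exact: linearDr. Qed.
Lemma ipvZl a U V : ipv H (a *: U) V = a * ipv H U V.
Proof. exact: linearZl_LR. Qed.
Lemma ipvZr a U V : ipv H U (a *: V) = a * ipv H U V.
Proof. exact: linearZr_LR. Qed.
Lemma ipvNl U V : ipv H (- U) V = - ipv H U V.
Proof. exact: linearNl. Qed.
Lemma ipvNr U V : ipv H U (- V) = - ipv H U V.
Proof. exact: linearNr. Qed.
Lemma ipv0l U : ipv H 0 U = 0. Proof. exact: linear0l. Qed.
Lemma ipv0r U : ipv H U 0 = 0. Proof. exact: linear0r. Qed.
Lemma ipvC U V : ipv H U V = ipv H V U.
Proof. by rewrite hermC /= expr0 mul1r. Qed.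
Lemma ipv_gt0 U : U != 0 -> 0 < ipv H U U.
Proof. exact: neq0_dnorm_gt0. Qed.
Lemma ipv_ge0 U : 0 <= ipv H U U.
Proof. by have [->|/ipv_gt0/ltW//] := eqVneq U 0; rewrite ipv0l. Qed.
Lemma ipv_eq0 U : ipv H U U = 0 -> U = 0.
Proof. by move=> E; apply/eqP/negPn/negP => /ipv_gt0; rewrite E ltxx. Qed.

Lemma ipzDl X Y Z : ipz H (X + Y) Z = ipz H X Z + ipz H Y Z.
Proof. exact: linearDl. Qed.
Lemma ipzDr X Y Z : ipz H X (Y + Z) = ipz H X Y + ipz H X Z.
Proof. exact: linearDr. Qed.
Lemma ipzZl a X Y : ipz H (a *: X) Y = a * ipz H X Y.
Proof. exact: linearZl_LR. Qed.
Lemma ipzZr a X Y : ipz H X (a *: Y) = a * ipz H X Y.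
Proof. exact: linearZr_LR. Qed.
Lemma ipzNl X Y : ipz H (- X) Y = - ipz H X Y.
Proof. exact: linearNl. Qed.
Lemma ipzNr X Y : ipz H X (- Y) = - ipz H X Y.
Proof. exact: linearNr. Qed.
Lemma ipz0l X : ipz H 0 X = 0. Proof. exact: linear0l. Qed.
Lemma ipz0r X : ipz H X 0 = 0. Proof. exact: linear0r. Qed.
Lemma ipzC X Y : ipz H X Y = ipz H Y X.
Proof. by rewrite hermC /= expr0 mul1r. Qed.
Lemma ipz_gt0 X : X != 0 -> 0 < ipz H X X.
Proof. exact: neq0_dnorm_gt0. Qed.
Lemma ipz_ge0 X : 0 <= ipz H X X.
Proof. by have [->|/ipz_gt0/ltW//] := eqVneq X 0; rewrite ipz0l. Qed.
Lemma ipz_eq0 X : ipz H X X = 0 -> X = 0.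
Proof. by move=> E; apply/eqP/negPn/negP => /ipz_gt0; rewrite E ltxx. Qed.

Lemma betaDl U V W : beta H (U + V) W = beta H U W + beta H V W.
Proof. exact: linearDl. Qed.
Lemma betaDr U V W : beta H U (V + W) = beta H U V + beta H U W.
Proof. exact: linearDr. Qed.
Lemma betaZl a U V : beta H (a *: U) V = a *: beta H U V.
Proof. exact: linearZl_LR. Qed.
Lemma betaZr a U V : beta H U (a *: V) = a *: beta H U V.
Proof. exact: linearZr_LR. Qed.
Lemma betaNl U V : beta H (- U) V = - beta H U V.
Proof. exact: linearNl. Qed.
Lemma betaNr U V : beta H U (- V) = - beta H U V.
Proof. exact: linearNr. Qed.
Lemma beta0l U : beta H 0 U = 0. Proof. exact: linear0l. Qed.
Lemma beta0r U : beta H U 0 = 0. Proof. exact: linear0r. Qed.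
Lemma betaxx U : beta H U U = 0.
Proof.
have /rowP UU := beta_skew H U U; apply/rowP => i; rewrite mxE.
by have := UU i; rewrite mxE; lra.
Qed.

Definition ipvE := (ipvDl, ipvDr, ipvZl, ipvZr, ipvNl, ipvNr, ipv0l, ipv0r).
Definition ipzE := (ipzDl, ipzDr, ipzZl, ipzZr, ipzNl, ipzNr, ipz0l, ipz0r).
Definition betaE := (betaDl, betaDr, betaZl, betaZr, betaNl, betaNr, beta0l, beta0r).

Lemma ipv_inj U V : (forall W, ipv H U W = ipv H V W) -> U = V.
Proof.
move=> E; apply/eqP; rewrite -subr_eq0; apply/eqP/ipv_eq0.
by rewrite ipvDl E -ipvDl subrr ipv0l.
Qed.

Lemma ipz_inj X Y : (forall Z, ipz H X Z = ipz H Y Z) -> X = Y.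
Proof.
move=> E; apply/eqP; rewrite -subr_eq0; apply/eqP/ipz_eq0.
by rewrite ipzDl E -ipzDl subrr ipz0l.
Qed.

Lemma J_linl U a X Y : J H (a *: X + Y) U = a *: J H X U + J H Y U.
Proof.
by apply: ipv_inj => W; rewrite !ipvE !J_adjoint !ipzE.
Qed.
Lemma J_0 U : J H 0 U = 0.
Proof. by apply: ipv_inj => W; rewrite !ipvE !J_adjoint !ipzE. Qed.
Lemma J_Dl U X Y : J H (X + Y) U = J H X U + J H Y U.
Proof. by rewrite -[X]scale1r J_linl !scale1r. Qed.
Lemma J_Zl U a X : J H (a *: X) U = a *: J H X U.
Proof. by rewrite -[a *: X]addr0 J_linl J_0 addr0. Qed.
Lemma J_skew X U V : ipv H (J H X U) V = - ipv H U (J H X V).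
Proof. by rewrite [ipv H U _]ipvC !J_adjoint beta_skew ipzNl. Qed.

Lemma J_self X U : ipv H (J H X U) U = 0.
Proof. by rewrite J_adjoint betaxx ipz0l. Qed.

(** Polarization of [J_sqr], using that [J H Z] is skew. *)
Lemma J_isometry X Y U : ipv H (J H X U) (J H Y U) = ipz H X Y * ipv H U U.
Proof.
have sq Z : ipv H (J H Z U) (J H Z U) = ipz H Z Z * ipv H U U.
  by rewrite J_skew J_sqr scaleNr ipvNr ipvZr opprK.
have := sq (X + Y); rewrite J_Dl !ipvE !ipzE !sq.
rewrite [ipv H (J H Y U) (J H X U)]ipvC [ipz H Y X]ipzC; nra.
Qed.

Lemma beta_J X U : beta H U (J H X U) = ipv H U U *: X.
Proof.
apply: ipz_inj => Z; rewrite -J_adjoint J_isometry ipzZl ipzC; ring.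
Qed.

Lemma ipv_lin a U V W : ipv H (a *: U + V) W = a * ipv H U W + ipv H V W.
Proof. by rewrite !ipvE. Qed.
Lemma ipz_lin a X Y Z : ipz H (a *: X + Y) Z = a * ipz H X Z + ipz H Y Z.
Proof. by rewrite !ipzE. Qed.

Variable w : {vspace 'rV[R]_p}.

Definition projp U : 'rV[R]_p := daddv_pi (vperp H w) w U.

Lemma vperpP U : reflect (forall V, V \in w -> ipv H U V = 0) (U \in vperp H w).
Proof. exact: mem_orthovP. Qed.

Lemma vperp_capv : (vperp H w :&: w = 0)%VS.
Proof.
apply/eqP; rewrite -subv0; apply/subvP => U; rewrite memv_cap memv0.
by move=> /andP[/vperpP UP Uw]; apply/eqP/ipv_eq0/UP.
Qed.

(** A dimension count: each vector of a spanning list lowers the dimension of the orthogonal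
    complement by at most one. *)
Lemma vperp_addv : (vperp H w + w = fullv)%VS.
Proof.
have orthov_span (t : seq 'rV[R]_p) :
    (p <= \dim (orthov (ipv H) <<t>>%VS) + size t)%N.
  elim: t => [|u t IH]; first by rewrite span_nil orthov0 dimvf /dim /= addn0 mul1n.
  have sub : (orthov (ipv H) <<t>>%VS :&: orthov (ipv H) <[u]> <= orthov (ipv H) <<u :: t>>%VS)%VS.
    apply/subvP => v; rewrite memv_cap => /andP[/mem_orthovP vs /mem_orthovP vu].
    apply/mem_orthovP => y; rewrite span_cons => /memv_addP[y1 y1u [y2 y2s ->]].
    by rewrite linearDr /=; apply: etrans (congr2 +%R (vu _ y1u) (vs _ y2s)) _; rewrite addr0.
  have := dimvS sub; have := leq_dim_orthov1 (ipv H) u (orthov (ipv H) <<t>>%VS).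
  move: IH; rewrite /= addnS => h1 h2 h3.
  apply: leq_trans h1 _; rewrite -addSn leq_add2r.
  by rewrite (leq_trans (leqSpred _)) // ltnS (leq_trans h2).
apply/eqP; rewrite eqEdim subvf /= dimv_disjoint_sum; last exact: vperp_capv.
have := orthov_span (vbasis w); rewrite size_tuple (span_basis (vbasisP w)).
by rewrite dimvf /dim /= mul1n.
Qed.

Lemma projp_linear : linear projp.
Proof. by move=> a U V; rewrite /projp linearP. Qed.
Lemma projpD U V : projp (U + V) = projp U + projp V.
Proof. exact: linearD. Qed.
Lemma projpZ a U : projp (a *: U) = a *: projp U.
Proof. exact: linearZ. Qed.
Lemma projpN U : projp (- U) = - projp U.
Proof. exact: linearN. Qed.
Lemma projp0 : projp 0 = 0. Proof. exact: linear0. Qed.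
Definition projpE := (projpD, projpZ, projpN, projp0).

Lemma projp_vperp U : projp U \in vperp H w.
Proof. exact: memv_pi. Qed.

Lemma sub_projp U : U - projp U \in w.
Proof.
have : U \in (vperp H w + w)%VS by rewrite vperp_addv memvf.
move=> /(daddv_pi_add vperp_capv) E; rewrite -[X in X - _]E /projp addrC addKr.
exact: memv_pi.
Qed.

Lemma projp_id U : U \in vperp H w -> projp U = U.
Proof. by move=> Uw; apply: daddv_pi_id => //; exact: vperp_capv. Qed.

Lemma projp_eq0 U : U \in w -> projp U = 0.
Proof.
move=> Uw; apply: ipv_eq0; have /vperpP h := projp_vperp U.
rewrite -[X in ipv H _ X]opprK ipvNr -[X in ipv H _ X]addr0 -(subrr U) addrA.
rewrite [- projp U + U]addrC ipvDr ipvNr (h _ Uw) (h _ (sub_projp U)); ring.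
Qed.

Lemma projp_eq0P U : (projp U == 0) = (U \in w).
Proof.
apply/eqP/idP => [E|]; last exact: projp_eq0.
by have := sub_projp U; rewrite E subr0.
Qed.

Lemma projpK U : projp (projp U) = projp U.
Proof. by rewrite projp_id // projp_vperp. Qed.

Lemma projp_ip U V : ipv H (projp U) (projp V) = ipv H (projp U) V.
Proof.
have /vperpP/(_ _ (sub_projp V)) := projp_vperp U.
by rewrite ipvDr ipvNr => /eqP; rewrite subr_eq0 => /eqP ->.
Qed.

Lemma projp_sa U V : ipv H (projp U) V = ipv H U (projp V).
Proof. by rewrite -projp_ip ipvC projp_ip ipvC. Qed.

Lemma F_E Z U : F_ H w Z U = projp (J H Z U).
Proof. by []. Qed.

Lemma P_E Z U : P_ H w Z U = J H Z U - projp (J H Z U).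
Proof.
have : J H Z U \in (vperp H w + w)%VS by rewrite vperp_addv memvf.
move=> /(daddv_pi_add vperp_capv) E; rewrite -[X in X - _]E /projp addrC addKr.
by [].
Qed.

Lemma unit_vperp_exists : w != fullv ->
  exists xi, xi \in vperp H w /\ ipv H xi xi = 1.
Proof.
move=> wp.
have [U Uw] : exists U, U \notin w.
  apply: contrapT => h; case/negP: wp; apply/eqP/vspaceP => U; rewrite memvf.
  by apply/negPn/negP => Uw; apply: h; exists U.
have P0 : projp U != 0 by rewrite projp_eq0P.
have s0 := ipv_gt0 P0.
exists ((Num.sqrt (ipv H (projp U) (projp U)))^-1 *: projp U); split.
  by rewrite memvZ // projp_vperp.
rewrite ipvZl ipvZr mulrA -invfM -expr2 sqr_sqrtr ?ltW // mulVf //.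
by rewrite gt_eqF.
Qed.

End Heisenberg.

(** * The shape operator as a matrix *)

Section ShapeMatrix.
Context {R : realType} {p m : nat} (H : genHeisenberg R p m).
Variable w : {vspace 'rV[R]_p}.
Implicit Types (U V W xi : 'rV[R]_p) (X Y Z : 'rV[R]_m) (a : R).
Local Notation pi := (projp H w).

Definition ipn (u v : 'rV[R]_(p + m)) : R :=
  ipv H (lsubmx u) (lsubmx v) + ipz H (rsubmx u) (rsubmx v).

Lemma ipn_row U X V Y : ipn (row_mx U X) (row_mx V Y) = ipv H U V + ipz H X Y.
Proof. by rewrite /ipn !row_mxKl !row_mxKr. Qed.

Lemma ipn_lin a u v x : ipn (a *: u + v) x = a * ipn u x + ipn v x.
Proof. by rewrite /ipn !linearD !linearZ /= ipv_lin ipz_lin; ring. Qed.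

Lemma ipnC u v : ipn u v = ipn v u.
Proof. by rewrite /ipn ipvC ipzC. Qed.

Lemma ipn_gt0 u : u != 0 -> 0 < ipn u u.
Proof.
move=> u0; rewrite lt_neqAle addr_ge0 ?ipv_ge0 ?ipz_ge0 // andbT eq_sym.
apply: contra u0 => /eqP E; have := ipv_ge0 H (lsubmx u); have := ipz_ge0 H (rsubmx u).
move: E; rewrite /ipn => E e1 e2.
have /ipv_eq0 l0 : ipv H (lsubmx u) (lsubmx u) = 0 by lra.
have /ipz_eq0 r0 : ipz H (rsubmx u) (rsubmx u) = 0 by lra.
by rewrite -[u]hsubmxK l0 r0 row_mx0.
Qed.

Variables tau sigma rho : R.

Definition shape_v xi U : 'rV[R]_p :=
  (tau / 2) *: U + rho *: (pi U - ipv H U xi *: xi).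

(** Matrices act on row vectors [row_mx U X] of v + z. *)
Definition shape_mx xi : 'M[R]_(p + m) :=
  block_mx (lin1_mx (shape_v xi)) (lin1_mx (fun U => (sigma / 2) *: beta H U xi))
           (lin1_mx (fun X => - (sigma / 2) *: J H X xi)) tau%:M.

(** By [kahler_mx_ip] this is the operator of the quadratic form that sends Z to the squared length
    of [F_ H w Z xi], the form that defines the generalized Kaehler angle. *)
Definition kahler_mx xi : 'M[R]_m := lin1_mx (fun X => beta H xi (pi (J H X xi))).

Lemma shape_v_linear xi : linear (shape_v xi).
Proof.
move=> a U V; rewrite /shape_v projp_linear ipv_lin.
by apply/rowP => i; rewrite !mxE; ring.
Qed.

Lemma beta_linear xi : linear (fun U => (sigma / 2) *: beta H U xi).
Proof.
by move=> a U V; rewrite !betaE; apply/rowP => i; rewrite !mxE; ring.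
Qed.

Lemma J_linear xi : linear (fun X => - (sigma / 2) *: J H X xi).
Proof.
by move=> a X Y; rewrite J_linl; apply/rowP => i; rewrite !mxE; ring.
Qed.

Lemma kahler_linear xi : linear (fun X => beta H xi (pi (J H X xi))).
Proof. by move=> a X Y; rewrite J_linl !projpE !betaE. Qed.

Lemma mul_shape_mx xi U X : row_mx U X *m shape_mx xi =
  row_mx (shape_v xi U - (sigma / 2) *: J H X xi)
         ((sigma / 2) *: beta H U xi + tau *: X).
Proof.
rewrite mul_row_block (mul_rV_lin1_mx _ (shape_v_linear xi)).
rewrite (mul_rV_lin1_mx _ (beta_linear xi)) (mul_rV_lin1_mx _ (J_linear xi)).
by rewrite mul_mx_scalar scaleNr.
Qed.

Lemma mul_kahler_mx xi X : X *m kahler_mx xi = beta H xi (pi (J H X xi)).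
Proof. exact: mul_rV_lin1_mx (kahler_linear xi). Qed.

Lemma kahler_mx_ip xi X Y :
  ipz H (X *m kahler_mx xi) Y = ipv H (pi (J H X xi)) (pi (J H Y xi)).
Proof. by rewrite mul_kahler_mx -J_adjoint ipvC projp_ip. Qed.

Lemma kahler_mx_sa xi X Y :
  ipz H (X *m kahler_mx xi) Y = ipz H X (Y *m kahler_mx xi).
Proof. by rewrite kahler_mx_ip [RHS]ipzC kahler_mx_ip ipvC. Qed.

Lemma shape_mx_sa xi u v : ipn (u *m shape_mx xi) v = ipn u (v *m shape_mx xi).
Proof.
rewrite -[u]hsubmxK -[v]hsubmxK; set U := lsubmx u; set X := rsubmx u.
set V := lsubmx v; set Y := rsubmx v.
rewrite !mul_shape_mx !ipn_row /shape_v !ipvE !ipzE.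
rewrite projp_sa [ipv H U (J H Y xi)]ipvC !J_adjoint (beta_skew H xi U).
rewrite (beta_skew H xi V) !ipzNl [ipz H X (beta _ _ _)]ipzC [ipv H xi V]ipvC; ring.
Qed.

Variable xi : 'rV[R]_p.
Hypothesis xi_perp : xi \in vperp H w.
Hypothesis xi_unit : ipv H xi xi = 1.

(** Orthogonal projection onto the part of [vperp H w] orthogonal to [xi]. *)
Definition projx U : 'rV[R]_p := pi U - ipv H U xi *: xi.

Lemma pi_xi : pi xi = xi. Proof. exact: projp_id. Qed.

Lemma ip_pi_xi U : ipv H (pi U) xi = ipv H U xi.
Proof. by rewrite projp_sa pi_xi. Qed.

Lemma projxK U : projx (projx U) = projx U.
Proof.
rewrite /projx !projpE projpK pi_xi !ipvE ip_pi_xi xi_unit mulr1 subrr scale0r.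
by rewrite subr0.
Qed.

Lemma projx_linear : linear projx.
Proof.
move=> a U V; rewrite /projx projp_linear ipv_lin.
by apply/rowP => i; rewrite !mxE; ring.
Qed.

Lemma shape_vE U : shape_v xi U = (tau / 2) *: U + rho *: projx U.
Proof. by []. Qed.

Lemma mxtrace_lin1 (f : 'rV[R]_p -> 'rV[R]_p) : \tr (lin1_mx f) = \sum_i f (delta_mx 0 i) 0 i.
Proof. by apply: eq_bigr => i _; rewrite mxE. Qed.

Lemma ipv_coord U V : ipv H U V = \sum_i U 0 i * ipv H (delta_mx 0 i) V.
Proof.
rewrite {1}(row_sum_delta U) (@ip_sum _ _ (ipv H) (@ipv_lin _ _ _ H)).
by apply: eq_bigr => i _; rewrite ipvZl.
Qed.

(** Only the diagonal blocks count, and [xi] enters them through its length alone. This is the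
    source of the constant mean curvature. *)
Lemma trace_shape_mx : \tr (shape_mx xi) =
  tau / 2 * p%:R + rho * (\tr (lin1_mx pi) - 1) + tau * m%:R.
Proof.
rewrite mxtrace_block mxtrace_scalar !mxtrace_lin1 -[tau *+ m]mulr_natr; congr (_ + _).
rewrite -[X in _ * (_ - X)]xi_unit ipv_coord -sumrB mulr_sumr.
have -> : p%:R = \sum_(i < p) (1 : R) by rewrite sumr_const card_ord.
rewrite mulr_sumr -big_split /=.
by apply: eq_bigr => i _; rewrite !mxE !eqxx /=; ring.
Qed.

(** The trace minus 1 is the trace of [projx], a self-adjoint idempotent. *)
Lemma trace_projp_ge1 : 1 <= \tr (lin1_mx pi).
Proof.
have [e eO] := orthonormal_basis_exists (@ipv_lin _ _ _ H) (@ipvC _ _ _ H) (@ipv_gt0 _ _ _ H).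
pose E : 'M[R]_p := lin1_mx projx.
have := orthonormal_trace (@ipv_lin _ _ _ H) E eO.
have -> : \tr E = \tr (lin1_mx pi) - 1.
  rewrite /E !mxtrace_lin1 -[X in _ - X]xi_unit ipv_coord -sumrB; apply: eq_bigr => i _.
  by rewrite !mxE mulrC.
move=> tE; rewrite -subr_ge0 -tE; apply: sumr_ge0 => i _.
rewrite (mul_rV_lin1_mx _ projx_linear).
have -> : ipv H (projx (e i)) (e i) = ipv H (projx (e i)) (projx (e i)).
  rewrite /projx !ipvE projp_ip ip_pi_xi xi_unit ![ipv H xi _]ipvC ip_pi_xi; ring.
exact: ipv_ge0.
Qed.

Lemma trace_shape_mx_gt0 : 0 < tau -> 0 < rho -> 0 < \tr (shape_mx xi).
Proof.
move=> t0 r0; rewrite trace_shape_mx.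
have h1 : 0 <= tau / 2 * p%:R by rewrite mulr_ge0 // divr_ge0 // ltW.
have h2 : 0 <= rho * (\tr (lin1_mx pi) - 1).
  by rewrite mulr_ge0 ?subr_ge0 ?trace_projp_ge1 // ltW.
have h3 : 0 < tau * m%:R by rewrite mulr_gt0 // ltr0n (z_neq0 H).
by lra.
Qed.

Section CharPoly.
Variable x : R.
Let delta := x - tau / 2.
Let eps := delta - rho.
Hypotheses (delta0 : delta != 0) (eps0 : eps != 0).

(** The inverse of the block of [x%:M - shape_mx xi] on v. *)
Let res U : 'rV[R]_p := delta^-1 *: (U - projx U) + eps^-1 *: projx U.

Let res_linear : linear res.
Proof.
move=> a U V; rewrite /res projx_linear.
by apply/rowP => i; rewrite !mxE; ring.
Qed.

Let resK : lin1_mx res *m (x%:M - lin1_mx (shape_v xi)) = 1%:M.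
Proof.
apply/row_matrixP => i; rewrite !rowE mulmxA (mul_rV_lin1_mx _ res_linear) mulmx1.
rewrite mulmxBr mul_mx_scalar (mul_rV_lin1_mx _ (shape_v_linear xi)).
set u := delta_mx 0 i; rewrite shape_vE /res.
have -> : projx (delta^-1 *: (u - projx u) + eps^-1 *: projx u) = eps^-1 *: projx u.
  have pN : projx (u - projx u) = 0.
    rewrite [u - _]addrC -scaleN1r projx_linear projxK scaleN1r addNr //.
  rewrite projx_linear pN scaler0 add0r -[eps^-1 *: _]addr0 projx_linear projxK.
  have -> : projx 0 = 0 by rewrite /projx projp0 ipv0l scale0r subr0.
  by rewrite addr0.
apply/rowP => j; rewrite !mxE.
have xE : x = delta + tau / 2 by rewrite /delta subrK.
have rE : rho = delta - eps by rewrite /eps; ring.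
rewrite xE rE; field.
by rewrite delta0 eps0.
Qed.

(** The dependence on [xi] is a rank one perturbation, and [xi] is an eigenvector of
    [delta%:M - rho *: lin1_mx pi] with eigenvalue [eps]; hence [xi] drops out of the
    determinant. *)
Let det_v : \det (x%:M - lin1_mx (shape_v xi)) =
  \det (delta%:M - rho *: lin1_mx pi) * (1 + rho / eps).
Proof.
pose N := (\col_i (rho / eps * ipv H (delta_mx 0 i) xi)) *m xi.
have -> : x%:M - lin1_mx (shape_v xi) = (1%:M + N) *m (delta%:M - rho *: lin1_mx pi).
  have xA : xi *m (delta%:M - rho *: lin1_mx pi) = eps *: xi.
    rewrite mulmxBr mul_mx_scalar -scalemxAr (mul_rV_lin1_mx _ (projp_linear _ _)).
    by rewrite pi_xi -scalerBl.
  rewrite mulmxDl mul1mx -mulmxA xA; apply/matrixP => i j; rewrite !mxE big_ord1 !mxE.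
  rewrite eqxx [j == i]eq_sym /=.
  have -> : x = delta + tau / 2 by rewrite /delta subrK.
  by case: (i == j) => /=; field.
rewrite det_mulmx det_1_rank1 mulrC; congr (_ * (1 + _)).
rewrite mxE -[RHS]mulr1 -[X in _ = _ * X]xi_unit ipv_coord mulr_sumr.
by apply: eq_bigr => i _; rewrite mxE; ring.
Qed.

(** The Schur complement of that block is
    [shape_factor *: (shape_cubic%:M + kahler_mx xi)]. *)
Definition shape_factor : R := - (sigma ^+ 2 / 4) * rho / (delta * eps).
Definition shape_cubic : R :=
  - (4 / (sigma ^+ 2 * rho)) * ((x - tau) * delta - sigma ^+ 2 / 4) * eps.

Hypotheses (sigma0 : sigma != 0) (rho0 : rho != 0).

(** Since [J H X xi] is orthogonal to [xi], the inverse [res] sends it to [delta^-1] times itself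
    plus [eps^-1 - delta^-1 = rho / (delta * eps)] times its projection by [pi]. Applying
    [beta H xi] turns the first summand into a multiple of [X], by [beta_J], and the second into a
    multiple of [X *m kahler_mx xi]. *)
Lemma det_shape_mx : \det (x%:M - shape_mx xi) =
  \det (delta%:M - rho *: lin1_mx pi) * (1 + rho / eps) *
  (shape_factor ^+ m * \det (shape_cubic%:M + kahler_mx xi)).
Proof.
have -> : x%:M - shape_mx xi = block_mx (x%:M - lin1_mx (shape_v xi))
    (- lin1_mx (fun U => (sigma / 2) *: beta H U xi))
    (- lin1_mx (fun X => - (sigma / 2) *: J H X xi)) ((x - tau)%:M).
  rewrite (scalar_mx_block p m x) /shape_mx opp_block_mx add_block_mx !add0r.
  by rewrite (raddfB (@scalar_mx _ _)).
rewrite (det_schur _ _ _ resK) det_v; congr (_ * _).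
rewrite -detZ; congr (\det _); apply/row_matrixP => i; rewrite !rowE.
set X := delta_mx 0 i.
rewrite mulmxBr mul_mx_scalar !mulmxA !mulmxN !mulNmx opprK.
rewrite (mul_rV_lin1_mx _ (J_linear xi)) (mul_rV_lin1_mx _ res_linear).
rewrite (mul_rV_lin1_mx _ (beta_linear xi)).
rewrite -scalemxAr mulmxDr mul_mx_scalar mul_kahler_mx.
set F := pi (J H X xi).
have pJ : projx (- (sigma / 2) *: J H X xi) = - (sigma / 2) *: F.
  by rewrite /projx !projpE ipvZl J_self mulr0 scale0r subr0.
rewrite /res pJ !betaE !(beta_skew H _ xi) beta_J xi_unit scale1r.
apply/rowP => j; rewrite !mxE /shape_factor /shape_cubic.
move: eps0; rewrite /eps => e0; field.
by rewrite delta0 e0 sigma0 rho0.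
Qed.

End CharPoly.

End ShapeMatrix.

(** * Constancy of spectra: the shape matrix against the Kaehler matrix *)

Definition has_spectrum (R : realType) n (ip : 'rV[R]_n -> 'rV[R]_n -> R) (F : 'M[R]_n)
    (d : 'I_n -> R) : Prop :=
  exists e : 'I_n -> 'rV[R]_n,
    (forall i j, ip (e i) (e j) = (i == j)%:R) /\ forall i, e i *m F = d i *: e i.

Lemma has_spectrum_perm (R : realType) n (ip : 'rV[R]_n -> 'rV[R]_n -> R) (F : 'M[R]_n)
    (d k : 'I_n -> R) (s : 'S_n) :
  has_spectrum ip F d -> (forall i, k i = d (s i)) -> has_spectrum ip F k.
Proof.
move=> [e [eO eF]] sE; exists (fun i => e (s i)); split.
  by move=> i j; rewrite eO (inj_eq perm_inj).
by move=> i; rewrite eF sE.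
Qed.

Section ConstantSpectrum.
Context {R : realType} {p m : nat} (H : genHeisenberg R p m).
Variable w : {vspace 'rV[R]_p}.
Hypothesis w_proper : w != fullv.
Variables tau sigma rho : R.
Hypotheses (sigma0 : sigma != 0) (rho0 : rho != 0).

Let unit_perp xi := xi \in vperp H w /\ ipv H xi xi = 1.
Let S xi := shape_mx H w tau sigma rho xi.
Let C xi := kahler_mx H w xi.
(** The values of x at which the block on v may fail to be invertible. *)
Let bad := [:: tau / 2; tau / 2 + rho].

Let bad_delta x : x \notin bad -> x - tau / 2 != 0 /\ x - tau / 2 - rho != 0.
Proof.
rewrite !inE negb_or => /andP[x1 x2]; split; first by rewrite subr_eq0.
by rewrite -addrA -opprD subr_eq0.
Qed.

Let cubic : {poly R} :=
  (- (4 / (sigma ^+ 2 * rho))) *: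
  ((('X - tau%:P) * ('X - (tau / 2)%:P) - (sigma ^+ 2 / 4)%:P) * ('X - (tau / 2 + rho)%:P)).

Let cubicE x : cubic.[x] = shape_cubic tau sigma rho x.
Proof.
rewrite /cubic /shape_cubic hornerZ !(hornerM, hornerD, hornerN, hornerX, hornerC).
by ring.
Qed.

(** Substitution of a nonconstant polynomial is injective; this is how the spectrum of [C] is
    recovered from that of [S]. *)
Let size_cubic : (1 < size cubic)%N.
Proof.
have c0 : - (4 / (sigma ^+ 2 * rho)) != 0.
  by rewrite oppr_eq0 mulf_neq0 // invr_neq0 // mulf_neq0 // expf_neq0.
rewrite /cubic size_scale //.
set q := _ - (sigma ^+ 2 / 4)%:P.
have sq : size q = 3%N.
  rewrite /q size_polyDl; first by rewrite size_mul ?polyXsubC_eq0 // !size_XsubC.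
  by rewrite size_polyN size_mul ?polyXsubC_eq0 // !size_XsubC (leq_ltn_trans (size_polyC_leq1 _)).
by rewrite size_mul ?polyXsubC_eq0 // -?size_poly_gt0 sq // size_XsubC.
Qed.

Let det_cubic xi c x : has_spectrum (ipz H) (C xi) c ->
  \det ((shape_cubic tau sigma rho x)%:M + C xi) =
  ((\prod_i ('X - (- c i)%:P)) \Po cubic).[x].
Proof.
move=> [Z [ZO ZC]].
rewrite -[C xi]opprK (orthonormal_eigen_det (@ipz_lin _ _ _ H) _ (d := fun i => - c i) ZO).
  rewrite horner_comp cubicE horner_prod; apply: eq_bigr => i _.
  by rewrite !hornerE.
by move=> i; rewrite mulmxN ZC scaleNr.
Qed.

Let det_shape xi k x : has_spectrum (ipn H) (S xi) k ->
  \det (x%:M - S xi) = (\prod_i ('X - (k i)%:P)).[x].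
Proof.
move=> [e [eO eS]]; rewrite (orthonormal_eigen_det (@ipn_lin _ _ _ H) _ eO eS).
by rewrite horner_prod; apply: eq_bigr => i _; rewrite !hornerE.
Qed.

Let factor x := \det ((x - tau / 2)%:M - rho *: lin1_mx (projp H w)) *
  (1 + rho / (x - tau / 2 - rho)) * shape_factor tau sigma rho x ^+ m.

Let det_factor xi x : unit_perp xi -> x \notin bad ->
  \det (x%:M - S xi) = factor x * \det ((shape_cubic tau sigma rho x)%:M + C xi).
Proof.
move=> [xw x1] /bad_delta[d0 e0].
by rewrite /S (det_shape_mx xw x1 d0 e0 sigma0 rho0) mulrA.
Qed.

(** Every operator involved has some spectrum by [spectral_theorem]. For two unit vectors,
    [det_factor] carries equality of characteristic polynomials from one kind of operator to the
    other; the eigenvalues then agree up to a permutation, which [has_spectrum_perm] absorbs. *)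
Lemma constant_shape_spectrum :
  (exists k, forall xi, xi \in vperp H w -> ipv H xi xi = 1 ->
     has_spectrum (ipn H) (shape_mx H w tau sigma rho xi) k) <->
  (exists c, forall xi, xi \in vperp H w -> ipv H xi xi = 1 ->
     has_spectrum (ipz H) (kahler_mx H w xi) c).
Proof.
have [xi0 [xi0w xi01]] := unit_vperp_exists H w_proper.
have specC xi : exists c, has_spectrum (ipz H) (C xi) c.
  have [Z [c ZC]] := spectral_theorem (@ipz_lin _ _ _ H) (@ipzC _ _ _ H) (@ipz_gt0 _ _ _ H)
    (kahler_mx_sa H w xi).
  by exists c, Z.
have specS xi : exists k, has_spectrum (ipn H) (S xi) k.
  have [e [k eS]] := spectral_theorem (@ipn_lin _ _ _ H) (@ipnC _ _ _ H) (@ipn_gt0 _ _ _ H)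
    (shape_mx_sa H w tau sigma rho xi).
  by exists k, e.
split=> [[k kS]|[c cC]].
- have [c0 c0C] := specC xi0; exists c0 => xi xiw xi1; have [c cC] := specC xi.
  have E : \prod_i ('X - (- c i)%:P) = \prod_i ('X - (- c0 i)%:P).
    apply/eqP; rewrite -subr_eq0 -(@comp_poly_eq0 _ _ _ size_cubic).
    rewrite linearB /= subr_eq0; apply/eqP.
    (* The eigenvalues [k] are excluded as well: a zero of [factor] outside [bad] is a root of the
       characteristic polynomial of the shape matrix, so elsewhere the factor can be cancelled. *)
    apply: (@poly_eq_cofinite _ _ _ (bad ++ codom k)) => x.
    rewrite mem_cat negb_or => /andP[xbad xk].
    rewrite -(det_cubic x cC) -(det_cubic x c0C).
    have k1 := kS _ xiw xi1; have k0 := kS _ xi0w xi01.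
    have := det_shape x k1; rewrite -(det_shape x k0).
    rewrite (det_factor (conj xiw xi1) xbad) (det_factor (conj xi0w xi01) xbad).
    apply: mulfI; apply: contraNneq xk => f0.
    have := det_shape x k0; rewrite (det_factor (conj xi0w xi01) xbad) f0 mul0r.
    move=> /esym/rootP; rewrite /root -/(root _ _).
    rewrite (_ : \prod_i _ = \prod_(a <- codom k) ('X - a%:P)); last first.
      by rewrite big_image.
    by rewrite root_prod_XsubC.
  have [s sE] := prod_XsubC_perm E.
  by apply: (has_spectrum_perm (s := s) cC) => i; apply: oppr_inj; rewrite sE.
- have [k0 k0S] := specS xi0; exists k0 => xi xiw xi1; have [k kS] := specS xi.
  have E : \prod_i ('X - (k i)%:P) = \prod_i ('X - (k0 i)%:P).
    apply: (@poly_eq_cofinite _ _ _ bad) => x xbad.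
    rewrite -(det_shape x kS) -(det_shape x k0S).
    rewrite (det_factor (conj xiw xi1) xbad) (det_factor (conj xi0w xi01) xbad).
    by rewrite (det_cubic x (cC _ xiw xi1)) (det_cubic x (cC _ xi0w xi01)).
  have [s sE] := prod_XsubC_perm E.
  exact: (has_spectrum_perm (s := s) kS).
Qed.

End ConstantSpectrum.

(** * Generalized Kaehler angles as eigenvalues *)

Section KahlerAngle.
Context {R : realType} {p m : nat} (H : genHeisenberg R p m).
Variable w : {vspace 'rV[R]_p}.

Lemma cos_sqr_le (a b : R) : 0 <= a <= pi / 2 -> 0 <= b <= pi / 2 ->
  (cos a ^+ 2 <= cos b ^+ 2) = (b <= a).
Proof.
move=> /andP[a0 a1] /andP[b0 b1]; have pi0 := pi_ge0 R.
have ha : - (pi / 2) <= a <= pi / 2 by rewrite a1 andbT; lra.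
have hb : - (pi / 2) <= b <= pi / 2 by rewrite b1 andbT; lra.
rewrite ler_sqr ?nnegrE ?cos_ge0_pihalf // !leNgt ltr_cos // in_itv /=; apply/andP; split; lra.
Qed.

Lemma acos_sqrt (c : R) : 0 <= c <= 1 ->
  0 <= acos (Num.sqrt c) <= pi / 2 /\ cos (acos (Num.sqrt c)) ^+ 2 = c.
Proof.
move=> /andP[c0 c1]; have s0 := sqrtr_ge0 c.
have s1 : Num.sqrt c <= 1 by rewrite -[1]sqrtr1 ler_wsqrtr.
have sI : -1 <= Num.sqrt c <= 1 by rewrite s1 andbT; lra.
have [/andP[h0 h1] E] := acos_def sI; split; last by rewrite E sqr_sqrtr.
rewrite h0 leNgt; apply/negP => h2.
have pi0 := pi_gt0 R.
have : cos (acos (Num.sqrt c)) < cos (pi / 2).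
  by rewrite ltr_cos // in_itv /= ?h0 //; apply/andP; split; lra.
by rewrite cos_pihalf E ltNge s0.
Qed.

(** By [kahler_mx_ip], orthogonality of the vectors [F_ H w (Z i) xi] means that the [Z i]
    diagonalize the Kaehler matrix. *)
Lemma generalized_kahler_angle_spectrum xi (phi : 'I_m -> R) :
  xi \in vperp H w -> ipv H xi xi = 1 -> generalized_kahler_angle H w xi phi ->
  has_spectrum (ipz H) (kahler_mx H w xi) (fun i => cos (phi i) ^+ 2).
Proof.
move=> xiw xi1 [_ [Z [ZO Zk ZPF _]]]; exists Z; split => // i.
rewrite [LHS](orthonormal_expand (@ipz_lin _ _ _ H) _ ZO) (bigD1 i) //= big1 ?addr0.
  by rewrite kahler_mx_ip -!F_E (Zk i).2 ZO eqxx xi1 !mulr1.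
move=> j ji; rewrite kahler_mx_ip -!F_E (ZPF i j _).2 ?scale0r //.
by rewrite eq_sym.
Qed.

(** An orthonormal eigenbasis serves as the required basis of the centre. The eigenvalues decrease
    because the angles have to increase. *)
Lemma spectrum_generalized_kahler_angle xi (c : 'I_m -> R) :
  xi \in vperp H w -> ipv H xi xi = 1 ->
  (forall i j : 'I_m, (i <= j)%N -> c j <= c i) ->
  has_spectrum (ipz H) (kahler_mx H w xi) c ->
  generalized_kahler_angle H w xi (fun i => acos (Num.sqrt (c i))).
Proof.
move=> xiw xi1 cdec [Z [ZO ZC]].
have FZ i j : ipv H (F_ H w (Z i) xi) (F_ H w (Z j) xi) = c i * (i == j)%:R.
  by rewrite !F_E -kahler_mx_ip ZC ipzZl ZO.
have c01 i : 0 <= c i <= 1.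
  have := FZ i i; rewrite eqxx mulr1 => <-; rewrite ipv_ge0 /=.
  (* [c i <= 1], since the squared lengths of the two components of [J H (Z i) xi] add up to 1. *)
  have := ipv_ge0 H (P_ H w (Z i) xi); rewrite P_E !ipvE F_E.
  rewrite J_isometry ZO eqxx xi1 !projp_ip [ipv H (J H (Z i) xi) _]ipvC.
  by have -> : true%:R = 1 :> R by []; lra.
have ac i := acos_sqrt (c01 i).
split=> [i j ij|].
  by rewrite -cos_sqr_le ?(ac _).1 // !(ac _).2 cdec.
exists Z; split => //.
- by move=> i; split; [exact: (ac i).1|rewrite FZ (ac i).2 ZO eqxx xi1 !mulr1].
(* The vectors [J H (Z i) xi] are orthogonal by [J_isometry] and so are their projections; hence
   their components in [w] are orthogonal too. *)
- move=> i j ij; split; last by rewrite FZ (negbTE ij) mulr0.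
  have := FZ i j; rewrite (negbTE ij) mulr0 !F_E !P_E => F0.
  set a := J H (Z i) xi in F0 *; set b := J H (Z j) xi in F0 *.
  rewrite !ipvE -(projp_sa H w a b) -(projp_ip H w a b) F0 J_isometry ZO (negbTE ij).
  by rewrite mul0r !subrr.
move=> Y psi Y0 [psiI psiF].
have YE := orthonormal_expand (@ipz_lin _ _ _ H) Y ZO.
(* [cos psi ^+ 2] is the mean of the [c j] with weights [y j ^+ 2], so it lies between the extreme
   ones. *)
pose y i := ipz H Y (Z i).
have YY : ipz H Y Y = \sum_i y i ^+ 2.
  rewrite {1}YE (@ip_sum _ _ (ipz H) (@ipz_lin _ _ _ H)); apply: eq_bigr => i _.
  by rewrite ipzZl [ipz H (Z i) Y]ipzC -expr2.
have FY : ipv H (F_ H w Y xi) (F_ H w Y xi) = \sum_i c i * y i ^+ 2.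
  rewrite !F_E -kahler_mx_ip {1}YE mulmx_suml (@ip_sum _ _ (ipz H) (@ipz_lin _ _ _ H)).
  apply: eq_bigr => i _; rewrite -scalemxAl ZC !ipzZl [ipz H (Z i) Y]ipzC /y; ring.
have Yp : 0 < ipz H Y Y by exact: ipz_gt0.
have psiE : cos psi ^+ 2 * (\sum_i y i ^+ 2) = \sum_i c i * y i ^+ 2.
  by rewrite -FY psiF xi1 mulr1 YY.
split=> i iE.
- rewrite -cos_sqr_le ?(ac _).1 // (ac _).2 -(ler_pM2r Yp) YY psiE mulr_sumr.
  by apply: ler_sum => j _; rewrite ler_wpM2r ?sqr_ge0 // cdec // iE.
- rewrite -cos_sqr_le ?(ac _).1 // (ac _).2 -(ler_pM2r Yp) YY psiE mulr_sumr.
  apply: ler_sum => j _; rewrite ler_wpM2r ?sqr_ge0 // cdec // iE.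
  by rewrite -ltnS prednK ?ltn_ord // (z_neq0 H).
Qed.

Lemma sort_decreasing (c : 'I_m -> R) :
  exists s : 'S_m, forall i j : 'I_m, (i <= j)%N -> c (s j) <= c (s i).
Proof.
pose t := [tuple of sort (fun a b : R => b <= a) [tuple c i | i < m]].
have /tuple_permP[s sE] : perm_eq t [tuple c i | i < m] by rewrite perm_sort.
have tE i : tnth t i = c (s i).
  have := congr1 (fun l : seq R => nth 0 l i) sE.
  by rewrite -!tnth_nth !tnth_mktuple.
exists s => i j ij; rewrite -!tE !(tnth_nth 0).
have srt : sorted (fun a b : R => b <= a) t.
  by apply: sort_sorted => a b; exact: le_total.
apply: (sorted_leq_nth _ _ _ srt) => //.
- by move=> a b d h1 h2; exact: le_trans h2 h1.
- by rewrite inE size_tuple.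
- by rewrite inE size_tuple.
Qed.

Lemma constant_kahler_spectrum : w != fullv ->
  (exists c, forall xi, xi \in vperp H w -> ipv H xi xi = 1 ->
     has_spectrum (ipz H) (kahler_mx H w xi) c) <->
  constant_generalized_kahler_angle H w.
Proof.
move=> wp; split=> [[c cC]|[phi phiP]].
  have [s sdec] := sort_decreasing c.
  exists (fun i => acos (Num.sqrt (c (s i)))) => xi xiw xi1.
  apply: spectrum_generalized_kahler_angle => //.
  exact: (has_spectrum_perm (s := s) (cC _ xiw xi1)).
exists (fun i => cos (phi i) ^+ 2) => xi xiw xi1.
exact: generalized_kahler_angle_spectrum (phiP _ xiw xi1).
Qed.

End KahlerAngle.

(** * The metric and its Levi-Civita connection *)

(** Reduces a directional derivative to a derivative in one real variable, where the rule for [expR]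
    applies. *)
Lemma is_derive_lineP (R : realType) (E F : normedModType R) (f : E -> F) (x v : E) (d : F) :
  is_derive (0 : R) (1 : R) (fun h : R => f (h *: v + x)) d <-> is_derive x v f d.
Proof.
pose q1 := fun h : R => h^-1 *: (((fun h : R => f (h *: v + x)) \o shift 0) (h *: (1 : R))
   - f (0 *: v + x)).
pose q2 := fun h : R => h^-1 *: ((f \o shift x) (h *: v) - f x).
have qE : q1 = q2.
  by apply/funext => h; rewrite /q1 /q2 /= addr0 scale0r add0r [h *: (1 : R)]mulr1.
split=> -[cf df].
- have C : q2 @ 0^' --> d by rewrite -df -qE; exact: cf.
  by split; [apply/cvg_ex; eexists; exact: C | exact: cvg_lim C].
- have C : q1 @ 0^' --> d by rewrite -df qE; exact: cf.
  by split; [apply/cvg_ex; eexists; exact: C | exact: cvg_lim C].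
Qed.

Section Pointwise.
Context {R : realType} {E F : normedModType R}.

Lemma is_derive_addf (f g : E -> F) x v df dg :
  is_derive x v f df -> is_derive x v g dg ->
  is_derive x v (fun y => f y + g y) (df + dg).
Proof. by move=> fd gd; exact: is_deriveD. Qed.

Lemma is_derive_subf (f g : E -> F) x v df dg :
  is_derive x v f df -> is_derive x v g dg ->
  is_derive x v (fun y => f y - g y) (df - dg).
Proof. by move=> fd gd; exact: is_deriveB. Qed.

Lemma is_derive_oppf (f : E -> F) x v df :
  is_derive x v f df -> is_derive x v (fun y => - f y) (- df).
Proof. by move=> fd; exact: is_deriveN. Qed.

Lemma is_derive_scalef (a : R) (f : E -> F) x v df :
  is_derive x v f df -> is_derive x v (fun y => a *: f y) (a *: df).
Proof. by move=> fd; exact: is_deriveZ. Qed.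

Lemma is_derive_mulf (f g : E -> R) x v df dg :
  is_derive x v f df -> is_derive x v g dg ->
  is_derive x v (fun y => f y * g y) (f x * dg + g x * df).
Proof. by move=> fd gd; exact: is_deriveM. Qed.

Lemma is_derive_cstf (a : F) (x v : E) : is_derive x v (fun _ => a) 0.
Proof. exact: is_derive_cst. Qed.

End Pointwise.

Lemma is_derive_expR_comp (R : realType) (f : R -> R) (t df : R) :
  is_derive t (1 : R) f df ->
  is_derive t (1 : R) (fun h => expR (f h)) (df * expR (f t)).
Proof.
move=> fd; have := @is_derive1_comp R expR f t _ _ (is_derive_expR (f t)) fd.
by move=> D; apply: (is_derive_eq D); rewrite mulrC.
Qed.

Lemma is_derive_line (R : realType) (E : normedModType R) (t : R) (u x : E) :
  is_derive t (1 : R) (fun h : R => h *: u + x) u.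
Proof.
have := is_deriveD (is_derive_scalel u (is_derive_id t (1 : R))) (is_derive_cst x t (1 : R)).
by move=> D; apply: (is_derive_eq D); rewrite scale1r addr0.
Qed.

Section Metric.
Context {R : realType} {p m : nat} (H : genHeisenberg R p m).

Lemma betaL (a : R) U V W : beta H (a *: U + V) W = a *: beta H U W + beta H V W.
Proof. by rewrite !betaE. Qed.
Lemma betaR (a : R) U V W : beta H W (a *: U + V) = a *: beta H W U + beta H W V.
Proof. by rewrite !betaE. Qed.
Lemma ipz_linr Z (a : R) X Y : ipz H Z (a *: X + Y) = a * ipz H Z X + ipz H Z Y.
Proof. by rewrite !ipzE. Qed.
Lemma ipv_linr U (a : R) V W : ipv H U (a *: V + W) = a * ipv H U V + ipv H U W.
Proof. by rewrite !ipvE. Qed.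

Local Notation AN := (R * 'rV[R]_p * 'rV[R]_m)%type.
Implicit Types (x y u v w : AN).

(** The z-component of the tangent vector [u] at [x] in the frame of
    left-invariant fields is [expR (- x.1.1) *: vert x u]. *)
Definition vert x u : 'rV[R]_m := u.2 - 2^-1 *: beta H x.1.2 u.1.2.

Definition metric x u v : R :=
  u.1.1 * v.1.1 + expR (- x.1.1) * ipv H u.1.2 v.1.2
  + expR (- x.1.1) ^+ 2 * ipz H (vert x u) (vert x v).

Lemma dr_metricE x u v : dr_metric H x u v = metric x u v.
Proof.
have e : expR (- x.1.1) = expR (- x.1.1 / 2) * expR (- x.1.1 / 2).
  by rewrite -expRD -splitr.
have E c : 'D_c (dr_mul H (dr_inv x)) x =
    (c.1.1, expR (- x.1.1 / 2) *: c.1.2, expR (- x.1.1) *: vert x c).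
  rewrite derive_dr_mul /=; congr (_, _, _).
  by rewrite betaNl betaZl /vert e; apply/rowP => i; rewrite !mxE; field.
rewrite /metric /dr_metric !E /dr_ip /= !ipvE !ipzE e; ring.
Qed.

Lemma dr_metric_metric : dr_metric H = metric.
Proof. by apply/funext => x; apply/funext => u; apply/funext => v; exact: dr_metricE. Qed.

Lemma vertD x u v : vert x (u + v) = vert x u + vert x v.
Proof. by rewrite /vert !betaE; apply/rowP => i; rewrite !mxE; ring. Qed.
Lemma vertZ x (a : R) u : vert x (a *: u) = a *: vert x u.
Proof. by rewrite /vert !betaE; apply/rowP => i; rewrite !mxE; ring. Qed.

Lemma metricC x u v : metric x u v = metric x v u.
Proof. by rewrite /metric ipvC ipzC mulrC. Qed.
Lemma metricDl x u v w : metric x (u + v) w = metric x u w + metric x v w.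
Proof. by rewrite /metric vertD /= ipvDl ipzDl; ring. Qed.
Lemma metricZl x (a : R) u w : metric x (a *: u) w = a * metric x u w.
Proof. by rewrite /metric vertZ /= ipvZl ipzZl /GRing.scale /=; ring. Qed.

Lemma metric_eq0 x u : metric x u u = 0 -> u = 0.
Proof.
move=> E; have e0 := expR_gt0 (- x.1.1).
have s1 : 0 <= u.1.1 * u.1.1 by rewrite -expr2 sqr_ge0.
have s2 : 0 <= expR (- x.1.1) * ipv H u.1.2 u.1.2 by rewrite mulr_ge0 ?ipv_ge0 ?ltW.
have s3 : 0 <= expR (- x.1.1) ^+ 2 * ipz H (vert x u) (vert x u).
  by rewrite mulr_ge0 ?ipz_ge0 ?sqr_ge0.
rewrite /metric in E.
have /eqP : u.1.1 * u.1.1 = 0 by lra.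
rewrite mulf_eq0 orbb => /eqP z1.
have /eqP : expR (- x.1.1) * ipv H u.1.2 u.1.2 = 0 by lra.
rewrite mulf_eq0 gt_eqF //= => /eqP/ipv_eq0 z2.
have /eqP : expR (- x.1.1) ^+ 2 * ipz H (vert x u) (vert x u) = 0 by lra.
rewrite mulf_eq0 expf_eq0 /= gt_eqF //= => /eqP/ipz_eq0.
rewrite /vert z2 beta0r scaler0 subr0 => z3.
by case: u z1 z2 z3 {E s1 s2 s3} => [[a V] Y] /= -> -> ->.
Qed.

Lemma derive_metricE x u v w : 'D_u (fun y => metric y v w) x =
  - u.1.1 * expR (- x.1.1) * ipv H v.1.2 w.1.2
  + expR (- x.1.1) ^+ 2 *
    (- 2 * u.1.1 * ipz H (vert x v) (vert x w)
     - 2^-1 * ipz H (beta H u.1.2 v.1.2) (vert x w)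
     - 2^-1 * ipz H (vert x v) (beta H u.1.2 w.1.2)).
Proof.
suff : is_derive x u (fun y => metric y v w) (- u.1.1 * expR (- x.1.1) * ipv H v.1.2 w.1.2
  + expR (- x.1.1) ^+ 2 *
    (- 2 * u.1.1 * ipz H (vert x v) (vert x w)
     - 2^-1 * ipz H (beta H u.1.2 v.1.2) (vert x w)
     - 2^-1 * ipz H (vert x v) (beta H u.1.2 w.1.2))) by move=> D; exact: derive_val.
apply/is_derive_lineP.
have lD := is_derive_line (0 : R) u x.
have sD := is_derive_fst (is_derive_fst lD).
have x0 : 0 *: u + x = x by rewrite scale0r add0r.
have eD : is_derive (0 : R) (1 : R) (fun h : R => expR (- (h *: u + x).1.1))
    (- u.1.1 * expR (- x.1.1)).
  by rewrite -{2}x0; exact: is_derive_expR_comp (is_deriveN sD).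
have vD z : is_derive (0 : R) (1 : R) (fun h => vert (h *: u + x) z)
    (- (2^-1 *: beta H u.1.2 z.1.2)).
  have bD := is_derive_row (F := 'rV[R]_m) (fun a V W => betaL a V W z.1.2)
     (is_derive_snd (is_derive_fst lD)).
  have := is_deriveB (is_derive_cst z.2 (0 : R) (1 : R)) (is_deriveZ (2^-1) bD).
  by move=> D; apply: (is_derive_eq D); rewrite sub0r.
have iD := is_derive_bilinear (F := R) (fun V a Z Z' => ipz_lin H a Z Z' V) (@ipz_linr)
  (vD v) (vD w).
have D := is_derive_addf (is_derive_addf (is_derive_cst (v.1.1 * w.1.1) (0 : R) (1 : R))
   (is_derive_mulf eD (is_derive_cst (ipv H v.1.2 w.1.2) (0 : R) (1 : R))))
   (is_derive_mulf (is_derive_mulf eD eD) iD).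
move: D; rewrite !x0 => D.
rewrite (_ : (fun h : R => _) = (fun h : R => v.1.1 * w.1.1
   + expR (- (h *: u + x).1.1) * ipv H v.1.2 w.1.2 + expR (- (h *: u + x).1.1) *
   expR (- (h *: u + x).1.1) * ipz H (vert (h *: u + x) v) (vert (h *: u + x) w))); last first.
  by apply/funext => h; rewrite /metric -expr2.
by apply: (is_derive_eq D); rewrite /GRing.scale /= !ipzE; ring.
Qed.

Definition chris_v x u v : 'rV[R]_p :=
  - (2^-1 *: (u.1.1 *: v.1.2 + v.1.1 *: u.1.2))
  - (2^-1 * expR (- x.1.1)) *: (J H (vert x u) v.1.2 + J H (vert x v) u.1.2).

(** The closed form of the Levi-Civita connection. The last component is chosen so that [vert x]
    removes its [beta] term and leaves [- (u.1.1 *: vert x v + v.1.1 *: vert x u)]. *)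
Definition chris x u v : AN :=
  (2^-1 * expR (- x.1.1) * ipv H u.1.2 v.1.2
     + expR (- x.1.1) ^+ 2 * ipz H (vert x u) (vert x v),
   chris_v x u v,
   - (u.1.1 *: vert x v + v.1.1 *: vert x u) + 2^-1 *: beta H x.1.2 (chris_v x u v)).

Let derive_metric x u v w : R :=
  - u.1.1 * expR (- x.1.1) * ipv H v.1.2 w.1.2
  + expR (- x.1.1) ^+ 2 *
    (- 2 * u.1.1 * ipz H (vert x v) (vert x w)
     - 2^-1 * ipz H (beta H u.1.2 v.1.2) (vert x w)
     - 2^-1 * ipz H (vert x v) (beta H u.1.2 w.1.2)).

Lemma chris_koszul x u v w : 2 * metric x (chris x u v) w =
  derive_metric x u v w + derive_metric x v u w - derive_metric x w u v.
Proof.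
rewrite /metric /derive_metric.
have -> : vert x (chris x u v) = - (u.1.1 *: vert x v + v.1.1 *: vert x u).
  by rewrite /vert /= addrK.
rewrite /= /chris_v; move: (vert x u) (vert x v) (vert x w) => u' v' w'.
rewrite !ipvE !J_adjoint !ipzE (beta_skew H v.1.2 u.1.2).
rewrite (beta_skew H w.1.2 v.1.2) (beta_skew H w.1.2 u.1.2) !ipzE.
rewrite [ipz H v' (beta _ _ _)]ipzC [ipz H u' (beta _ _ _)]ipzC.
rewrite ?[ipz H v' u']ipzC.
by field.
Qed.

(** [chris] solves the Koszul equation; a second solution agrees with it, as one sees by testing
    both on their difference. *)
Lemma christoffelE x u v : christoffel (metric) x u v = chris x u v.
Proof.
apply: xget_unique => [w|a aP].
  rewrite chris_koszul; apply/esym; congr (_ + _ - _); exact: derive_metricE.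
apply/eqP; rewrite -subr_eq0; apply/eqP/(metric_eq0 (x := x)).
set D := a - chris x u v.
have E1 := chris_koszul x u v D.
have E2 : 2 * metric x a D =
    derive_metric x u v D + derive_metric x v u D - derive_metric x D u v.
  by apply: (etrans (aP D)); congr (_ + _ - _); exact: derive_metricE.
have two0 : (2 : R) != 0 by [].
have E := mulfI two0 (etrans E2 (esym E1)).
have -> : metric x D D = metric x a D - metric x (chris x u v) D.
  by rewrite {1}/D metricDl -scaleN1r metricZl mulN1r.
by apply/eqP; rewrite subr_eq0; apply/eqP.
Qed.

Lemma chrisZr x u (a : R) v : chris x u (a *: v) = a *: chris x u v.
Proof.
have cv : chris_v x u (a *: v) = a *: chris_v x u v.
  have JZ X U : J H X (a *: U) = a *: J H X U by exact: linearZ.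
  rewrite /chris_v vertZ J_Zl JZ /=.
  by apply/rowP => j; rewrite !mxE /GRing.scale /=; ring.
rewrite /chris cv vertZ /= !betaE; move: (vert x u) (vert x v) => u' v'; congr (_, _, _).
  by rewrite !ipvE !ipzE /GRing.scale /=; ring.
by apply/rowP => j; rewrite !mxE /GRing.scale /=; ring.
Qed.

End Metric.

(** * Geodesics *)

Section HalfHyperbolic.
Context {R : realType}.
Implicit Type t : R.

(** [cosh (t / 2)] and [sinh (t / 2)]. *)
Definition ch t : R := (expR (t / 2) + expR (- (t / 2))) / 2.
Definition sh t : R := (expR (t / 2) - expR (- (t / 2))) / 2.

Lemma expR_half_inv t : expR (t / 2) * expR (- (t / 2)) = 1.
Proof. by rewrite -expRD subrr expR0. Qed.

Lemma chsh t : ch t ^+ 2 - sh t ^+ 2 = 1.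
Proof. by rewrite -[RHS](expR_half_inv t) /ch /sh; field. Qed.

Lemma ch0 : ch 0 = 1. Proof. by rewrite /ch mul0r oppr0 expR0; field. Qed.
Lemma sh0 : sh 0 = 0. Proof. by rewrite /sh mul0r oppr0 expR0; field. Qed.

Lemma ch_gt0 t : 0 < ch t.
Proof. by rewrite divr_gt0 // addr_gt0 // expR_gt0. Qed.

Lemma sh_gt0 t : 0 < t -> 0 < sh t.
Proof. by move=> t0; rewrite divr_gt0 // subr_gt0 ltr_expR; lra. Qed.

Lemma chD s t : ch (s + t) = ch s * ch t + sh s * sh t.
Proof. by rewrite /ch /sh !mulrDl !opprD !expRD; field. Qed.

Lemma shD s t : sh (s + t) = sh s * ch t + ch s * sh t.
Proof. by rewrite /ch /sh !mulrDl !opprD !expRD; field. Qed.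

Let half t : is_derive t (1 : R) (fun u : R => u / 2) (2^-1).
Proof.
have := is_derive_mulf (is_derive_id t (1 : R)) (is_derive_cstf (2^-1 : R) t (1 : R)).
by move=> D; apply: (is_derive_eq D); rewrite /GRing.scale /=; ring.
Qed.

Let expD t : is_derive t (1 : R) (fun u : R => expR (u / 2)) (2^-1 * expR (t / 2)).
Proof. exact: is_derive_expR_comp (half t). Qed.

Let expND t : is_derive t (1 : R) (fun u : R => expR (- (u / 2))) (- 2^-1 * expR (- (t / 2))).
Proof. exact: is_derive_expR_comp (is_derive_oppf (half t)). Qed.

Lemma is_derive_ch t : is_derive t (1 : R) ch (sh t / 2).
Proof.
have D := is_derive_mulf (is_derive_addf (expD t) (expND t)) (is_derive_cstf (2^-1 : R) t (1 : R)).
by apply: (is_derive_eq D); rewrite /sh /=; field.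
Qed.

Lemma is_derive_sh t : is_derive t (1 : R) sh (ch t / 2).
Proof.
have D := is_derive_mulf (is_derive_subf (expD t) (expND t)) (is_derive_cstf (2^-1 : R) t (1 : R)).
by apply: (is_derive_eq D); rewrite /ch /=; field.
Qed.

Lemma ode_half (f f1 : R -> R) :
  (forall t, is_derive t (1 : R) f (f1 t)) ->
  (forall t, is_derive t (1 : R) f1 (f t / 4)) ->
  forall t, f t = f 0 * ch t + 2 * f1 0 * sh t.
Proof.
move=> fD f1D t.
(* Differentiation multiplies [f1 + f / 2] by 1/2 and [f1 - f / 2] by -1/2; each becomes constant
   after multiplication by the opposite exponential, and [f] is their difference. *)
have P1 : (f1 t + 2^-1 * f t) * expR (- (t / 2)) = f1 0 + 2^-1 * f 0.
  have D u : is_derive u (1 : R) (fun u => (f1 u + 2^-1 *: f u) * expR (- (u / 2))) 0.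
    have D1 := is_derive_mulf (is_derive_addf (f1D u) (is_derive_scalef (2^-1) (fD u))) (expND u).
    by apply: (is_derive_eq D1); rewrite /GRing.scale /=; field.
  by have /= := is_derive_0_is_cst t 0 D; rewrite mul0r oppr0 expR0 mulr1.
have Q1 : (f1 t - 2^-1 * f t) * expR (t / 2) = f1 0 - 2^-1 * f 0.
  have D u : is_derive u (1 : R) (fun u => (f1 u - 2^-1 *: f u) * expR (u / 2)) 0.
    have D1 := is_derive_mulf (is_derive_subf (f1D u) (is_derive_scalef (2^-1) (fD u))) (expD u).
    by apply: (is_derive_eq D1); rewrite /GRing.scale /=; field.
  by have /= := is_derive_0_is_cst t 0 D; rewrite mul0r expR0 mulr1.
have E := expR_half_inv t.
have e1 : f1 t + 2^-1 * f t = (f1 0 + 2^-1 * f 0) * expR (t / 2).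
  by rewrite -P1 -mulrA [_ * expR (t / 2)]mulrC E mulr1.
have e2 : f1 t - 2^-1 * f t = (f1 0 - 2^-1 * f 0) * expR (- (t / 2)).
  by rewrite -Q1 -mulrA E mulr1.
have -> : f t = (f1 t + 2^-1 * f t) - (f1 t - 2^-1 * f t) by field.
by rewrite e1 e2 /ch /sh; field.
Qed.

End HalfHyperbolic.

(** The scalar is viewed as a 1 by 1 matrix, which makes scaling a case of [is_derive_bilinear]. *)
Lemma is_derive_scalevec (R : realType) (V : normedModType R) n (k : V -> R)
    (f : V -> 'rV[R]_n) x v dk df :
  is_derive x v k dk -> is_derive x v f df ->
  is_derive x v (fun y => k y *: f y) (dk *: f x + k x *: df).
Proof.
move=> kD fD.
have kD' : is_derive x v (fun y => (k y)%:M : 'rV[R]_1) dk%:M.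
  apply: (@is_derive_linear R V R 'rV[R]_1 (fun a : R => a%:M)) => //.
    by move=> a b d; rewrite raddfD /= scale_scalar_mx.
  rewrite (_ : (fun a : R => a%:M) = fun a : R => a *: (1%:M : 'rV[R]_1)).
    exact: scalel_continuous.
  by apply/funext => a; rewrite scale_scalar_mx mulr1.
have := is_derive_bilinear (Q := fun (a : 'rV[R]_1) (u : 'rV[R]_n) => a *m u)
  _ _ kD' fD.
rewrite (_ : (fun y => _) = fun y => k y *: f y); last first.
  by apply/funext => y; rewrite mul_scalar_mx.
rewrite !mul_scalar_mx; apply.
  by move=> u a b b'; rewrite mulmxDl scalemxAl.
by move=> u a b b'; rewrite mulmxDr scalemxAr.
Qed.

Lemma is_derive_row_cst (R : realType) n (f : R -> 'rV[R]_n) :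
  (forall t, is_derive t (1 : R) f 0) -> forall t, f t = f 0.
Proof.
move=> fD t; apply/rowP => j.
have lin : linear (fun u : 'rV[R]_n => u 0 j) by move=> a u v; rewrite !mxE.
apply: (@is_derive_0_is_cst _ (fun t => f t 0 j)) => u.
by have := is_derive_row (F := R) lin (fD u); rewrite mxE.
Qed.

Lemma is_derive_invf (R : realType) (f : R -> R) t df :
  is_derive t (1 : R) f df -> f t != 0 ->
  is_derive t (1 : R) (fun u => (f u)^-1) (- (f t) ^- 2 * df).
Proof.
move=> fD f0; have fd : derivable f t 1 by exact: ex_derive.
have := derivableP (derivableV f0 fd); rewrite deriveV // (@derive_val _ _ _ _ _ _ _ fD).
by [].
Qed.

Section Geodesics.
Context {R : realType} {p m : nat} (H : genHeisenberg R p m).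
Local Notation AN := (R * 'rV[R]_p * 'rV[R]_m)%type.
Local Notation g := (metric H).
Implicit Types (c : R -> AN) (t : R).

Lemma geodesicP c c1 c2 :
  (forall t, is_derive t (1 : R) c (c1 t)) -> (forall t, is_derive t (1 : R) c1 (c2 t)) ->
  (forall t, c2 t + christoffel g (c t) (c1 t) (c1 t) = 0) ->
  geodesic g c /\ derive1 c = c1.
Proof.
move=> cD c1D E.
have dc : derive1 c = c1 by apply/funext => t; rewrite derive1E; exact: derive_val.
split=> // t; rewrite dc; split; [exact: ex_derive|exact: ex_derive|].
by rewrite derive1E (@derive_val _ _ _ _ _ _ _ (c1D t)).
Qed.

Section Horizontal.
Variables (c c1 c2 : R -> AN).
Hypotheses (cD : forall t, is_derive t (1 : R) c (c1 t))
  (c1D : forall t, is_derive t (1 : R) c1 (c2 t))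
  (cE : forall t, c2 t + chris H (c t) (c1 t) (c1 t) = 0)
  (c_vert : vert H (c 0) (c1 0) = 0)
  (c_unit : g (c 0) (c1 0) (c1 0) = 1).

Let sD t := is_derive_fst (is_derive_fst (cD t)).
Let UD t := is_derive_snd (is_derive_fst (cD t)).
Let aD t := is_derive_fst (is_derive_fst (c1D t)).
Let VD t := is_derive_snd (is_derive_fst (c1D t)).

Let c2E t : c2 t = - chris H (c t) (c1 t) (c1 t).
Proof. by apply/eqP; rewrite -subr_eq0 opprK cE. Qed.

(** The last component of the geodesic equation; its [beta] term cancels against the derivative of
    the one in [vert]. *)
Let vertD0 t : is_derive t (1 : R) (fun t => vert H (c t) (c1 t))
  ((2 * (c1 t).1.1) *: vert H (c t) (c1 t)).
Proof.
have bD := is_derive_bilinear (F := 'rV[R]_m) (fun V a W W' => betaL H a W W' V)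
  (fun V a W W' => betaR H a W W' V) (UD t) (VD t).
have D := is_derive_subf (is_derive_snd (c1D t)) (is_derive_scalef (2^-1) bD).
apply: (is_derive_eq D); rewrite betaxx add0r c2E /= !betaE.
by apply/rowP => j; rewrite !mxE; ring.
Qed.

(** [expR (- 2 * s) *: vert] is constant along a geodesic. *)
Lemma vert0 t : vert H (c t) (c1 t) = 0.
Proof.
pose e t := expR (- 2 *: (c t).1.1).
have eD (u : R) : is_derive u (1 : R) e ((- 2 * (c1 u).1.1) * e u).
  exact: is_derive_expR_comp (is_derive_scalef _ (sD u)).
have vD (u : R) : is_derive u (1 : R) (fun u => e u *: vert H (c u) (c1 u)) 0.
  have D := is_derive_scalevec (eD u) (vertD0 u).
  by apply: (is_derive_eq D); rewrite scalerA -scalerDl; apply/rowP => j; rewrite !mxE; ring.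
have := is_derive_row_cst vD t; rewrite c_vert scaler0.
by move=> /eqP; rewrite scaler_eq0 gt_eqF ?expR_gt0 //= => /eqP.
Qed.

Let VD' t : is_derive t (1 : R) (fun t => (c1 t).1.2) ((c1 t).1.1 *: (c1 t).1.2).
Proof.
apply: (is_derive_eq (VD t)); rewrite c2E /= /chris_v vert0 !J_0 addr0 scaler0 subr0 opprK.
by apply/rowP => j; rewrite !mxE; field.
Qed.

Let aD' t : is_derive t (1 : R) (fun t => (c1 t).1.1)
  (- (2^-1 * (expR (- (c t).1.1) * ipv H (c1 t).1.2 (c1 t).1.2))).
Proof.
by apply: (is_derive_eq (aD t)); rewrite c2E /= vert0 ipz0l mulr0 addr0 mulrA.
Qed.

(** Conservation of speed when the vertical part vanishes; it is what gives the coefficient 1/4 in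
    the equations below. *)
Let energy t : (c1 t).1.1 ^+ 2 + expR (- (c t).1.1) * ipv H (c1 t).1.2 (c1 t).1.2 = 1.
Proof.
pose E t := (c1 t).1.1 * (c1 t).1.1 + expR (- (c t).1.1) * ipv H (c1 t).1.2 (c1 t).1.2.
have eD (u : R) := is_derive_expR_comp (is_derive_oppf (sD u)).
have iD (u : R) := is_derive_bilinear (F := R) (fun V a W W' => ipv_lin H a W W' V)
  (@ipv_linr _ _ _ H) (VD' u) (VD' u).
have ED (u : R) : is_derive u (1 : R) E 0.
  have D := is_derive_addf (is_derive_mulf (aD' u) (aD' u)) (is_derive_mulf (eD u) (iD u)).
  by apply: (is_derive_eq D); rewrite !ipvE /GRing.scale /=; field.
rewrite expr2 -/(E t) (is_derive_0_is_cst t 0 ED) /E -c_unit /metric c_vert.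
by rewrite ipz0l mulr0 addr0.
Qed.

Let Y t := expR (- (2^-1 * (c t).1.1)).

Let YD t : is_derive t (1 : R) Y (- (2^-1 * (c1 t).1.1) * Y t).
Proof. exact: is_derive_expR_comp (is_derive_oppf (is_derive_scalef (2^-1) (sD t))). Qed.

Lemma geodesic_height t : expR (- (2^-1 * (c t).1.1)) =
  expR (- (2^-1 * (c 0).1.1)) * (ch t - (c1 0).1.1 * sh t).
Proof.
have Y'D (u : R) : is_derive u (1 : R) (fun u => - (2^-1 * (c1 u).1.1) * Y u) (Y u / 4).
  have D := is_derive_mulf (is_derive_oppf (is_derive_scalef (2^-1) (aD' u))) (YD u).
  apply: (is_derive_eq D); have := energy u.
  rewrite /GRing.scale /= => E.
  have -> : expR (- (c u).1.1) * ipv H (c1 u).1.2 (c1 u).1.2 = 1 - (c1 u).1.1 ^+ 2.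
    by rewrite -E; ring.
  by field.
by rewrite -/(Y t) (ode_half YD Y'D) /Y; field.
Qed.

(** Write a and V for the first two components of [c1]. Since Y' = - a Y / 2 and V' = a V, the terms
    with V cancel in the second derivative of Y U, so each coordinate of Y U satisfies the same
    equation as Y. *)
Lemma geodesic_v t : expR (- (2^-1 * (c t).1.1)) *: (c t).1.2 =
  expR (- (2^-1 * (c 0).1.1)) *:
    ((ch t - (c1 0).1.1 * sh t) *: (c 0).1.2 + (2 * sh t) *: (c1 0).1.2).
Proof.
apply/rowP => j.
have lin : linear (fun u : 'rV[R]_p => u 0 j) by move=> a u v; rewrite !mxE.
have UjD (u : R) := is_derive_row (F := R) lin (UD u).
have VjD (u : R) := is_derive_row (F := R) lin (VD' u).
pose f (u : R) := Y u * (c u).1.2 0 j.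
pose f1 (u : R) := - (2^-1 * (c1 u).1.1) * Y u * (c u).1.2 0 j + Y u * (c1 u).1.2 0 j.
have fD (u : R) : is_derive u (1 : R) f (f1 u).
  have D := is_derive_mulf (YD u) (UjD u).
  by apply: (is_derive_eq D); rewrite /f1; ring.
have f1D (u : R) : is_derive u (1 : R) f1 (f u / 4).
  have D := is_derive_addf (is_derive_mulf (is_derive_mulf
    (is_derive_oppf (is_derive_scalef (2^-1) (aD' u))) (YD u)) (UjD u))
    (is_derive_mulf (YD u) (VjD u)).
  apply: (is_derive_eq D); have := energy u.
  rewrite /f /GRing.scale /= !mxE => E.
  have -> : expR (- (c u).1.1) * ipv H (c1 u).1.2 (c1 u).1.2 = 1 - (c1 u).1.1 ^+ 2.
    by rewrite -E; ring.
  by field.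
by have := ode_half fD f1D t; rewrite /f /f1 /Y !mxE => ->; field.
Qed.

End Horizontal.

Lemma horizontal_geodesic c : geodesic g c ->
  vert H (c 0) (derive1 c 0) = 0 -> g (c 0) (derive1 c 0) (derive1 c 0) = 1 ->
  forall t,
  expR (- (2^-1 * (c t).1.1)) =
    expR (- (2^-1 * (c 0).1.1)) * (ch t - (derive1 c 0).1.1 * sh t) /\
  expR (- (2^-1 * (c t).1.1)) *: (c t).1.2 = expR (- (2^-1 * (c 0).1.1)) *:
    ((ch t - (derive1 c 0).1.1 * sh t) *: (c 0).1.2 + (2 * sh t) *: (derive1 c 0).1.2).
Proof.
move=> cG c_vert c_unit t.
have cD u : is_derive u (1 : R) c (derive1 c u).
  by have [d _ _] := cG u; rewrite derive1E; exact: derivableP.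
have c1D u : is_derive u (1 : R) (derive1 c) (derive1 (derive1 c) u).
  by have [_ d _] := cG u; rewrite [derive1 (derive1 c) u]derive1E; exact: derivableP.
have cE u : derive1 (derive1 c) u + chris H (c u) (derive1 c u) (derive1 c u) = 0.
  by have [_ _ <-] := cG u; rewrite christoffelE.
by split; [exact: geodesic_height cD c1D cE c_vert c_unit t
          |exact: geodesic_v cD c1D cE c_vert c_unit t].
Qed.

(** The two exponentials have nonnegative coefficients that are not both zero. The bound makes
    [explicit_geodesic] meaningful for all times. *)
Lemma ch_sub_gt0 (a t : R) : a ^+ 2 <= 1 -> 0 < ch t - a * sh t.
Proof.
move=> a1; have e1 := expR_gt0 (t / 2); have e2 := expR_gt0 (- (t / 2)).
have -> : ch t - a * sh t =
    ((1 - a) * expR (t / 2) + (1 + a) * expR (- (t / 2))) / 2 by rewrite /ch /sh; field.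
rewrite divr_gt0 //.
have l1 : 0 <= 1 - a by nra.
have l2 : 0 <= 1 + a by nra.
have p1 : 0 <= (1 - a) * expR (t / 2) by rewrite mulr_ge0 // ltW.
have p2 : 0 <= (1 + a) * expR (- (t / 2)) by rewrite mulr_ge0 // ltW.
have [a0|a0] := leP a 0.
  by have : 0 < (1 - a) * expR (t / 2) by [rewrite mulr_gt0 //; lra]; lra.
by have : 0 < (1 + a) * expR (- (t / 2)) by [rewrite mulr_gt0 //; lra]; lra.
Qed.

Section Explicit.
Variables (s0 a0 : R) (U0 V0 : 'rV[R]_p) (X0 : 'rV[R]_m).
Hypothesis unit0 : a0 ^+ 2 + expR (- s0) * ipv H V0 V0 = 1.

Let h t := ch t - a0 * sh t.
Let h1 t := (sh t - a0 * ch t) / 2.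

Let h_gt0 t : 0 < h t.
Proof.
apply: ch_sub_gt0; have : 0 <= expR (- s0) * ipv H V0 V0.
  by rewrite mulr_ge0 ?expR_ge0 ?ipv_ge0.
by move: unit0; set q := expR _ * _ => u0 q0; lra.
Qed.

Let h_neq0 t : h t != 0. Proof. by rewrite gt_eqF. Qed.

Let hD t : is_derive t (1 : R) h (h1 t).
Proof.
have D := is_derive_subf (is_derive_ch t) (is_derive_scalef a0 (is_derive_sh t)).
by apply: (is_derive_eq D); rewrite /h1 /GRing.scale /=; field.
Qed.

Let h1D t : is_derive t (1 : R) h1 (h t / 4).
Proof.
have D := is_derive_mulf (is_derive_subf (is_derive_sh t) (is_derive_scalef a0 (is_derive_ch t)))
  (is_derive_cstf (2^-1 : R) t (1 : R)).
by apply: (is_derive_eq D); rewrite /h /GRing.scale /=; field.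
Qed.

Let hVD t : is_derive t (1 : R) (fun t => (h t)^-1) (- (h t) ^- 2 * h1 t).
Proof. exact: is_derive_invf (hD t) (h_neq0 t). Qed.

(** The horizontal geodesic starting at [(s0, U0, X0)] with the direction
    [(a0, V0, 2^-1 *: beta H U0 V0)]. *)
Definition explicit_geodesic t : AN :=
  (s0 - 2 * ln (ch t - a0 * sh t),
   U0 + (2 * sh t / (ch t - a0 * sh t)) *: V0,
   X0 + (2 * sh t / (ch t - a0 * sh t)) *: (2^-1 *: beta H U0 V0)).

(** The formula comes from solving [geodesic_height] and [geodesic_v] for the coordinates and
    integrating the vanishing of [vert] for the last one. *)
Lemma explicit_geodesicP : geodesic g explicit_geodesic /\
  derive1 explicit_geodesic 0 = (a0, V0, 2^-1 *: beta H U0 V0).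
Proof.
pose c1 t : AN := (- 2 * h1 t / h t, (h t) ^- 2 *: V0, (h t) ^- 2 *: (2^-1 *: beta H U0 V0)).
pose k t : R := - 2 * h1 t * (h t) ^- 3.
pose c2 t : AN := (- 2^-1 + 2 * h1 t ^+ 2 * (h t) ^- 2, k t *: V0, k t *: (2^-1 *: beta H U0 V0)).
(* First integral of h'' = h / 4. *)
have rel t : h t ^+ 2 - 4 * h1 t ^+ 2 = 1 - a0 ^+ 2.
  by rewrite -[RHS]mulr1 -[X in _ = _ * X](chsh t) /h /h1; field.
have fD t : is_derive t (1 : R) (fun t => 2 * sh t / h t) ((h t) ^- 2).
  have D := is_derive_mulf (is_derive_scalef 2 (is_derive_sh t)) (hVD t).
  apply: (is_derive_eq D); rewrite /GRing.scale /=.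
  (* Twice the Wronskian of [sh] and [h], constant because both solve y'' = y / 4. *)
  have key : ch t * h t - 2 * sh t * h1 t = 1 by rewrite -[RHS](chsh t) /h /h1; field.
  by rewrite -[RHS]mulr1 -[X in _ = _ * X]key; have hn := h_neq0 t; field.
have lnD t : is_derive t (1 : R) (fun t => s0 - 2 * ln (h t)) (- 2 * h1 t / h t).
  have D := is_derive_subf (is_derive_cstf s0 t (1 : R))
    (is_derive_scalef 2 (@is_derive1_comp R (@ln R) h t _ _ (is_derive1_ln (h_gt0 t)) (hD t))).
  by apply: (is_derive_eq D); rewrite /GRing.scale /=; ring.
have kD t : is_derive t (1 : R) (fun t => (h t) ^- 2) (k t).
  have D := is_derive_mulf (hVD t) (hVD t).
  rewrite (_ : (fun t => (h t) ^- 2) = fun t => (h t)^-1 * (h t)^-1); last first.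
    by apply/funext => u; rewrite -exprVn expr2.
  by apply: (is_derive_eq D); rewrite /k; have hn := h_neq0 t; field.
have aD t : is_derive t (1 : R) (fun t => - 2 * h1 t / h t) (- 2^-1 + 2 * h1 t ^+ 2 * (h t) ^- 2).
  have D := is_derive_mulf (is_derive_scalef (- 2) (h1D t)) (hVD t).
  by apply: (is_derive_eq D); rewrite /GRing.scale /=; have hn := h_neq0 t; field.
have cst0 (F : normedModType R) (a : F) (f : R -> F) t df :
    is_derive t (1 : R) f df -> is_derive t (1 : R) (fun u => a + f u) df.
  by move=> D; apply: (is_derive_eq (is_derive_addf (is_derive_cstf a t (1 : R)) D)); rewrite add0r.
have cD t : is_derive t (1 : R) explicit_geodesic (c1 t).
  by apply: is_derive_pair; [apply: is_derive_pair => //|]; apply: cst0; exact: is_derive_scale.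
have c1D t : is_derive t (1 : R) c1 (c2 t).
  by apply: is_derive_pair; [apply: is_derive_pair => //|]; exact: is_derive_scale.
have [//|gG dE] := geodesicP cD c1D _; last first.
  split=> //; rewrite dE /c1 /h1 /h sh0 ch0 mulr0 subr0 expr1n invr1 !scale1r.
  by congr (_, _, _); field.
move=> t; rewrite christoffelE.
have vc : vert H (explicit_geodesic t) (c1 t) = 0.
  by rewrite /vert /= !(betaE, betaxx, scaler0, addr0); apply/rowP => j; rewrite !mxE; ring.
rewrite /chris /chris_v vc !J_0 !(ipz0l, mulr0, addr0, scaler0, subr0, oppr0, add0r).
have es : expR (- (explicit_geodesic t).1.1) = expR (- s0) * h t ^+ 2.
  rewrite /= opprD opprK expRD -/(h t); congr (_ * _).
  by rewrite mulrC -[2]/(2%:R) expRM_natr lnK // posrE.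
have hn := h_neq0 t.
congr (_, _, _); rewrite /=.
- rewrite es !ipvE.
  have -> : 2^-1 * (expR (- s0) * h t ^+ 2) * (h t ^- 2 * (h t ^- 2 * ipv H V0 V0)) =
      2^-1 * (expR (- s0) * ipv H V0 V0) * h t ^- 2 by field.
  have -> : expR (- s0) * ipv H V0 V0 = h t ^+ 2 - 4 * h1 t ^+ 2.
    by rewrite rel -unit0; ring.
  by field.
- by apply/rowP => j; rewrite !mxE /k; field.
- rewrite !(betaE, betaxx, scaler0, addr0); apply/rowP => j; rewrite !mxE /k; field.
  by rewrite -/(h t) hn.
Qed.

End Explicit.
End Geodesics.

Lemma is_derive_line0 (R : realType) (E : normedModType R) (t : R) (v : E) :
  is_derive t (1 : R) (fun h : R => h *: v) v.
Proof.
have D := is_derive_scalel v (is_derive_id t (1 : R)).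
by apply: (is_derive_eq D); rewrite scale1r.
Qed.

(** * The tube as a level set *)

Section Submanifold.
Context {R : realType} {p m : nat} (H : genHeisenberg R p m).
Variable w : {vspace 'rV[R]_p}.
Local Notation AN := (R * 'rV[R]_p * 'rV[R]_m)%type.
Local Notation g := (metric H).
Local Notation pi := (projp H w).
Local Notation S := (S_grp H w).
Implicit Types (x u v : AN).

Lemma is_derive_projp (E : normedModType R) (f : E -> 'rV[R]_p) (a b : E) df :
  is_derive a b f df -> is_derive a b (fun y => pi (f y)) (pi df).
Proof. by apply: is_derive_row => k U V; rewrite !projpE. Qed.

Lemma one_parameter_line v :
  (forall a b : R, dr_mul H (a *: v) (b *: v) = (a + b) *: v) ->
  one_parameter_subgroup H (fun t => t *: v) /\ derive1 (fun t : R => t *: v) 0 = v.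
Proof.
move=> E; split; last by rewrite derive1E (@derive_val _ _ _ _ _ _ _ (is_derive_line0 0 v)).
split=> [s t|t]; first by rewrite E.
by have := is_derive_line0 t v => D; exact: ex_derive.
Qed.

(** The right side is a subgroup. Along a one-parameter subgroup with initial velocity in [s_alg w],
    the component in [vperp H w] has derivative 0 at time 0, and by the homomorphism property at all
    times. Conversely, a point is the product of (0, 0, X), (0, U, 0) and (s, 0, 0), each of which
    lies on a straight line that is a one-parameter subgroup. *)
Lemma S_grpE : S = [set x | x.1.2 \in w].
Proof.
apply/seteqP; split=> [x|[[s U] X] /= Uw].
  apply.
    split; first exact: mem0v.
      by move=> y z /= yw zw; rewrite memvD // memvZ.
    by move=> y /= yw; rewrite memvN memvZ.
  move=> phi [phiM phiD] /= phi0.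
  rewrite -(projp_eq0P H); apply/eqP; pose f t := pi (phi t).1.2.
  have fM s t : f (s + t) = f s + expR ((phi s).1.1 / 2) *: f t.
    by rewrite /f phiM /= !projpE.
  have fD0 : is_derive (0 : R) (1 : R) f 0.
    have D : is_derive (0 : R) (1 : R) phi (derive1 phi 0).
      by rewrite derive1E; exact: derivableP.
    have := is_derive_projp (is_derive_snd (is_derive_fst D)).
    by rewrite (projp_eq0 H phi0).
  have fD t : is_derive t (1 : R) f 0.
    apply/is_derive_lineP.
    rewrite (_ : (fun h : R => _) = fun h => f t + expR ((phi t).1.1 / 2) *: f h).
      have D := is_derive_addf (is_derive_cstf (f t) (0 : R) (1 : R))
        (is_derive_scalef (expR ((phi t).1.1 / 2)) fD0).
      by apply: (is_derive_eq D); rewrite scaler0 addr0.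
    by apply/funext => h; rewrite [h *: 1]mulr1 addrC fM.
  have f0 : f 0 = 0.
    have := fM 0 0; rewrite addr0 => /esym/eqP; rewrite -subr_eq0 addrC addKr.
    by rewrite scaler_eq0 gt_eqF ?expR_gt0 //= => /eqP.
  by have := is_derive_row_cst fD 1; rewrite f0.
move=> G [_ GM _] Gphi.
have line v : v.1.2 \in w -> (forall a b : R, dr_mul H (a *: v) (b *: v) = (a + b) *: v) -> G v.
  move=> vw /one_parameter_line[vP vD].
  by have := Gphi _ vP; rewrite vD scale1r; apply.
have sc (a q : R) (V : 'rV[R]_p) (Z : 'rV[R]_m) :
  a *: ((q, V, Z) : AN) = (a * q, a *: V, a *: Z) by [].
have G1 : G (0, 0, X).
  apply: line => [|a b]; first exact: mem0v.
  rewrite !sc /dr_mul /= !(betaE, mulr0, scaler0, mul0r, expR0, scale1r, addr0).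
  by rewrite scalerDl.
have G2 : G (0, U, 0).
  apply: line => [//|a b].
  rewrite !sc /dr_mul /= !(betaE, betaxx, mulr0, scaler0, mul0r, expR0, scale1r, addr0).
  by rewrite scalerDl.
have G3 : G (s, 0, 0).
  apply: line => [|a b]; first exact: mem0v.
  by rewrite !sc /dr_mul /= !(betaE, scaler0, addr0) mulrDl.
have := GM _ _ G1 (GM _ _ G2 G3); rewrite /dr_mul /=.
rewrite !(betaE, scaler0, mul0r, expR0, scale1r, addr0, add0r).
by [].
Qed.

Lemma tangent_S x u : x.1.2 \in w -> u.1.2 \in w -> tangent S x u.
Proof.
move=> xw uw; exists (fun t : R => t *: u + x); split.
- by move=> t; rewrite S_grpE /= memvD // memvZ.
- by rewrite scale0r add0r.
- exact: is_derive_line.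
Qed.

Lemma tangent_S_sub x u : tangent S x u -> u.1.2 \in w.
Proof.
move=> [c [cS _ cD]]; rewrite -(projp_eq0P H); apply/eqP.
have D := is_derive_projp (is_derive_snd (is_derive_fst cD)).
have c0 : (fun y => pi (c y).1.2) = fun _ : R => 0.
  by apply/funext => t; apply: projp_eq0; have := cS t; rewrite S_grpE.
rewrite c0 in D.
by rewrite -(@derive_val _ _ _ _ _ _ _ D) (@derive_val _ _ _ _ _ _ _ (is_derive_cstf _ _ _)).
Qed.

Lemma vert_z x (a : R) Z : vert H x (a, 0, Z) = Z.
Proof. by rewrite /vert /= beta0r scaler0 subr0. Qed.

Lemma vert_hor x (a : R) V : vert H x (a, V, 2^-1 *: beta H x.1.2 V) = 0.
Proof. by rewrite /vert /= subrr. Qed.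

(** The test vectors are B, the horizontal lifts of vectors of [w], and central vectors; together
    they span the tangent space. *)
Lemma normal_SP x u : x.1.2 \in w ->
  normal g S x u <-> [/\ u.1.1 = 0, u.1.2 \in vperp H w & vert H x u = 0].
Proof.
move=> xw; split=> [N|[u1 /vperpP u2 u3] v /tangent_S_sub vw]; last first.
  by rewrite /metric u1 u2 // u3 ipz0l mul0r !mulr0 !addr0.
have Nw v : v.1.2 \in w -> g x u v = 0 by move=> vw; apply: N; exact: tangent_S.
split.
- have := Nw (1, 0, 0) (mem0v _).
  by rewrite /metric vert_z ipz0r ipv0r !mulr0 !addr0 mulr1.
- apply/vperpP => V Vw; have := Nw (0, V, 2^-1 *: beta H x.1.2 V) Vw.
  rewrite /metric vert_hor ipz0r !mulr0 add0r addr0 => /eqP.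
  by rewrite mulf_eq0 gt_eqF ?expR_gt0 //= => /eqP.
- have := Nw (0, 0, vert H x u) (mem0v _).
  rewrite /metric vert_z ipv0r !mulr0 !add0r => /eqP.
  by rewrite mulf_eq0 expf_eq0 /= gt_eqF ?expR_gt0 //= => /eqP E; exact: ipz_eq0 E.
Qed.

Definition level (k : R) : set AN :=
  [set x | ipv H (pi x.1.2) (pi x.1.2) = k ^+ 2 * expR x.1.1].

Lemma expR_height (s : R) : expR (- (2^-1 * s)) ^+ 2 = (expR s)^-1.
Proof. by rewrite -expRM_natr -expRN; congr expR; field. Qed.

(** Expresses membership by the rescaled vector that [geodesic_v] controls along geodesics. *)
Lemma level_heightE (k s : R) (U : 'rV[R]_p) (X : 'rV[R]_m) :
  level k (s, U, X) <->
  ipv H (pi (expR (- (2^-1 * s)) *: U)) (pi (expR (- (2^-1 * s)) *: U)) = k ^+ 2.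
Proof.
rewrite /level /= !projpE !ipvE mulrA -expr2 expR_height.
have e0 := expR_gt0 s; split=> [->|<-]; first by rewrite mulrCA mulVf ?mulr1 // gt_eqF.
by rewrite mulrAC mulVf ?mul1r // gt_eqF.
Qed.

Lemma expR_ln_height (s a : R) : 0 < a -> expR (- (s + 2 * ln a)) = expR (- s) * a ^- 2.
Proof.
move=> a0; rewrite opprD expRD; congr (_ * _).
by rewrite -mulNr mulrC -[- 2]/(- (2%:R)) mulrN expRN expRM_natr lnK // posrE.
Qed.

(** A normal geodesic starts with [pi U = 0] and without B-component, so [geodesic_v] gives the
    length of its rescaled [pi U] at time [r]. For the other inclusion, [explicit_geodesic] at time
    [r] is solved for its initial data. *)
Lemma tube_level r : 0 < r -> tube g S r = level (2 * sh r).
Proof.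
move=> r0; apply/seteqP; split=> [y [c [cG cS cN cU ->]]|[[s U] X] xL].
  have cw : (c 0).1.2 \in w by move: cS; rewrite S_grpE.
  have /(normal_SP _ cw)[a0 V0 v0] := cN.
  have [_ ] := horizontal_geodesic cG v0 cU r; case: (c r) => [[s U] X] /= E.
  apply/level_heightE; rewrite E !projpE (projp_eq0 H cw) scaler0 add0r (projp_id V0) !ipvE.
  have := cU; rewrite /metric a0 v0 ipz0l !(mulr0, mul0r, addr0, add0r) expRN -expR_height => cU'.
  by apply: etrans (etrans (congr1 ( *%R ((2 * sh r) ^+ 2)) cU') (mulr1 _)); ring.
have k0 : 2 * sh r != 0 by rewrite mulf_neq0 // gt_eqF // sh_gt0.
have c0 := ch_gt0 r; have cn0 : ch r != 0 by rewrite gt_eqF.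
have s0 : sh r != 0 by rewrite gt_eqF // sh_gt0.
pose V0 := (ch r / (2 * sh r)) *: pi U; pose U0 := U - pi U.
(* The term [0 * sh r] is kept to match the body of [explicit_geodesic] with [a0 = 0]. *)
pose q := 2 * sh r / (ch r - 0 * sh r).
have qV : q *: V0 = pi U.
  rewrite /q /V0 mul0r subr0 scalerA -[RHS]scale1r; congr (_ *: _).
  by field; rewrite s0 cn0.
have unit0 : 0 ^+ 2 + expR (- (s + 2 * ln (ch r))) * ipv H V0 V0 = 1.
  rewrite expr0n /= add0r (expR_ln_height _ c0) /V0 !ipvE xL /= expRN.
  have e0 : expR s != 0 by rewrite gt_eqF // expR_gt0.
  by field; rewrite s0 cn0 e0.
have [cG cD] := explicit_geodesicP (s0 := s + 2 * ln (ch r)) U0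
   (X - q *: (2^-1 *: beta H U0 V0)) unit0.
set c := explicit_geodesic _ _ _ _ _ _ in cG cD.
have c_0 : c 0 = (s + 2 * ln (ch r), U0, X - q *: (2^-1 *: beta H U0 V0)).
  rewrite /c /explicit_geodesic sh0 ch0 !mulr0 !mul0r subr0 ln1 mulr0 subr0 !scale0r !addr0.
  by [].
exists c; split=> //.
- by rewrite S_grpE c_0 /= sub_projp.
- apply/normal_SP; first by rewrite c_0 /= sub_projp.
  rewrite cD; split=> //=; first by rewrite memvZ // projp_vperp.
  by rewrite c_0 vert_hor.
- by rewrite cD /metric c_0 vert_hor /= ipz0l !(mulr0, addr0, mul0r) -[RHS]unit0 expr0n.
- rewrite /c /explicit_geodesic -/q qV subrK mul0r subr0 addrK.
  by rewrite /U0 subrK.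
Qed.

End Submanifold.

Section Level.
Context {R : realType} {p m : nat} (H : genHeisenberg R p m).
Variable w : {vspace 'rV[R]_p}.
Local Notation AN := (R * 'rV[R]_p * 'rV[R]_m)%type.
Local Notation g := (metric H).
Local Notation pi := (projp H w).
Implicit Types (x u v : AN).

Lemma is_derive_ipv (E : normedModType R) (f h : E -> 'rV[R]_p) (a b : E) df dh :
  is_derive a b f df -> is_derive a b h dh ->
  is_derive a b (fun y => ipv H (f y) (h y)) (ipv H df (h a) + ipv H (f a) dh).
Proof.
exact: (is_derive_bilinear (F := R) (fun V k W W' => ipv_lin H k W W' V) (@ipv_linr _ _ _ H)).
Qed.

Lemma is_derive_beta (E : normedModType R) (f h : E -> 'rV[R]_p) (a b : E) df dh :
  is_derive a b f df -> is_derive a b h dh ->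
  is_derive a b (fun y => beta H (f y) (h y)) (beta H df (h a) + beta H (f a) dh).
Proof.
exact: (is_derive_bilinear (F := 'rV[R]_m) (fun V k W W' => betaL H k W W' V)
  (fun V k W W' => betaR H k W W' V)).
Qed.

Lemma tangent_levelP k x u : k != 0 -> level H w k x ->
  tangent (level H w k) x u <->
  2 * ipv H (pi x.1.2) (pi u.1.2) = u.1.1 * (k ^+ 2 * expR x.1.1).
Proof.
move=> k0 xL; split=> [[c [cL c0 cD]]|].
  have UD := is_derive_projp H w (is_derive_snd (is_derive_fst cD)).
  have D := is_derive_subf (is_derive_ipv UD UD) (is_derive_scalef (k ^+ 2)
     (is_derive_expR_comp (is_derive_fst (is_derive_fst cD)))).
  rewrite (_ : (fun t : R => _ - _) = fun _ => 0) in D; last first.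
    by apply/funext => t; have := cL t; rewrite /level /= => ->; rewrite subrr.
  have := @derive_val _ _ _ _ _ _ _ D.
  rewrite (@derive_val _ _ _ _ _ _ _ (is_derive_cstf _ _ _)) c0 [ipv H (pi u.1.2) _]ipvC.
  by rewrite /GRing.scale /= => E; lra.
case: x u xL => [[s U] X] [[a V] Y]; rewrite /level /= => xL uE.
pose N := ipv H (pi U) (pi U).
have N0 : 0 < N by rewrite /N xL mulr_gt0 ?expR_gt0 // exprn_even_gt0.
(* By the tangency condition the radial part of [pi V] is [(a / 2) *: pi U]; [W] is the remainder,
   orthogonal to [pi U]. *)
have [W WE] : exists W, W = pi V - (a / 2) *: pi U by exists (pi V - (a / 2) *: pi U).
have WU : ipv H W (pi U) = 0.
  by rewrite WE !ipvE [ipv H (pi V) _]ipvC xL; lra.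
have pW : pi W = W by rewrite WE !projpE !projpK.
(* The curve below turns [pi U] by a rational parametrization of the circle in the
   plane of [pi U] and [W], rescaled by the height. *)
pose al := ipv H W W / (4 * N).
have al0 : 0 <= al by rewrite divr_ge0 ?ipv_ge0 // mulr_ge0 // ltW.
have WW : ipv H W W = 4 * N * al by rewrite /al mulrC divfK // gt_eqF // mulr_gt0.
pose q (t : R) := 1 + al *: (t * t).
have q0 t : q t != 0 by rewrite gt_eqF // ltr_pwDl // mulr_ge0 // -expr2 sqr_ge0.
pose f (t : R) := expR (2^-1 *: (a *: t)) * (q t)^-1.
pose c (t : R) : AN := (s + t * a, (U - pi U) + t *: (V - pi V)
   + f t *: ((1 - al *: (t * t)) *: pi U + t *: W), X + t *: Y).
exists c; split.
- move=> t; rewrite /level /= !projpE !projpK !subrr scaler0 !add0r pW !ipvE WW WU.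
  rewrite [ipv H (pi U) W]ipvC WU expRD [RHS]mulrA -xL -/N.
  have -> : expR (t * a) = expR (2^-1 *: (a *: t)) * expR (2^-1 *: (a *: t)).
    by rewrite -expRD /GRing.scale /=; congr expR; field.
  by have := q0 t; rewrite /f /q /GRing.scale /= => h; field.
- rewrite /c /f /q !(mul0r, scale0r, mulr0, scaler0, addr0, subr0, expR0, invr1, scale1r).
  by rewrite mulr1 scale1r subrK.
have tD : is_derive (0 : R) (1 : R) (fun t : R => t) 1 by exact: is_derive_id.
have ttD := is_derive_scalef al (is_derive_mulf tD tD).
have qD : is_derive (0 : R) (1 : R) q 0.
  have D := is_derive_addf (is_derive_cstf (1 : R) (0 : R) (1 : R)) ttD.
  by apply: (is_derive_eq D); rewrite /GRing.scale /=; ring.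
have fD : is_derive (0 : R) (1 : R) f (a / 2).
  have D := is_derive_mulf (is_derive_expR_comp (is_derive_scalef (2^-1) (is_derive_scalef a tD)))
    (is_derive_invf qD (q0 0)).
  apply: (is_derive_eq D); rewrite /q /GRing.scale /=.
  by rewrite !(mul0r, mulr0, addr0, expR0, add0r, invr1, mulr1, mul1r) mulrC.
have vD := is_derive_addf (is_derive_addf (is_derive_cstf (U - pi U) (0 : R) (1 : R))
   (is_derive_line0 0 (V - pi V)))
  (is_derive_scalevec fD (is_derive_addf
     (is_derive_scalevec (is_derive_subf (is_derive_cstf (1 : R) (0 : R) (1 : R)) ttD)
        (is_derive_cstf (pi U) (0 : R) (1 : R))) (is_derive_line0 0 W))).
apply: is_derive_pair; [apply: is_derive_pair|].
- have D := is_derive_addf (is_derive_cstf s (0 : R) (1 : R)) (is_derive_line0 0 a).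
  by apply: (is_derive_eq D); rewrite add0r.
- apply: (is_derive_eq vD); rewrite /f /q WE.
  rewrite !(mul0r, scale0r, mulr0, scaler0, addr0, add0r, subr0, expR0, invr1, scale1r, mulr1, oppr0).
  by apply/rowP => j; rewrite !mxE; ring.
- have D := is_derive_addf (is_derive_cstf X (0 : R) (1 : R)) (is_derive_line0 0 Y).
  by apply: (is_derive_eq D); rewrite add0r.
Qed.

Lemma level_neq0 k : w != fullv -> level H w k !=set0.
Proof.
move=> wp; have [xi [xiw xi1]] := unit_vperp_exists H wp.
exists (0, k *: xi, 0); rewrite /level /= !projpE (projp_id xiw) !ipvE xi1 expR0.
by rewrite !mulr1 expr2.
Qed.

(** A family containing the defining function of [level H w k] and closed under
    directional derivatives. *)
Let level_fun (al : R) (W : 'rV[R]_p) (ga de : R) x : R :=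
  al * ipv H (pi x.1.2) (pi x.1.2) + ipv H x.1.2 W + ga + de * expR x.1.1.

Let level_funD al W ga de x v :
  is_derive x v (level_fun al W ga de)
    (level_fun 0 ((2 * al) *: pi v.1.2) (ipv H v.1.2 W) (de * v.1.1) x).
Proof.
apply/is_derive_lineP; have x0 : 0 *: v + x = x by rewrite scale0r add0r.
have lD := is_derive_line (0 : R) v x.
have UD := is_derive_snd (is_derive_fst lD); have pD := is_derive_projp H w UD.
have eD := is_derive_expR_comp (is_derive_fst (is_derive_fst lD)).
have D := is_derive_addf (is_derive_addf (is_derive_addf
   (is_derive_scalef al (is_derive_ipv pD pD))
   (is_derive_ipv UD (is_derive_cstf W (0 : R) (1 : R)))) (is_derive_cstf ga (0 : R) (1 : R)))
   (is_derive_scalef de eD).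
apply: (is_derive_eq D); rewrite !x0 /level_fun !ipvE [ipv H (pi v.1.2) _]ipvC projp_ip.
rewrite -(projp_sa H w x.1.2 v.1.2).
by rewrite /GRing.scale /=; ring.
Qed.

Let level_fun_continuous al W ga de x : {for x, continuous (level_fun al W ga de)}.
Proof.
have Uc : {for x, continuous (fun y : AN => y.1.2)}.
  by case: x => [[s U] X]; apply: (@cvg_comp _ _ _ fst snd _ (nbhs (s, U)));
    [exact: cvg_fst|exact: cvg_snd].
have sc : {for x, continuous (fun y : AN => y.1.1)}.
  by case: x Uc => [[s U] X] _; apply: (@cvg_comp _ _ _ fst fst _ (nbhs (s, U))); exact: cvg_fst.
have pl : linear pi by exact: projp_linear.
have pc : {for x, continuous (fun y : AN => pi y.1.2)}.
  exact: (cvg_comp _ _ Uc (@linear_row_continuous _ _ _ _ pl _)).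
have bc (f1 f2 : AN -> 'rV[R]_p) : {for x, continuous f1} -> {for x, continuous f2} ->
    {for x, continuous (fun y => ipv H (f1 y) (f2 y))}.
  exact: (bilinear_row_continuous (F := R) (fun V a W W' => ipv_lin H a W W' V) (@ipv_linr _ _ _ H)).
apply: cvgD; first apply: cvgD; first apply: cvgD.
- by apply: cvgM; [exact: cvg_cst|exact: bc].
- by apply: bc => //; exact: cvg_cst.
- exact: cvg_cst.
- by apply: cvgM; [exact: cvg_cst|exact: (cvg_comp _ _ sc (@continuous_expR R _))].
Qed.

Let level_fun_smooth al W ga de : smooth setT (level_fun al W ga de).
Proof.
move=> n; elim: n al W ga de => [|n IH] al W ga de.
  by split=> // x _; exact: level_fun_continuous.
split=> [x _|v]; first exact: level_fun_continuous.
split=> [x _|]; first by have D := level_funD al W ga de x v; exact: ex_derive.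
rewrite (_ : 'D_v _ = level_fun 0 ((2 * al) *: pi v.1.2) (ipv H v.1.2 W) (de * v.1.1)) //.
by apply/funext => x; exact: (@derive_val _ _ _ _ _ _ _ (level_funD al W ga de x v)).
Qed.

Lemma hypersurface_level k : w != fullv -> k != 0 -> hypersurface (level H w k).
Proof.
move=> wp k0; split; first exact: level_neq0.
move=> x xL; exists setT, (level_fun 1 0 0 (- k ^+ 2)); split=> //.
- exact: openT.
(* Along B only the exponential term varies, and its coefficient [- k ^+ 2] is nonzero. *)
- move=> y _; exists (1, 0, 0).
  rewrite (@derive_val _ _ _ _ _ _ _ (level_funD _ _ _ _ y _)) /level_fun /=.
  rewrite projp0 scaler0 ipv0r ipv0l !(mul0r, add0r) mulr1.
  by rewrite mulf_neq0 ?oppr_eq0 ?expf_neq0 // gt_eqF ?expR_gt0.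
- rewrite setIT; apply/seteqP; split=> y; rewrite /level /level_fun /= ipv0r mul1r !addr0.
    by move=> ->; split=> //; ring.
  by move=> [_ E]; lra.
Qed.

End Level.

(** * The unit normal field and the parallel hypersurfaces *)

Section TubeConstants.
Context {R : realType}.
Variable r : R.
Hypothesis r_gt0 : 0 < r.

Definition tube_tau : R := sh r / ch r.
Definition tube_sigma : R := (ch r)^-1.
Definition tube_rho : R := (2 * sh r * ch r)^-1.
Local Notation tau := tube_tau.
Local Notation sigma := tube_sigma.
Local Notation rho := tube_rho.

Let s0 : sh r != 0. Proof. by rewrite gt_eqF // sh_gt0. Qed.
Let c0 : ch r != 0. Proof. by rewrite gt_eqF // ch_gt0. Qed.

Lemma tau_gt0 : 0 < tau. Proof. by rewrite divr_gt0 ?sh_gt0 ?ch_gt0. Qed.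
Lemma sigma_gt0 : 0 < sigma. Proof. by rewrite invr_gt0 ch_gt0. Qed.
Lemma rho_gt0 : 0 < rho.
Proof. by rewrite invr_gt0 mulr_gt0 ?ch_gt0 // mulr_gt0 ?sh_gt0. Qed.

Lemma tau_sigma : tau ^+ 2 + sigma ^+ 2 = 1.
Proof.
apply: (mulfI (expf_neq0 2 c0)); rewrite mulr1.
transitivity (sh r ^+ 2 + 1); first by rewrite /tube_tau /tube_sigma; field.
by rewrite -[X in _ + X](chsh r); ring.
Qed.
Lemma rho_tau : 2 * (rho * tau) = sigma ^+ 2.
Proof. by rewrite /tube_rho /tube_tau /tube_sigma; field; rewrite ?s0 ?c0. Qed.
Lemma rho_radius : rho * (2 * sh r) = sigma.
Proof. by rewrite /tube_rho /tube_sigma; field; rewrite ?s0 ?c0. Qed.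
Lemma sigma_radius : sigma * (2 * sh r) = 2 * tau.
Proof. by rewrite /tube_tau /tube_sigma; field. Qed.

End TubeConstants.

Section Tube.
Context {R : realType} {p m : nat} (H : genHeisenberg R p m).
Variable w : {vspace 'rV[R]_p}.
Local Notation AN := (R * 'rV[R]_p * 'rV[R]_m)%type.
Local Notation g := (metric H).
Local Notation pi := (projp H w).
Implicit Types (x u v : AN).

Section NormalField.
Variable r : R.
Hypothesis r_gt0 : 0 < r.
Local Notation M := (level H w (2 * sh r)).
Local Notation tau := (tube_tau r).
Local Notation sigma := (tube_sigma r).
Local Notation rho := (tube_rho r).

Let k0 : 2 * sh r != 0. Proof. by rewrite mulf_neq0 // gt_eqF // sh_gt0. Qed.

(** The velocity at time [r] of the geodesics that leave [S_grp H w] orthogonally, written in terms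
    of the point reached. *)
Definition nu x : AN :=
  (- tau, rho *: pi x.1.2, 2^-1 *: beta H x.1.2 (rho *: pi x.1.2)).

Lemma vert_nu x : vert H x (nu x) = 0. Proof. exact: vert_hor. Qed.

Lemma metric_nu x u : g x u (nu x) =
  - tau * u.1.1 + expR (- x.1.1) * (rho * ipv H (pi x.1.2) (pi u.1.2)).
Proof. by rewrite /metric vert_nu ipz0r mulr0 addr0 /= ipvZr ipvC projp_ip; ring. Qed.

Lemma tangent_nuP x u : M x -> tangent M x u <-> g x u (nu x) = 0.
Proof.
move=> xM; rewrite (tangent_levelP _ k0 xM) metric_nu expRN.
have e0 : expR x.1.1 != 0 by rewrite gt_eqF ?expR_gt0.
set q := ipv H _ _; have rn : rho != 0 by rewrite gt_eqF // rho_gt0.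
have tE : tau = rho * (2 * sh r) ^+ 2 / 2.
  by rewrite expr2 mulrA rho_radius // sigma_radius // mulrC mulKf.
rewrite tE; split=> E.
  have -> : q = u.1.1 * ((2 * sh r) ^+ 2 * expR x.1.1) / 2 by rewrite -E; field.
  by field.
apply: (mulfI (mulf_neq0 (invr_neq0 e0) rn)).
have {}E : (expR x.1.1)^-1 * (rho * q) = rho * (2 * sh r) ^+ 2 / 2 * u.1.1 by lra.
transitivity (2 * ((expR x.1.1)^-1 * (rho * q))); first ring.
by rewrite E; field.
Qed.

Lemma metric_nu_nu x : M x -> g x (nu x) (nu x) = 1.
Proof.
move=> xM; rewrite metric_nu /= !projpE projpK ipvZr xM expRN -[RHS](tau_sigma r).
have e0 : expR x.1.1 != 0 by rewrite gt_eqF ?expR_gt0.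
by rewrite -(rho_radius r_gt0); field.
Qed.

(** A family that contains [nu] and is closed under directional derivatives, which gives smoothness
    by induction. *)
Let nu_fun (a b q : R) (V0 V1 V2 : 'rV[R]_p) (Z0 : 'rV[R]_m) x : AN :=
  (a, b *: pi x.1.2 + V0,
   q *: beta H x.1.2 (pi x.1.2) + beta H x.1.2 V1 + beta H V2 (pi x.1.2) + Z0).

Let nu_funD a b q V0 V1 V2 Z0 x v :
  is_derive x v (nu_fun a b q V0 V1 V2 Z0)
    (nu_fun 0 0 0 (b *: pi v.1.2) (q *: pi v.1.2) (q *: v.1.2)
       (beta H v.1.2 V1 + beta H V2 (pi v.1.2)) x).
Proof.
apply/is_derive_lineP; have x0 : 0 *: v + x = x by rewrite scale0r add0r.
have lD := is_derive_line (0 : R) v x.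
have UD := is_derive_snd (is_derive_fst lD); have pD := is_derive_projp H w UD.
have D1 := is_derive_cstf a (0 : R) (1 : R).
have D2 := is_derive_addf (is_derive_scalef b pD) (is_derive_cstf V0 (0 : R) (1 : R)).
have D3 := is_derive_addf (is_derive_addf (is_derive_addf
   (is_derive_scalef q (is_derive_beta H UD pD))
   (is_derive_beta H UD (is_derive_cstf V1 (0 : R) (1 : R))))
   (is_derive_beta H (is_derive_cstf V2 (0 : R) (1 : R)) pD)) (is_derive_cstf Z0 (0 : R) (1 : R)).
apply: (is_derive_eq (is_derive_pair (is_derive_pair D1 D2) D3)).
rewrite !x0 /nu_fun !(betaE, scale0r, addr0, add0r); congr (_, _, _).
by apply/rowP => j; rewrite !mxE; ring.
Qed.

Let nu_fun_continuous a b q V0 V1 V2 Z0 x : {for x, continuous (nu_fun a b q V0 V1 V2 Z0)}.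
Proof.
have Uc : {for x, continuous (fun y : AN => y.1.2)}.
  by case: x => [[s U] X]; apply: (@cvg_comp _ _ _ fst snd _ (nbhs (s, U)));
    [exact: cvg_fst|exact: cvg_snd].
have pl : linear pi by exact: projp_linear.
have pc : {for x, continuous (fun y : AN => pi y.1.2)}.
  exact: (cvg_comp _ _ Uc (@linear_row_continuous _ _ _ _ pl _)).
have bc (f1 f2 : AN -> 'rV[R]_p) : {for x, continuous f1} -> {for x, continuous f2} ->
    {for x, continuous (fun y => beta H (f1 y) (f2 y))}.
  exact: (bilinear_row_continuous (F := 'rV[R]_m) (fun V k W W' => betaL H k W W' V)
    (fun V k W W' => betaR H k W W' V)).
have cst (F : normedModType R) (y : F) : {for x, continuous (fun _ : AN => y)} by exact: cvg_cst.
have c2 : {for x, continuous (fun y : AN => b *: pi y.1.2 + V0)}.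
  by apply: cvgD; [exact: cvgZl_tmp|exact: cst].
have c3 : {for x, continuous (fun y : AN => q *: beta H y.1.2 (pi y.1.2)
    + beta H y.1.2 V1 + beta H V2 (pi y.1.2) + Z0)}.
  apply: cvgD; last exact: cst.
  apply: cvgD; last by apply: bc => //; exact: cst.
  apply: cvgD; last by apply: bc => //; exact: cst.
  by apply: cvgZl_tmp; exact: bc.
exact: (cvg_pair (cvg_pair (cst _ a) c2) c3).
Qed.

Let nu_fun_smooth a b q V0 V1 V2 Z0 : smooth setT (nu_fun a b q V0 V1 V2 Z0).
Proof.
move=> n; elim: n a b q V0 V1 V2 Z0 => [|n IH] a b q V0 V1 V2 Z0.
  by split=> // x _; exact: nu_fun_continuous.
split=> [x _|v]; first exact: nu_fun_continuous.
split=> [x _|]; first by have D := nu_funD a b q V0 V1 V2 Z0 x v; exact: ex_derive.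
rewrite (_ : 'D_v _ = nu_fun 0 0 0 (b *: pi v.1.2) (q *: pi v.1.2) (q *: v.1.2)
       (beta H v.1.2 V1 + beta H V2 (pi v.1.2))) //.
by apply/funext => x; exact: (@derive_val _ _ _ _ _ _ _ (nu_funD a b q V0 V1 V2 Z0 x v)).
Qed.

Let nuE : nu = nu_fun (- tau) rho (2^-1 * rho) 0 0 0 0.
Proof.
apply/funext => x; rewrite /nu /nu_fun !(betaE, addr0) scalerA.
by [].
Qed.

Lemma nu_smooth : smooth setT nu.
Proof. by rewrite nuE; exact: nu_fun_smooth. Qed.

Lemma derive_nu x v : is_derive x v nu
  (0, rho *: pi v.1.2, (2^-1 * rho) *: (beta H v.1.2 (pi x.1.2) + beta H x.1.2 (pi v.1.2))).
Proof.
have D := nu_funD (- tau) rho (2^-1 * rho) 0 0 0 0 x v; rewrite nuE.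
apply: (is_derive_eq D); rewrite /nu_fun !(scale0r, betaE, add0r, addr0).
by rewrite scalerDr addrC.
Qed.

Lemma unit_normal_nu : unit_normal_field g M nu.
Proof.
split; first by exists setT; split=> //; [exact: openT|exact: nu_smooth].
move=> x xM; split; first exact: metric_nu_nu.
by move=> v /(tangent_nuP _ xM) E; rewrite metricC.
Qed.

(** Along the geodesic with velocity [nu], the rescaled [pi U] is multiplied by [sh (r + t) / sh r].
    For the other inclusion the geodesic is again solved for its initial data. *)
Lemma parallel_level t : 0 < r + t -> parallel g M nu t = level H w (2 * sh (r + t)).
Proof.
move=> rt0; have c0 := ch_gt0 r; have s0 := sh_gt0 r_gt0.
have cn : ch r != 0 by rewrite gt_eqF.
have sn : sh r != 0 by rewrite gt_eqF.
have radius : 2 * sh r * (ch t + tau * sh t + 2 * sh t * rho) = 2 * sh (r + t).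
  rewrite shD /tube_tau /tube_rho; transitivity
    (2 * sh r * ch t + 2 * sh t * (sh r ^+ 2 + 1) / ch r); first by field; rewrite sn cn.
  have -> : sh r ^+ 2 + 1 = ch r ^+ 2 by rewrite -[X in _ + X](chsh r); ring.
  by field.
apply/seteqP; split=> [y [c [cG cM cD ->]]|[[s U] X] xL].
  have v0 : vert H (c 0) (derive1 c 0) = 0 by rewrite cD vert_nu.
  have cU : g (c 0) (derive1 c 0) (derive1 c 0) = 1 by rewrite cD metric_nu_nu.
  have [_ ] := horizontal_geodesic cG v0 cU t; rewrite cD /=; case: (c t) => [[s U] X] /= E.
  apply/level_heightE; rewrite E !projpE !projpK.
  have := cM; move: (c 0) => [[s1 U1] X1] /level_heightE /=; rewrite !projpE !ipvE => E1.
  by rewrite -radius exprMn -E1; ring.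
have h0 : 0 < ch t + tau * sh t.
  have -> : ch t + tau * sh t = ch (r + t) / ch r by rewrite chD /tube_tau; field.
  by rewrite divr_gt0 ?ch_gt0.
set h := ch t + tau * sh t in h0 radius.
have hn : h != 0 by rewrite gt_eqF.
pose q := 2 * sh t / (ch t - (- tau) * sh t).
have qE : q = 2 * sh t / h by rewrite /q mulNr opprK.
(* The factor by which [pi U] itself grows up to time [t]; the starting point therefore has radial
   part [ga^-1 *: pi U]. *)
pose ga := 1 + q * rho.
have gaE : ga = sh (r + t) / (sh r * h).
  rewrite /ga qE; apply: (mulfI k0).
  transitivity (2 * sh (r + t) / h); last by field; rewrite ?sn ?hn.
  by rewrite -radius; field.
have stn : sh (r + t) != 0 by rewrite gt_eqF // sh_gt0.
have ga0 : ga != 0 by rewrite gaE mulf_neq0 // invr_neq0 // mulf_neq0.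
pose U0 := U - pi U + ga^-1 *: pi U; pose V0 := (rho / ga) *: pi U.
have pU0 : pi U0 = ga^-1 *: pi U by rewrite /U0 !projpE !projpK subrr add0r.
have en : expR s != 0 by rewrite gt_eqF ?expR_gt0.
have unit0 : (- tau) ^+ 2 + expR (- (s + 2 * ln h)) * ipv H V0 V0 = 1.
  rewrite (expR_ln_height _ h0) /V0 !ipvE xL /= expRN gaE -[RHS](tau_sigma r).
  by rewrite -(rho_radius r_gt0); field; rewrite ?sn ?hn ?stn ?en.
pose X0 := X - q *: (2^-1 *: beta H U0 V0).
have [cG cD] := explicit_geodesicP (s0 := s + 2 * ln h) U0 X0 unit0.
set c := explicit_geodesic _ _ _ _ _ _ in cG cD.
have c_0 : c 0 = (s + 2 * ln h, U0, X0).
  rewrite /c /explicit_geodesic sh0 ch0 !mulr0 !mul0r subr0 ln1 mulr0 subr0 !scale0r !addr0.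
  by [].
exists c; split=> //.
- rewrite c_0 /level /= pU0 !ipvE xL /= expRD gaE.
  have -> : expR (2 * ln h) = h ^+ 2 by rewrite mulrC -[2]/(2%:R) expRM_natr lnK // posrE.
  by field; rewrite ?sn ?hn ?stn.
- rewrite cD c_0 /nu /= pU0 scalerA.
  by [].
- rewrite /c /explicit_geodesic -/q /X0 subrK mulNr opprK addrK; congr (_, _, _).
  rewrite /U0 /V0 -addrA scalerA -scalerDl.
  have -> : ga^-1 + q * (rho / ga) = 1.
    by rewrite mulrA -[X in X + _]mul1r -mulrDl -/ga divff.
  by rewrite scale1r subrK.
Qed.

End NormalField.
End Tube.

(** Makes [C1_chain_rule], which concerns real functions, available for the coordinates of a vector
    field. *)
Lemma Ck1_linear_comp (R : realType) (E F G : normedModType R) (O : set E) (f : E -> F)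
    (L : F -> G) :
  open O -> linear L -> continuous L -> Ck 1 O f -> Ck 1 O (L \o f).
Proof.
move=> Oo Ll Lc [fc f1]; split=> [x Ox|v].
  exact: (cvg_comp _ _ (fc x Ox) (Lc (f x))).
have [fd [dc _]] := f1 v.
have dL x : O x -> is_derive x v (L \o f) (L ('D_v f x)).
  by move=> Ox; apply: is_derive_linear => //; exact: derivableP (fd x Ox).
split=> [x Ox|]; first by have D := dL x Ox; exact: ex_derive.
split=> // x Ox.
have Dx : 'D_v (L \o f) x = L ('D_v f x) by have D := dL x Ox; exact: derive_val.
rewrite /continuous_at /prop_for Dx.
apply: cvg_trans (cvg_comp _ _ (dc x Ox) (Lc ('D_v f x))).
apply: near_eq_cvg; near=> y.
have Oy : O y by near: y; exact: open_nbhs_nbhs.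
by rewrite /=; have D := dL y Oy; apply/esym; exact: derive_val.
Unshelve. all: by end_near. Qed.

(** * The shape operator of the tube *)

Section Coordinates.
Context {R : realType} {p m : nat}.
Local Notation AN := (R * 'rV[R]_p * 'rV[R]_m)%type.

Definition AN_coord : seq (AN * (AN -> R)) :=
  ((1, 0, 0), fun y : AN => y.1.1) ::
  [seq ((0, delta_mx 0 j, 0), fun y : AN => y.1.2 0 j) | j <- index_enum 'I_p] ++
  [seq ((0, 0, delta_mx 0 j), fun y : AN => y.2 0 j) | j <- index_enum 'I_m].

Let pair_sum (I : Type) (s : seq I) (f : I -> AN) :
  \sum_(i <- s) f i = (\sum_(i <- s) (f i).1.1, \sum_(i <- s) (f i).1.2, \sum_(i <- s) (f i).2).
Proof. by elim: s => [|i s IH]; rewrite ?big_nil // !big_cons IH. Qed.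

Let row_norm n (u : 'rV[R]_n) j : `|u 0 j| <= `|u|.
Proof.
rewrite [leRHS]/Num.Def.normr /= mx_normrE; exact: (le_bigmax _ (fun ij => `|u ij.1 ij.2|) (0, j)).
Qed.

Lemma AN_coordP : coordinates AN_coord.
Proof.
split=> [[[s U] X]|[[s U] X] b].
  rewrite /AN_coord big_cons big_cat !big_map /= !pair_sum /=.
  rewrite -!row_sum_delta.
  have z (I : Type) (t : seq I) (F : lmodType R) (a : I -> R) : \sum_(i <- t) a i *: (0 : F) = 0.
    by rewrite big1 // => i _; rewrite scaler0.
  have zR (I : Type) (t : seq I) (a : I -> R) : \sum_(i <- t) a i *: (0 : R) = 0.
    by rewrite big1 // => i _; exact: mulr0.
  rewrite !z ?zR; transitivity ((s * 1 + (0 + 0), s *: 0 + (U + 0), s *: 0 + (0 + X)) : AN) => //.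
  by rewrite mulr1 !scaler0 !(addr0, add0r).
have le1 (a b' : R) : a <= Num.max a b' by rewrite le_max lexx.
have le2 (a b' : R) : b' <= Num.max a b' by rewrite le_max lexx orbT.
have n1 : `|s| <= `|(s, U, X)| by apply: le_trans (le1 _ _); exact: le1.
have n2 : `|U| <= `|(s, U, X)| by apply: le_trans (le1 _ _); exact: le2.
have n3 : `|X| <= `|(s, U, X)| by exact: le2.
rewrite inE mem_cat => /or3P[/eqP ->|/mapP[j _ ->]|/mapP[j _ ->]] //=.
  exact: le_trans (row_norm _ _) n2.
exact: le_trans (row_norm _ _) n3.
Qed.

Lemma AN_coord_linear (b : AN * (AN -> R)) :
  b \in AN_coord -> linear b.2 /\ continuous b.2.
Proof.
have c1 : continuous (fun y : AN => y.1) by move=> [y X]; exact: cvg_fst.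
have c2 : continuous (fun y : AN => y.2) by move=> [y X]; exact: cvg_snd.
have c11 : continuous (fun y : R * 'rV[R]_p => y.1) by move=> [s U]; exact: cvg_fst.
have c12 : continuous (fun y : R * 'rV[R]_p => y.2) by move=> [s U]; exact: cvg_snd.
rewrite inE mem_cat => /or3P[/eqP ->|/mapP[j _ ->]|/mapP[j _ ->]] /=.
- by split=> [//|y]; exact: (cvg_comp _ _ (c1 y) (c11 _)).
- split=> [a y z|y]; first by rewrite /= !mxE.
  exact: (cvg_comp _ _ (cvg_comp _ _ (c1 y) (c12 _)) (@coord_continuous _ _ _ 0 j _)).
- split=> [a y z|y]; first by rewrite /= !mxE.
  exact: (cvg_comp _ _ (c2 y) (@coord_continuous _ _ _ 0 j _)).
Qed.

End Coordinates.

(** * Arbitrary unit normal fields *)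

Section UnitNormals.
Context {R : realType} {p m : nat} (H : genHeisenberg R p m).
Variable w : {vspace 'rV[R]_p}.
Local Notation AN := (R * 'rV[R]_p * 'rV[R]_m)%type.
Local Notation g := (metric H).
Variable r : R.
Hypothesis r_gt0 : 0 < r.
Local Notation M := (level H w (2 * sh r)).
Local Notation nu := (nu H w r).
Variable nu' : AN -> AN.
Hypothesis nu'P : unit_normal_field g M nu'.
Implicit Types (x u v : AN).

(** The part of [nu' x] orthogonal to [nu x] is tangent by [tangent_nuP], hence orthogonal to both
    normals and so to itself. *)
Lemma unit_normal_sign x : M x -> exists2 l : R, l ^+ 2 = 1 & nu' x = l *: nu x.
Proof.
move=> xM; have [n1 n2] := nu'P.2 x xM; have nn := metric_nu_nu r_gt0 xM.
pose l := g x (nu' x) (nu x); pose d := nu' x + (- l) *: nu x.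
have dn : g x d (nu x) = 0 by rewrite metricDl metricZl nn mulr1 subrr.
have dt : tangent M x d by apply/(tangent_nuP r_gt0 _ xM).
have dd : g x d d = 0.
  by rewrite {1}/d metricDl metricZl (n2 _ dt) metricC dn mulr0 addr0.
have nE : nu' x = l *: nu x.
  by have /eqP := metric_eq0 dd; rewrite /d scaleNr subr_eq0 => /eqP.
by exists l => //; rewrite -n1 nE metricZl metricC metricZl nn mulr1 expr2.
Qed.

(** By continuity the sign in [unit_normal_sign] is constant along a curve in the
    tube near [x]. *)
Lemma derive_unit_normal x u (l : R) : M x -> tangent M x u -> l ^+ 2 = 1 ->
  nu' x = l *: nu x -> 'D_u nu' x = l *: 'D_u nu x.
Proof.
move=> xM [c [cM c0 cD]] l1 xl; have [B [Bo MB nuS]] := nu'P.1.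
have t0 := tau_gt0 r_gt0.
have cc : {for 0, continuous c}.
  by apply: differentiable_continuous; apply/derivable1_diffP; exact: ex_derive.
have Bx : B x by exact: MB.
have near_l : \forall t \near (0 : R), nu' (c t) = l *: nu (c t).
  have fc : {for 0, continuous (fun t => (nu' (c t)).1.1)}.
    have nc := (nuS 0).1 x Bx; rewrite -c0 in nc.
    have [_ L] := @AN_coord_linear R p m (1, 0, 0, fun y => y.1.1) (mem_head _ _).
    exact: (cvg_comp _ _ (cvg_comp _ _ cc nc) (L _)).
  (* The first component of [nu] is the nonzero constant [- tau]; a change of sign would move it by
     [2 * tau], beyond the tolerance [tau]. *)
  have /cvgrPdist_lt/(_ _ t0) := fc; apply: filterS => t.
  rewrite c0 xl; have [l' l'1 ->] := unit_normal_sign (cM t).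
  have pm (a : R) : a ^+ 2 = 1 -> a = 1 \/ a = -1.
    by move=> /eqP; rewrite sqrf_eq1 => /orP[/eqP ->|/eqP ->]; [left|right].
  case: (pm _ l1) => ->; case: (pm _ l'1) => -> //=; rewrite /GRing.scale /= => E; exfalso.
    by move: E; rewrite ltr_norml => /andP[]; lra.
  by move: E; rewrite ltr_norml => /andP[]; lra.
(* The two fields are known to agree only along [c]; the chain rule carries this to the directional
   derivatives at [x], one coordinate at a time. *)
have coordE b : b \in AN_coord -> b.2 ('D_u nu' x) = b.2 (l *: 'D_u nu x).
  move=> bs; have [Ll Lc] := AN_coord_linear bs.
  have D1 := C1_chain_rule AN_coordP Bo (f := b.2 \o nu') (c := c).
  rewrite c0 in D1; have {}D1 := D1 _ Bx (Ck1_linear_comp Bo Ll Lc (nuS 1)) cD.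
  have D2 := C1_chain_rule AN_coordP openT (f := b.2 \o nu) (c := c).
  rewrite c0 in D2.
  have {}D2 := D2 _ I (Ck1_linear_comp openT Ll Lc (nu_smooth H w r 1)) cD.
  have D3 := is_derive_scalef l D2.
  have E1 : 'D_u (b.2 \o nu') x = b.2 ('D_u nu' x).
    have D := is_derive_linear Ll Lc (derivableP (((nuS 1).2 u).1 x Bx)).
    exact: derive_val.
  have E2 : 'D_u (b.2 \o nu) x = b.2 ('D_u nu x).
    have D := is_derive_linear Ll Lc (derivableP (((nu_smooth H w r 1).2 u).1 x I)).
    exact: derive_val.
  have b0 : b.2 0 = 0.
    by move: (Ll 1 0 0); rewrite scaler0 scale1r addr0 => /esym/eqP; rewrite -subr_eq0 addrK => /eqP.
  have bZ v : b.2 (l *: v) = l *: b.2 v by have := Ll l v 0; rewrite b0 !addr0.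
  rewrite bZ; apply: etrans (esym E1) _; apply: etrans _ (congr1 ( *:%R l) E2).
  apply: etrans (esym (@derive_val _ _ _ _ _ _ _ D1)) (etrans _ (@derive_val _ _ _ _ _ _ _ D3)).
  apply: near_eq_derive.
  by apply: filterS near_l => t /= ->; rewrite bZ.
have [E _] := @AN_coordP R p m.
rewrite [LHS]E [RHS]E !big_seq; apply: eq_bigr => b bs.
by rewrite (coordE _ bs).
Qed.

Lemma shape_unit_normal x u (l : R) : M x -> tangent M x u -> l ^+ 2 = 1 ->
  nu' x = l *: nu x -> Defs.shape g nu' x u = l *: Defs.shape g nu x u.
Proof.
move=> xM ut l1 xl; rewrite /Defs.shape /nabla (derive_unit_normal xM ut l1 xl) xl !christoffelE.
by rewrite chrisZr -scalerDr scalerN.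
Qed.

End UnitNormals.

(** * An isometric frame of the tangent spaces *)

Section Frame.
Context {R : realType} {p m : nat} (H : genHeisenberg R p m).
Variable w : {vspace 'rV[R]_p}.
Local Notation AN := (R * 'rV[R]_p * 'rV[R]_m)%type.
Local Notation g := (metric H).
Local Notation pi := (projp H w).
Variable r : R.
Hypothesis r_gt0 : 0 < r.
Local Notation k := (2 * sh r).
Local Notation M := (level H w k).
Local Notation tau := (tube_tau r).
Local Notation sigma := (tube_sigma r).
Local Notation rho := (tube_rho r).
Local Notation nu := (nu H w r).
Implicit Types (x u v : AN) (a b : 'rV[R]_(p + m)).

Let k0 : k != 0. Proof. by rewrite mulf_neq0 // gt_eqF // sh_gt0. Qed.
Let s0 : sigma != 0. Proof. by rewrite gt_eqF // sigma_gt0. Qed.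

Definition hexp x : R := expR (2^-1 * x.1.1).

Let hexp_sqr x : hexp x ^+ 2 = expR x.1.1.
Proof. by rewrite /hexp -expRM_natr; congr expR; field. Qed.

Let hexp0 x : hexp x != 0. Proof. by rewrite gt_eqF // expR_gt0. Qed.

Let expN x : expR (- x.1.1) = (hexp x ^+ 2)^-1.
Proof. by rewrite expRN hexp_sqr. Qed.

(** The direction of the geodesic from [S_grp H w] to [x]. *)
Definition xi x : 'rV[R]_p := (k * hexp x)^-1 *: pi x.1.2.

Lemma xi_perp x : xi x \in vperp H w.
Proof. by rewrite memvZ // projp_vperp. Qed.

Lemma xi_unit x : M x -> ipv H (xi x) (xi x) = 1.
Proof.
rewrite /xi !ipvE => ->; rewrite -hexp_sqr.
by have h := hexp0 x; field; rewrite h gt_eqF ?sh_gt0.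
Qed.

Let pi_xi x : pi x.1.2 = (k * hexp x) *: xi x.
Proof. by rewrite /xi scalerA divff ?scale1r // mulf_neq0. Qed.

Definition frame_v x a : 'rV[R]_p :=
  lsubmx a + ((tau - 1) * ipv H (lsubmx a) (xi x)) *: xi x.

(** An isometry of v + z onto the tangent space of the tube at [x]: it maps
    [xi x] to the unit tangent vector [sigma B + tau xi] and is the identity on
    the orthogonal complement of [xi x], in the left-invariant frame. *)
Definition frame x a : AN :=
  (sigma * ipv H (lsubmx a) (xi x), hexp x *: frame_v x a,
   hexp x ^+ 2 *: rsubmx a + 2^-1 *: beta H x.1.2 (hexp x *: frame_v x a)).

Lemma vert_frame x a : vert H x (frame x a) = hexp x ^+ 2 *: rsubmx a.
Proof. by rewrite /vert /= addrK. Qed.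

Lemma ip_shape_xi (t s q : R) (X V : 'rV[R]_p) (Z : 'rV[R]_m) :
  X \in vperp H w -> ipv H X X = 1 ->
  ipv H (shape_v H w t q X V - s *: J H Z X) X = t / 2 * ipv H V X.
Proof.
move=> Xp X1; rewrite /shape_v !ipvE J_self projp_sa (projp_id Xp) X1; ring.
Qed.

Section AtPoint.
Variable x : AN.
Hypothesis xM : M x.

Lemma ipv_frame_xi a : ipv H (frame_v x a) (xi x) = tau * ipv H (lsubmx a) (xi x).
Proof.
rewrite /frame_v; move: (xi x) (xi_unit xM) => X X1.
by rewrite !ipvE X1; ring.
Qed.

Lemma frame_metric a b : g x (frame x a) (frame x b) = ipn H a b.
Proof.
rewrite /metric !vert_frame /= expN /ipn.
have -> : ipv H (hexp x *: frame_v x a) (hexp x *: frame_v x b) = hexp x ^+ 2 *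
    (ipv H (lsubmx a) (lsubmx b)
     + (tau ^+ 2 - 1) * ipv H (lsubmx a) (xi x) * ipv H (lsubmx b) (xi x)).
  rewrite /frame_v; move: (xi x) (xi_unit xM) (lsubmx a) (lsubmx b) => X X1 A B.
  by rewrite !ipvE X1 [ipv H X B]ipvC; ring.
(* The contraction of [xi x] by [tau] is compensated by the component [sigma] along B. *)
have -> : tau ^+ 2 - 1 = - sigma ^+ 2 by rewrite -(tau_sigma r); ring.
by rewrite !ipzE; have h := hexp0 x; field.
Qed.

Lemma frame_tangent a : tangent M x (frame x a).
Proof.
apply/(tangent_levelP _ k0 xM); rewrite /= pi_xi projpZ.
rewrite ipvZl ipvZr [ipv H (xi x) _]ipvC projp_sa (projp_id (xi_perp x)) ipv_frame_xi.
rewrite -hexp_sqr; have := sigma_radius r; set K := k => E.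
transitivity (hexp x ^+ 2 * K * ipv H (lsubmx a) (xi x) * (2 * tau)); first ring.
by rewrite -E; ring.
Qed.

Lemma frame_lin (l : R) a b : frame x (l *: a + b) = l *: frame x a + frame x b.
Proof.
have lE : lsubmx (l *: a + b) = l *: lsubmx a + lsubmx b by rewrite linearD linearZ.
have rE : rsubmx (l *: a + b) = l *: rsubmx a + rsubmx b by rewrite linearD linearZ.
have fv : frame_v x (l *: a + b) = l *: frame_v x a + frame_v x b.
  rewrite /frame_v lE ipv_lin.
  by apply/rowP => j; rewrite !mxE; ring.
rewrite /frame fv lE rE ipv_lin.
transitivity ((l * (sigma * ipv H (lsubmx a) (xi x)) + sigma * ipv H (lsubmx b) (xi x),
  l *: (hexp x *: frame_v x a) + hexp x *: frame_v x b,
  l *: (hexp x ^+ 2 *: rsubmx a + 2^-1 *: beta H x.1.2 (hexp x *: frame_v x a)) +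
  (hexp x ^+ 2 *: rsubmx b + 2^-1 *: beta H x.1.2 (hexp x *: frame_v x b))) : AN) => //.
congr (_, _, _); first ring.
  by apply/rowP => j; rewrite !mxE; ring.
by rewrite !betaE; apply/rowP => j; rewrite !mxE; ring.
Qed.

Lemma frame_surj u : tangent M x u -> exists a, u = frame x a.
Proof.
move=> /(tangent_levelP _ k0 xM); rewrite pi_xi ipvZl -(projp_sa H w) (projp_id (xi_perp x)).
rewrite ipvC -hexp_sqr => E.
(* [c] is the coefficient of [u] on the unit vector sigma B + tau xi; [V'] below undoes the
   contraction by [tau]. *)
pose V := (hexp x)^-1 *: u.1.2; pose c := u.1.1 / sigma.
have Vx : ipv H V (xi x) = tau * c.
  have kn := k0; have hn := hexp0 x; have sn := s0.
  rewrite /V ipvZl /c; apply: (mulfI (mulf_neq0 kn (mulf_neq0 (expf_neq0 2 hn) sn))).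
  transitivity (sigma * (2 * (k * hexp x * ipv H u.1.2 (xi x))) / 2); first by field.
  rewrite E; transitivity (u.1.1 * k * hexp x ^+ 2 * (sigma * k) / 2); first by field.
  by rewrite (sigma_radius r); field.
pose V' := V + ((1 - tau) * c) *: xi x.
have V'x : ipv H V' (xi x) = c by rewrite /V' ipvDl Vx ipvZl xi_unit //; ring.
exists (row_mx V' ((hexp x ^+ 2)^-1 *: vert H x u)).
rewrite /frame /frame_v row_mxKl row_mxKr V'x.
have -> : V' + ((tau - 1) * c) *: xi x = V.
  by rewrite /V'; apply/rowP => j; rewrite !mxE; ring.
rewrite /V !scalerA !divff ?expf_neq0 // !scale1r /vert subrK /c mulrC divfK //.
by case: u {E V c Vx V' V'x} => [[? ?] ?].
Qed.

(** The covariant derivative of [nu] is explicit by [derive_nu] and [christoffelE]. Its last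
    component is half a [beta] of the middle one plus a vertical part, so the middle component is
    settled first, in [E2]. *)
Lemma shape_frame a :
  Defs.shape g nu x (frame x a) = - frame x (a *m shape_mx H w tau sigma rho (xi x)).
Proof.
rewrite /Defs.shape /nabla; congr (- _); rewrite christoffelE.
have D := derive_nu H w r x (frame x a); rewrite (@derive_val _ _ _ _ _ _ _ D).
rewrite /chris /chris_v vert_frame vert_nu J_0 addr0 ipz0r mulr0 addr0 scaler0 add0r.
rewrite /frame /frame_v /=; move: (pi_xi x) (xi_unit xM) (xi_perp x) => pU.
rewrite pU; move: (xi x) => X X1 Xp.
have pX := projp_id Xp.
have JZ Y U (l : R) : J H Y (l *: U) = l *: J H Y U by exact: linearZ.
have rn : rho != 0 by rewrite gt_eqF // rho_gt0.
have hn := hexp0 x.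
(* The radius and [tau] are expressed by [sigma] and [rho], so that no relation between the
   constants is left for [field]. *)
have kE : k = sigma / rho by rewrite -(rho_radius r_gt0); field.
have tE : tau = sigma ^+ 2 / (2 * rho).
  by rewrite -(rho_tau r_gt0); field.
have aE : a = row_mx (lsubmx a) (rsubmx a) by rewrite hsubmxK.
rewrite [X in lsubmx (X *m _)]aE [X in rsubmx (X *m _)]aE mul_shape_mx row_mxKl row_mxKr.
rewrite (ip_shape_xi _ _ _ _ _ Xp X1); move: (lsubmx a) (rsubmx a) => V Z {aE D}.
set c := ipv H V X; set W := hexp x *: (V + _); set G := - _ - _.
have pW : pi W = hexp x *: (pi V + ((tau - 1) * c) *: X).
  by rewrite /W projpZ projpD projpZ pX.
have WX : ipv H W X = hexp x * (tau * c) by rewrite /W ipvZl ipvDl ipvZl X1 -/c; ring.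
set T' := hexp x *: (shape_v _ _ _ _ _ _ - _ + _).
have E2 : rho *: pi W + G = T'.
  rewrite pW /G /W /T' J_Zl !JZ expN /shape_v -/c kE tE.
  by apply/rowP => j; rewrite !mxE; field; rewrite ?rn ?hn.
transitivity ((2^-1 * expR (- x.1.1) * ipv H W (rho *: ((k * hexp x) *: X)),
  rho *: pi W + G,
  (2^-1 * rho) *: beta H W ((k * hexp x) *: X) + tau *: (hexp x ^+ 2 *: Z)
   + 2^-1 *: beta H x.1.2 (rho *: pi W + G)) : AN).
  transitivity ((0 + 2^-1 * expR (- x.1.1) * ipv H W (rho *: ((k * hexp x) *: X)),
    rho *: pi W + G,
    (2^-1 * rho) *: (beta H W ((k * hexp x) *: X) + beta H x.1.2 (pi W))
    + (- (- tau *: (hexp x ^+ 2 *: Z)) + 2^-1 *: beta H x.1.2 G)) : AN) => //.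
  rewrite add0r; congr (_, _, _).
  rewrite (betaDr H x.1.2 (rho *: pi W) G) (betaZr H rho x.1.2 (pi W)).
  by apply/rowP => j; rewrite !mxE; ring.
rewrite E2; congr (_, _, _ + _).
  by rewrite !ipvZr WX expN kE tE; field; rewrite ?rn ?hn.
rewrite /W !(betaE, betaxx, scaler0, addr0) kE.
by apply/rowP => j; rewrite !mxE; field; rewrite ?rn ?hn.
Qed.

Lemma frame0 : frame x 0 = 0.
Proof.
have := frame_lin 1 0 0; rewrite !scale1r addr0 => /esym/eqP.
by rewrite -subr_eq0 addrK => /eqP.
Qed.

Lemma frameZ (l : R) a : frame x (l *: a) = l *: frame x a.
Proof. by rewrite -[l *: a]addr0 frame_lin frame0 addr0. Qed.

Lemma frame_inj : injective (frame x).
Proof.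
move=> a b ab; apply/eqP; rewrite -subr_eq0 addrC; apply/negPn/negP => /(ipn_gt0 H).
by rewrite -scaleN1r -frame_metric frame_lin ab scaleN1r addNr -(scale0r (0 : AN)) metricZl
  mul0r ltxx.
Qed.

Lemma frame_sum n (c : 'I_n -> R) (e : 'I_n -> 'rV[R]_(p + m)) :
  frame x (\sum_i c i *: e i) = \sum_i c i *: frame x (e i).
Proof.
have f0 := frame0.
elim: (index_enum _) => [|i s IH]; first by rewrite !big_nil.
by rewrite !big_cons frame_lin IH.
Qed.

Lemma frame_onb (e : 'I_(p + m) -> 'rV[R]_(p + m)) :
  (forall i j, ipn H (e i) (e j) = (i == j)%:R) ->
  tangent_onb g M x (fun i => frame x (e i)).
Proof.
move=> eO; split=> [i|i j|u /frame_surj[a ->]]; first exact: frame_tangent.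
  by rewrite frame_metric eO.
transitivity (\sum_i ipn H a (e i) *: frame x (e i)).
  by rewrite -frame_sum -(orthonormal_expand (@ipn_lin _ _ _ H) a eO).
by apply: eq_bigr => i _; rewrite frame_metric.
Qed.

(** Orthonormality gives [n <= p + m]. If [n] were smaller, a nonzero vector orthogonal to all [e j]
    would have an image under [frame] whose expansion in the basis is zero. *)
Lemma onb_frame n (f : 'I_n -> AN) : tangent_onb g M x f ->
  n = (p + m)%N /\ exists e : 'I_n -> 'rV[R]_(p + m),
    (forall i, f i = frame x (e i)) /\ forall i j, ipn H (e i) (e j) = (i == j)%:R.
Proof.
move=> [ft fO fspan].
have [e eE] := boolp.choice (fun i => frame_surj (ft i)).
have eO i j : ipn H (e i) (e j) = (i == j)%:R by rewrite -frame_metric -!eE fO.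
split; last by exists e.
have := orthonormal_row_free (@ipn_lin _ _ _ H) eO; rewrite /row_free => /eqP rk.
apply/eqP; rewrite eqn_leq -{1}rk rank_leq_col /=.
rewrite leqNgt; apply/negP => lt.
pose Q : 'M[R]_(p + m, n) := \matrix_(i, j) ipn H (delta_mx 0 i) (e j).
have [u [u0 uQ]] : exists u : 'rV[R]_(p + m), u != 0 /\ u *m Q = 0.
  have : kermx Q != 0.
    by rewrite -mxrank_eq0 mxrank_ker subn_eq0 -ltnNge (leq_ltn_trans (rank_leq_col _)).
  by move=> /rowV0Pn[u /sub_kermxP uQ u0]; exists u.
have ue j : ipn H u (e j) = 0.
  rewrite {1}(row_sum_delta u) (ip_sum (@ipn_lin _ _ _ H)).
  have := congr1 (fun v : 'rV[R]_n => v 0 j) uQ; rewrite !mxE => uQj.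
  apply: etrans uQj; apply: eq_bigr => i _; rewrite mxE -[_ *: _]addr0 ipn_lin.
  by rewrite /ipn !linear0 ipv0l ipz0l !addr0.
move/eqP: u0; apply; apply: frame_inj.
rewrite frame0 (fspan _ (frame_tangent u)) big1 // => i _.
by rewrite eE frame_metric ue scale0r.
Qed.

End AtPoint.
End Frame.

(** * Isoparametricity and principal curvatures *)

Section MainProof.
Context {R : realType} {p m : nat} (H : genHeisenberg R p m).
Variable w : {vspace 'rV[R]_p}.
Hypothesis w_proper : w != fullv.
Local Notation AN := (R * 'rV[R]_p * 'rV[R]_m)%type.
Local Notation g := (metric H).
Implicit Types (x u v : AN).

Section Radius.
Variable r : R.
Hypothesis r_gt0 : 0 < r.
Local Notation k := (2 * sh r).
Local Notation M := (level H w k).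
Local Notation nu := (nu H w r).
Local Notation A := (shape_mx H w (tube_tau r) (tube_sigma r) (tube_rho r)).

Let k0 : k != 0. Proof. by rewrite mulf_neq0 // gt_eqF // sh_gt0. Qed.

Lemma mean_curvature_level x : M x -> mean_curvature g M nu x (- \tr (A (xi H w r x))).
Proof.
move=> xM.
have [e eO] := orthonormal_basis_exists (@ipn_lin _ _ _ H) (ipnC H) (@ipn_gt0 _ _ _ H).
exists (p + m)%N, (fun i => frame H w r x (e i)); split; first exact: frame_onb.
rewrite -(orthonormal_trace (@ipn_lin _ _ _ H) _ eO) -sumrN; apply: eq_bigr => i _.
by rewrite shape_frame // -[in RHS]scaleN1r metricZl mulN1r frame_metric.
Qed.

Lemma constant_mean_curvature_level : constant_mean_curvature g M.
Proof.
exists nu; split; first exact: unit_normal_nu.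
exists (- (tube_tau r / 2 * p%:R + tube_rho r * (\tr (lin1_mx (projp H w)) - 1) + tube_tau r * m%:R)).
move=> x xM; have := mean_curvature_level xM.
by rewrite trace_shape_mx ?xi_perp ?xi_unit.
Qed.

(** Transfers constancy over the points of the tube to constancy over all unit directions [X]. *)
Lemma level_point (X : 'rV[R]_p) : X \in vperp H w -> ipv H X X = 1 ->
  exists2 x, M x & xi H w r x = X.
Proof.
move=> Xp X1; exists (0, k *: X, 0).
  by rewrite /level /= projpZ (projp_id Xp) !ipvE X1 expR0; ring.
by rewrite /xi /hexp /= mulr0 expR0 mulr1 projpZ (projp_id Xp) scalerA mulVf // scale1r.
Qed.

(** [d'] is [d] reindexed along [n = p + m], related to it by values to avoid a cast. The factor
    [- l] combines the sign of [nu'] with the one in [shape_frame]. *)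
Lemma principal_curvatures_spectrum nu' x (l : R) n (d : 'I_n -> R) :
  unit_normal_field g M nu' -> M x -> l ^+ 2 = 1 -> nu' x = l *: nu x ->
  principal_curvatures g M nu' x d ->
  n = (p + m)%N /\ forall d' : 'I_(p + m) -> R,
    (forall (i : 'I_n) (j : 'I_(p + m)), i = j :> nat -> d i = d' j) ->
    has_spectrum (ipn H) (A (xi H w r x)) (fun i => - l * d' i).
Proof.
move=> nuP xM l1 xl [f [fO fd]]; have [nE [e [fe eO]]] := onb_frame r_gt0 xM fO.
split=> // d' dd'; subst n; exists e; split=> // i; apply: (frame_inj r_gt0 xM).
rewrite frameZ // -fe -(dd' i i erefl) -scalerA -fd.
have [ft _ _] := fO.
rewrite (shape_unit_normal r_gt0 nuP xM (ft i) l1 xl) scalerA mulNr -expr2 l1 fe.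
by rewrite shape_frame // scaleN1r opprK.
Qed.

(** An arbitrary unit normal field is [l x *: nu x] with a sign [l x] that may vary
    over the tube; constant principal curvatures fix it through the trace, which is
    positive. *)
Lemma constant_principal_curvatures_level :
  constant_principal_curvatures g M <->
  (exists c, forall X, X \in vperp H w -> ipv H X X = 1 -> has_spectrum (ipn H) (A X) c).
Proof.
split=> [[nu' [nuP [n [d dP]]]]|[c cP]]; last first.
  exists nu; split; first exact: unit_normal_nu.
  exists (p + m)%N, (fun i => - c i) => x xM.
  have [e [eO eA]] := cP _ (xi_perp H w r x) (xi_unit r_gt0 xM).
  exists (fun i => frame H w r x (e i)); split; first exact: frame_onb.
  by move=> i; rewrite shape_frame // eA frameZ // scaleNr.
have [X0 [X0p X01]] := unit_vperp_exists H w_proper.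
have [x0 x0M x0X] := level_point X0p X01.
have [l0 l01 l0E] := unit_normal_sign r_gt0 nuP x0M.
have [nE _] := principal_curvatures_spectrum nuP x0M l01 l0E (dP _ x0M).
subst n; pose S := \sum_i d i; pose T := \tr (A X0).
have T0 : 0 < T.
  by apply: trace_shape_mx_gt0 => //; [exact: tau_gt0|exact: rho_gt0].
(* [T] is the trace of every [A X] and equals [- l * S], so [T / S] is the sign [- l], now visibly
   the same for all [X]. *)
exists (fun i => T / S * d i) => X Xp X1.
have [x xM xX] := level_point Xp X1.
have [l l1 lE] := unit_normal_sign r_gt0 nuP xM.
have [_ /(_ d)] := principal_curvatures_spectrum nuP xM l1 lE (dP _ xM).
rewrite xX => /(_ (fun i j ij => congr1 d (val_inj ij))) sp.
suff <- : - l = T / S by [].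
have TE : T = - l * S.
  have [e [eO eA]] := sp.
  have -> : T = \tr (A X) by rewrite /T !trace_shape_mx.
  rewrite -(orthonormal_trace (@ipn_lin _ _ _ H) _ eO) mulr_sumr; apply: eq_bigr => i _.
  rewrite eA -[_ *: _]addr0 ipn_lin eO eqxx mulr1 /ipn !linear0 ipv0l ipz0l.
  by rewrite !addr0.
have S0 : S != 0 by apply/eqP => S0; move: T0; rewrite TE S0 mulr0 ltxx.
by rewrite TE mulfK.
Qed.

End Radius.

Lemma isoparametric_level r : 0 < r -> isoparametric_hypersurface g (level H w (2 * sh r)).
Proof.
have hyp t : 0 < t -> hypersurface (level H w (2 * sh t)).
  by move=> t0; apply: hypersurface_level => //; rewrite mulf_neq0 // gt_eqF // sh_gt0.
move=> r0; split; [exact: hyp|exact: constant_mean_curvature_level|].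
exists (nu H w r); split; first exact: unit_normal_nu.
(* The bound [r] keeps [r + t] positive, so the parallel sets do not reach [S_grp H w]. *)
exists r => // t; rewrite ltr_norml => /andP[tr _].
have rt : 0 < r + t by lra.
rewrite parallel_level //; split; [exact: hyp|exact: constant_mean_curvature_level].
Qed.

End MainProof.

Theorem theorem4p5 (R : realType) (p m : nat) (H : genHeisenberg R p m)
  (w : {vspace 'rV[R]_p}) (w_proper : w != fullv) (r : R) (r_gt0 : 0 < r) :
  let M := tube (dr_metric H) (S_grp H w) r in
  isoparametric_hypersurface (dr_metric H) M /\
  (constant_principal_curvatures (dr_metric H) M <->
   constant_generalized_kahler_angle H w).
Proof.
rewrite dr_metric_metric (tube_level _ _ r_gt0) => M.
split; first exact: isoparametric_level.
rewrite constant_principal_curvatures_level // -(constant_kahler_spectrum H w_proper).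
apply: constant_shape_spectrum => //; rewrite gt_eqF //.
  exact: sigma_gt0.
exact: rho_gt0.
Qed.
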